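(* Let $\nu<1$ with $\nu\neq 0$, let $1\le p<\infty$ and $\delta\in\mathbb{R}$. Then the maximal operator $\widetilde{W}_*^{\nu}$, considered on the measure space $(\mathbb{R}_+,x^{\delta}dx)$, has the following mapping properties: (a) $\widetilde{W}_*^{\nu}$ is of strong type $(p,p)$ if and only if $p>1$ and $2\nu p-1<\delta<2p-1$; (b) $\widetilde{W}_*^{\nu}$ is of weak type $(p,p)$ if and only if $2\nu p-1\le\delta<2p-1$, with the second inequality replaced by $\delta\le 2p-1$ in case $p=1$; (c) $\widetilde{W}_*^{\nu}$ is of restricted weak type $(p,p)$ if and only if $2\nu p-1\le\delta\le 2p-1$. Moreover, $\widetilde{W}_*^{\nu}$ is of strong type $(\infty,\infty)$ if and only if $\nu<0$.
   Context: Notation: $\mathbb{R}_+=(0,\infty)$ and $d\eta_{\nu}(x)=x^{2\nu+1}dx$ on $\mathbb{R}_+$. For $\mu>-1$ let $I_{\mu}$ be the modified Bessel function of the first kind of order $\mu$ and $$W_t^{\mu}(x,y)=\frac{1}{2t}(xy)^{-\mu}e^{-(x^2+y^2)/4t}I_{\mu}\Big(\frac{xy}{2t}\Big),\qquad t,x,y>0$$ (the classical Bessel heat kernel). For $\nu<1$ the exotic Bessel heat kernel is $\widetilde{W}_t^{\nu}(x,y)=(xy)^{-2\nu}W_t^{-\nu}(x,y)$, and $$\widetilde{W}_t^{\nu}f(x)=\int_0^{\infty}\widetilde{W}_t^{\nu}(x,y)f(y)\,d\eta_{\nu}(y),\qquad \widetilde{W}_*^{\nu}f(x)=\sup_{t>0}\big|\widetilde{W}_t^{\nu}f(x)\big|,\qquad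 x>0.$$ The operator is considered on its natural domain (functions for which the defining integrals converge); mapping properties include that the operator is well defined on the functions in question. Terminology, for an operator $T$ and $1\le p<\infty$: $T$ is of strong type $(p,p)$ with respect to $(\mathbb{R}_+,x^{\delta}dx)$ if it is bounded on $L^p(\mathbb{R}_+,x^{\delta}dx)$; strong type $(\infty,\infty)$ means boundedness on $L^{\infty}(\mathbb{R}_+)$. $T$ is of weak type $(p,p)$ if there is a constant $C$ such that $\lambda^p\int_{\{y>0:|Tf(y)|>\lambda\}}x^{\delta}dx\le C\int_0^{\infty}|f(x)|^px^{\delta}dx$ for all $\lambda>0$ and all $f\in L^p(\mathbb{R}_+,x^{\delta}dx)$. $T$ is of restricted weak type $(p,p)$ if this weak type inequality holds (with a uniform constant) for all $f$ that are characteristic functions of sets of finite $x^{\delta}dx$ measure. *)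

(* Defs.v *)
From HB Require Import structures.
From mathcomp Require Import all_boot all_order all_algebra.
From mathcomp Require Import all_classical all_reals all_analysis.
From mathcomp Require Import measurable_realfun.

Set Implicit Arguments.
Unset Strict Implicit.
Unset Printing Implicit Defensive.
Import Order.TTheory GRing.Theory Num.Theory.
Import numFieldNormedType.Exports.

Local Open Scope classical_set_scope.
Local Open Scope ring_scope.

Notation Rpos := (`]0%R, +oo[%classic).

Section special_functions.
Context {R : realType}.
Implicit Types s mu z : R.

(* Only meaningful for 0 < s. *)
Definition Gamma s : R :=
  \int[lebesgue_measure]_(u in Rpos) (u `^ (s - 1) * expR (- u)).

Definition besselI_coeff mu z (k : nat) : R :=
  (z / 2) `^ (2 * k%:R + mu) / (k`!%:R * Gamma (k%:R + mu + 1)).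

(* Modified Bessel function of the first kind, for -1 < mu and 0 < z. *)
Definition besselI mu z : R := limn (series (besselI_coeff mu z)).

End special_functions.

(* The measure x^delta dx on (0, +oo), viewed as a measure on the whole real
   line that does not charge ]-oo, 0]. *)
Section power_measure.
Context {R : realType} (delta : R).

Definition power_measure (A : set (measurableTypeR R)) : \bar R :=
  (\int[lebesgue_measure]_(x in A `&` Rpos) (x `^ delta)%:E)%E.

Let power_measure0 : power_measure set0 = 0%E.
Proof. by rewrite /power_measure set0I integral_set0. Qed.

Let power_measure_ge0 A : (0 <= power_measure A)%E.
Proof. by apply: integral_ge0 => x _; rewrite lee_fin powR_ge0. Qed.

Let power_measure_sigma_additive : semi_sigma_additive power_measure.
Proof.
move=> F mF tF mUF; rewrite /power_measure setI_bigcupl.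
have mFI i : measurable (F i `&` Rpos : set (measurableTypeR R)).
  by apply: measurableI => //; exact: measurable_itv.
apply: (@semi_sigma_additive_nng_induced _ _ R lebesgue_measure
  (fun x => (x `^ delta)%:E) _ _ (fun i => F i `&` Rpos)) => //.
- exact: measurableT_comp (measurable_powR _).
- by move=> x; rewrite lee_fin powR_ge0.
- exact: trivIset_setIr.
- exact: bigcup_measurable.
Qed.

HB.instance Definition _ := isMeasure.Build _ _ _ power_measure
  power_measure0 power_measure_ge0 power_measure_sigma_additive.

End power_measure.

(* T is an operator with domain D; each of the three mapping properties below
   requires T f to be defined and measurable for every f it quantifies over. *)
Section operator_types.
Context d (X : measurableType d) (R : realType).
Variable mu : {measure set X -> \bar R}.
Variables (D : set (X -> R)) (T : (X -> R) -> (X -> \bar R)).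

Definition strong_type (p : \bar R) : Prop :=
  exists C : R, forall f : X -> R, f \in Lfun mu p ->
    [/\ D f, measurable_fun [set: X] (T f) &
        ('N[mu]_p[T f] <= C%:E * 'N[mu]_p[EFin \o f])%E].

Definition weak_type_ineq (p C : R) (f : X -> R) : Prop :=
  forall lambda : R, 0 < lambda ->
    ((lambda `^ p)%:E * mu [set y | lambda%:E < `|T f y|]
      <= C%:E * \int[mu]_y (`|f y| `^ p)%:E)%E.

Definition weak_type (p : R) : Prop :=
  exists C : R, forall f : X -> R, f \in Lfun mu p%:E ->
    [/\ D f, measurable_fun [set: X] (T f) & weak_type_ineq p C f].

Definition restricted_weak_type (p : R) : Prop :=
  exists C : R, forall E : set X, measurable E -> (mu E < +oo)%E ->
    [/\ D (\1_E), measurable_fun [set: X] (T \1_E) & weak_type_ineq p C (\1_E)].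

End operator_types.

(* Functions on (0, +oo) are represented by functions on R; the values of the
   input outside (0, +oo) are never used. *)
Section exotic_bessel.
Context {R : realType}.
Implicit Types mu nu t x y : R.

Definition bessel_kernel mu t x y : R :=
  (2 * t)^-1 * (x * y) `^ (- mu) * expR (- (x ^+ 2 + y ^+ 2) / (4 * t))
  * besselI mu (x * y / (2 * t)).

Definition exotic_kernel nu t x y : R :=
  (x * y) `^ (- (2 * nu)) * bessel_kernel (- nu) t x y.

Definition exotic_domain nu : set (measurableTypeR R -> R) :=
  [set f | forall t x, 0 < t -> 0 < x ->
    (power_measure (2 * nu + 1)).-integrable Rpos
      (fun y => (exotic_kernel nu t x y * f y)%:E)].

Definition exotic_semigroup nu t (f : measurableTypeR R -> R) x : R :=
  \int[power_measure (2 * nu + 1)]_(y in Rpos) (exotic_kernel nu t x y * f y).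

(* Extended by 0 outside (0, +oo). *)
Definition exotic_maximal nu (f : measurableTypeR R -> R) :
    measurableTypeR R -> \bar R := fun x =>
  if 0 < (x : R) then
    ereal_sup [set (`|exotic_semigroup nu t f x|)%:E | t in Rpos]
  else 0%E.

End exotic_bessel.

(* Main.v *)
(* Up to constants, the kernel of the semigroup at time t = a^2 with respect to dy is
   at most y/x^2 for y < x/2, x^(-2 nu) y^(2 nu - 1) min(a/y, y/a)^(2 - 2 nu) for
   y > 2x, and a Gaussian of width a plus 1/x for y comparable to x.
   With b = (delta + 1)/p, the maximal operator is therefore controlled by x^(-b) times
   a multiplicative convolution of y^b |f(y)| with min(x/y, y/x)^e, which is bounded on
   L^p(dy/y), plus a local Hardy-Littlewood maximal function, which is of weak type (1,1) and
   strong type (p,p), p > 1, for every power weight.  One may take e > 0 exactly when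
   2 nu < b < 2; at b = 2 nu and b = 2 a term x^(-b) L(f) appears, with L(f) a norm of
   f, and x^(-b) is in weak L^p but not in L^p.  Necessity is tested on the indicator of
   [1, 2], on y^(-2) on [eps, 1], and on normalized indicators of [1, 1 + h]. *)
Require Import Defs.
From mathcomp Require Import all_boot all_order all_algebra.
From mathcomp Require Import all_classical all_reals all_analysis.
From mathcomp Require Import measurable_realfun ess_sup_inf.
From mathcomp Require Import ring lra.
Import Order.TTheory GRing.Theory Num.Theory.
Import numFieldNormedType.Exports HBNNSimple.
Local Open Scope classical_set_scope.
Local Open Scope ring_scope.

Set Implicit Arguments.
Unset Strict Implicit.
Unset Printing Implicit Defensive.

(** * Nonnegative integrals *)

(** Sharp constants are irrelevant, but uniformity is not: one constant must serve all t, x, y, so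
    the size of I_mu is needed on the whole half-line and not only asymptotically. It comes from
    comparing the Bessel series termwise with that of cosh: the quotient of the coefficients is a
    quotient of Pochhammer symbols, of order k^(-mu-1/2), and the cosh series at lam has its mass at
    k of order lam. Two obstacles concern the operator itself. Its natural domain asks for
    convergence at every t and x, while the estimates may be infinite wherever the local maximal
    function is; convergence is therefore obtained at one larger point v and carried down to x by an
    almost monotone dependence of the kernel on x. And the supremum over uncountably many t is
    measurable because it is lower semicontinuous. The assumption nu <> 0 acts twice: at b = 2 nu
    the function x^(-b) lies in weak L^p only if b <> 0, and for p = oo the test function yields
    only nu <= 0. *)

Section nonneg_integral.
Context d (X : measurableType d) (R : realType).
Variable mu : {measure set X -> \bar R}.
Local Open Scope ereal_scope.

(** Both sides are suprema of integrals of nonnegative simple functions lying below the integrand,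
    and a simple function below [f] is below [g]. Measurability plays no part in that argument. *)
Lemma ge0_integral_mono (D : set X) (f g : X -> \bar R) :
  (forall x, D x -> 0 <= f x) -> (forall x, D x -> f x <= g x) ->
  \int[mu]_(x in D) f x <= \int[mu]_(x in D) g x.
Proof.
move=> f0 fg; have g0 x : D x -> 0 <= g x by move=> Dx; exact: le_trans (f0 x Dx) (fg x Dx).
rewrite integral_mkcond [leRHS]integral_mkcond !ge0_integralTE; last 2 first.
- by move=> x; rewrite patchE; case: ifPn => // /set_mem/g0.
- by move=> x; rewrite patchE; case: ifPn => // /set_mem/f0.
apply: ereal_sup_le => _ [h hf <-] /=; exists h => // x.
apply: le_trans (hf x) _; rewrite !patchE; case: ifPn => // /set_mem; exact: fg.
Qed.

Lemma ge0_integral_subset (A B : set X) (f : X -> \bar R) :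
  (forall x, B x -> 0 <= f x) -> A `<=` B ->
  \int[mu]_(x in A) f x <= \int[mu]_(x in B) f x.
Proof.
move=> f0 AB; rewrite integral_mkcond [leRHS]integral_mkcond.
apply: ge0_integral_mono => x _; rewrite !patchE; case: ifPn => //.
- by move=> /set_mem/AB/f0.
- by move=> /set_mem Ax; rewrite ifT//; exact/mem_set/AB.
- by move=> _; case: ifPn => // /set_mem; exact: f0.
Qed.

(** Monotone convergence for the functions [f \_ (F n)]: at each point the sequence is eventually
    constant. *)
Lemma ge0_cvg_integral_bigcup (F : (set X)^nat) (f : X -> \bar R) :
  (forall n, measurable (F n)) -> {homo F : n m / (n <= m)%N >-> (n <= m)%O} ->
  measurable_fun (\bigcup_n F n) f -> (forall x, (\bigcup_n F n) x -> 0 <= f x) ->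
  \int[mu]_(x in F n) f x @[n --> \oo] --> \int[mu]_(x in \bigcup_n F n) f x.
Proof.
move=> mF ndF mf f0.
have mU : measurable (\bigcup_n F n) by exact: bigcup_measurable.
rewrite integral_mkcond; under eq_fun do rewrite integral_mkcond.
have sub n : F n `<=` \bigcup_n F n by move=> x Fx; exists n.
have lim x : (f \_ (\bigcup_n F n)) x = limn (fun n => (f \_ (F n)) x).
  apply/esym/cvg_lim => //.
  rewrite patchE; case: ifPn => [/set_mem[n _ Fnx]|nF].
    apply: cvg_near_cst; near=> m; rewrite patchE ifT//; apply/mem_set.
    have nm : (n <= m)%N by near: m; exact: nbhs_infty_ge.
    by move: (ndF _ _ nm) => /subsetPset; apply.
  apply: cvg_near_cst; near=> m; rewrite patchE ifF//; apply/negP => /set_mem Fmx.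
  by move/negP: nF; apply; apply/mem_set; exists m.
have -> : (f \_ (\bigcup_n F n)) = fun x => limn (fun n => (f \_ (F n)) x).
  by apply/funext => x; exact: lim.
apply: cvg_monotone_convergence => //.
- move=> n; apply/(measurable_restrict _ (mF n) measurableT); rewrite setTI.
  by apply: measurable_funS mf => //; exact: sub.
- move=> n x _; rewrite patchE; case: ifPn => // /set_mem Fx; apply: f0; exact: sub Fx.
- move=> x _ n m nm; rewrite restrict_lee//; first by move=> y Fy; apply: f0; exact: sub Fy.
  by move: (ndF _ _ nm) => /subsetPset.
Unshelve. all: by end_near. Qed.

End nonneg_integral.

Section measurability.
Context {R : realType}.

Lemma measurable_funV d (X : measurableType d) (D : set X) (f : X -> R) :
  measurable_fun D f -> measurable_fun D (fun x => (f x)^-1).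
Proof.
move=> mf.
(* Inversion is reduced to multiplication and [powR]. Squaring makes the base nonnegative, and at a
   zero of [f] both sides are 0. *)
have -> : (fun x => (f x)^-1) = (fun x => f x * (f x ^+ 2) `^ (-1)).
  apply/funext => x; rewrite powR_inv1 ?sqr_ge0//.
  have [->|fx0] := eqVneq (f x) 0; first by rewrite mul0r invr0.
  by rewrite expr2 invfM mulrA divff// mul1r.
apply: measurable_funM => //.
apply: (@measurableT_comp _ _ _ _ _ _ (fun z : R => z `^ (-1))) => //.
exact: measurable_funX.
Qed.

End measurability.

(** Syntax-directed measurability: one operation is peeled off at a time, down to constants,
    projections and measurability hypotheses of the context. *)
Ltac meas := try apply: measurable_funTS; repeat match goal with
 | |- measurable_fun _ (@ln _) => exact: measurable_ln
 | |- measurable_fun _ (@expR _) => exact: measurable_expR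
 | |- measurable_fun _ (@GRing.inv _) => apply: (@measurable_funV _ _ _ _ id); exact: measurable_id
 | |- measurable_fun _ ( *%R _) => exact: mulrl_measurable
 | |- measurable_fun _ (@Order.lt _ _ ?c) =>
     exact: (@measurable_fun_ltr _ _ _ _ (cst c) id (@measurable_cst _ _ _ _ _ _) (@measurable_id _ _ _))
 | |- measurable_fun _ (@Order.le _ _ ?c) =>
     exact: (@measurable_fun_ler _ _ _ _ (cst c) id (@measurable_cst _ _ _ _ _ _) (@measurable_id _ _ _))
 | |- measurable_fun _ fst => exact: measurable_fst
 | |- measurable_fun _ snd => exact: measurable_snd
 | |- measurable_fun _ (fun x => EFin _) => apply/measurable_EFinP
 | |- measurable_fun _ (fun x => expR _) => apply: (measurableT_comp (@measurable_expR _))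
 | |- measurable_fun _ (fun x => ln _) => apply: (measurableT_comp (@measurable_ln _))
 | |- measurable_fun _ (fun x => powR _ ?a) => apply: (@measurableT_comp _ _ _ _ _ _ (fun z => powR z a)); first exact: measurable_powR
 | |- measurable_fun _ (fun x => poweR _ ?a) => apply: (@measurableT_comp _ _ _ _ _ _ (fun z => poweR z a)); first exact: measurable_poweR
 | |- measurable_fun _ (fun x => Num.norm _) => apply: (measurableT_comp (@normr_measurable _ _))
 | |- measurable_fun _ (fun x => abse _) => apply: (measurableT_comp (@abse_measurable _ _))
 | |- measurable_fun _ (fun x => ?c) => exact: measurable_cst
 | |- measurable_fun _ (fun x => x) => exact: measurable_id
 | |- measurable_fun _ (fun x => fst x) => exact: (measurable_funTS measurable_fst)
 | |- measurable_fun _ (fun x => snd x) => exact: (measurable_funTS measurable_snd)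
 | |- measurable_fun _ (fun x => GRing.exp _ _) => apply: measurable_funX
 | |- measurable_fun _ (fun x => GRing.inv _) => apply: measurable_funV
 | |- measurable_fun _ (fun x => GRing.opp _) => apply: measurable_funN
 | |- measurable_fun _ (fun x => (_ + _)%R) => apply: measurable_funD
 | |- measurable_fun _ (fun x => (_ * _)%R) => apply: measurable_funM
 | |- measurable_fun _ (fun x => (_ + _)%E) => apply: emeasurable_funD
 | |- measurable_fun _ (fun x => (_ * _)%E) => apply: emeasurable_funM
 | |- measurable_fun _ (fun x => (_ <= _)%R) => apply: measurable_fun_ler
 | |- measurable_fun _ (fun x => (_ < _)%R) => apply: measurable_fun_ltr
 | |- measurable_fun _ (fun x => andb _ _) => apply: measurable_and
 | |- measurable_fun _ (fun x => if _ then _ else _) => apply: measurable_fun_ifT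
 | H : measurable_fun setT ?f |- measurable_fun _ (fun x => ?f (fst x)) => 
   apply: measurable_funTS; apply: (measurableT_comp H measurable_fst)
 | H : measurable_fun setT ?f |- measurable_fun _ (fun x => ?f (snd x)) => 
   apply: measurable_funTS; apply: (measurableT_comp H measurable_snd)
 | H : measurable_fun setT ?f |- measurable_fun _ (fun x => ?f x) => exact: (measurable_funTS H)
 | H : measurable_fun setT ?f |- measurable_fun _ ?f => exact: (measurable_funTS H)
 end.

(** * Improper integrals from antiderivatives *)

Section improper_integral.
Context {R : realType}.
Implicit Types f F : R -> R.
Notation leb := (@lebesgue_measure R).

(** The parameter [l] stands for the singularity of the integrand: it is 0 for powers of x, and
    another point when 1 / (x - l) is integrated. *)
Lemma integral_derive_gt f F (l a b : R) : l < a -> a < b ->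
  (forall x : R, l < x -> is_derive x 1 F (f x)) ->
  (forall x : R, l < x -> {for x, continuous f}) ->
  (\int[leb]_(x in `[a, b]) (f x)%:E)%E = (F b - F a)%:E.
Proof.
move=> a0 ab dF cf.
have cF (x : R) : l < x -> {for x, continuous F}.
  by move=> x0; have [d _] := dF x x0; apply/differentiable_continuous/derivable1_diffP.
have pos (x : R) : x \in `[a, b] -> l < x.
  by rewrite in_itv/= => /andP[ax _]; exact: lt_le_trans ax.
rewrite (@continuous_FTC2 _ f F)//.
- apply: continuous_in_subspaceT => x /set_mem/= xab; apply: cf; exact: pos.
- split.
  + by move=> x /subset_itv_oo_cc/pos/dF[].
  + by apply: cvg_at_right_filter; exact: cF.
  + by apply: cvg_at_left_filter; apply: cF; exact: lt_trans ab.
- move=> x /subset_itv_oo_cc/pos/dF => -[dFx <-].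
  by rewrite derive1E.
Qed.

(** Starting at [n.+2] makes every interval nondegenerate, as the fundamental theorem of calculus is
    used with [a < b]. *)
Let exhaust n : set R := `[n.+2%:R^-1, n.+2%:R].

Lemma Rpos_bigcup : Rpos = \bigcup_n exhaust n :> set R.
Proof.
apply/seteqP; split => x /=.
- rewrite in_itv/= andbT => x0.
  exists (maxn (Num.trunc x) (Num.trunc x^-1)) => //.
  rewrite /exhaust/= in_itv/=.
  have lex (y : R) m : 0 < y -> (Num.trunc y <= m)%N -> y <= m.+2%:R.
    move=> y0 ym; apply/ltW/(lt_le_trans (truncnS_gt y)).
    by rewrite ler_nat ltnS (leq_trans ym).
  rewrite lex ?leq_maxl// andbT.
  rewrite -[leRHS]invrK lef_pV2 ?posrE ?invr_gt0 ?ltr0n//.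
  by rewrite lex ?leq_maxr// invr_gt0.
- move=> [n _]; rewrite /exhaust/= !in_itv/= andbT => /andP[+ _].
  by apply: lt_le_trans; rewrite invr_gt0.
Qed.

Lemma cvg_integral_Rpos f : measurable_fun (Rpos : set R) f ->
  (forall x : R, 0 < x -> 0 <= f x) ->
  (\int[leb]_(x in `[n.+2%:R^-1%R, n.+2%:R%R]) (f x)%:E)%E @[n --> \oo] -->
  (\int[leb]_(x in Rpos) (f x)%:E)%E.
Proof.
move=> mf f0; rewrite Rpos_bigcup; apply: ge0_cvg_integral_bigcup.
- by move=> n; exact: measurable_itv.
- move=> n m nm; apply/subsetPset => x; rewrite /exhaust/= !in_itv/= => /andP[nx xn].
  apply/andP; split; [apply: le_trans nx|apply: le_trans xn _].
    by rewrite lef_pV2 ?posrE ?ltr0n// ler_nat !ltnS.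
  by rewrite ler_nat !ltnS.
- by rewrite -Rpos_bigcup; apply/measurable_EFinP.
- by move=> x; rewrite -Rpos_bigcup/= in_itv/= andbT lee_fin; exact: f0.
Qed.

(** Only an upper bound on the increments of [F] survives the passage to the limit, so no limit of
    [F] at 0 or at infinity has to be computed. *)
Lemma integral_Rpos_derive_le f F (B : R) :
  (forall x : R, 0 < x -> is_derive x 1 F (f x)) ->
  (forall x : R, 0 < x -> {for x, continuous f}) ->
  (forall x : R, 0 < x -> 0 <= f x) ->
  (forall x y : R, 0 < x -> 0 < y -> F y - F x <= B) ->
  (\int[leb]_(x in Rpos) (f x)%:E <= B%:E)%E.
Proof.
move=> dF cf f0 FB.
have mf : measurable_fun (Rpos : set R) f.
  apply: open_continuous_measurable_fun; first exact: interval_open.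
  by move=> x /set_mem/=; rewrite in_itv/= andbT => /cf.
have h := @cvg_integral_Rpos f mf f0.
rewrite -(cvg_lim _ h)//; apply: lime_le; first by apply/cvg_ex; eexists; exact: h.
apply: nearW => n; rewrite (@integral_derive_gt f F 0)//.
- by rewrite lee_fin FB ?invr_gt0 ?ltr0n.
- by apply: (@lt_trans _ _ 1); rewrite ?invf_lt1 ?ltr1n ?ltr0n.
Qed.

End improper_integral.

(** * A multiplicative Hardy operator *)

Section dilation_kernel.
Context {R : realType}.
Implicit Types e s x y p : R.
Notation leb := (@lebesgue_measure R).

(* For 0 < s, y this is min(s/y, y/s)^e; integrated against dy/y its mass does not depend on s. *)
Definition dker e s y : R := expR (- (e * `|ln s - ln y|)).

Lemma dkerC e s y : dker e s y = dker e y s.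
Proof. by rewrite /dker distrC. Qed.

Lemma dker_ge0 e s y : 0 <= dker e s y.
Proof. exact: expR_ge0. Qed.

Lemma dker_le1 e s y : 0 <= e -> dker e s y <= 1.
Proof. by move=> e0; rewrite -expR0 ler_expR oppr_le0 mulr_ge0. Qed.

Lemma is_derive_expR_ln e s y : 0 < y ->
  is_derive y 1 (fun z => expR (e * (ln z - ln s))) (expR (e * (ln y - ln s)) * (e * y^-1)).
Proof.
move=> y0.
have dl := is_derive1_ln y0.
have d2 : is_derive y 1 (fun z => e * (ln z - ln s)) (e * y^-1).
  by apply: is_derive_eq; rewrite subr0.
exact: (@is_derive1_comp _ expR (fun z => e * (ln z - ln s)) y _ _ (is_derive_expR _) d2).
Qed.

(** With E = (y/s)^e the kernel is min(E, 1/E), which has a kink at s. It is dominated by the smooth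
    function 4 E / (1 + E)^2, and the latter divided by y has the antiderivative -(4/e) / (1 + E),
    whose total increment is at most 4/e. *)
Lemma integral_dker e s : 0 < e -> 0 < s ->
  (\int[leb]_(y in Rpos) (dker e s y / y)%:E <= (4 / e)%:E)%E.
Proof.
move=> e0 s0.
pose E y := expR (e * (ln y - ln s)).
have E0 y : 0 < E y by exact: expR_gt0.
have E1 y : 1 + E y != 0 by rewrite gt_eqF// addr_gt0.
pose f y := 4 / e * ((1 + E y)^-2 * (E y * (e * y^-1))).
apply: (@le_trans _ _ (\int[leb]_(y in Rpos) (f y)%:E)%E).
  apply: ge0_integral_mono => y /=; rewrite in_itv/= andbT => y0.
    by rewrite lee_fin divr_ge0 ?dker_ge0 ?ltW.
  rewrite lee_fin.
  have -> : f y = 4 * E y / (1 + E y)^+2 / y by rewrite /f; field; rewrite E1 !gt_eqF.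
  rewrite ler_wpM2r ?invr_ge0 ?(ltW y0)//.
  rewrite ler_pdivlMr ?exprn_gt0 ?addr_gt0//.
  rewrite /dker; case: (lerP (ln s) (ln y)) => sy.
    rewrite expRN -/(E y).
    have E2 : 1 <= E y by rewrite -expR0 ler_expR mulr_ge0 ?subr_ge0// ltW.
    rewrite ler_pdivrMl//.
    have := E0 y; nra.
  rewrite -mulrN opprB -/(E y).
  have E2 : E y <= 1 by rewrite -expR0 ler_expR mulr_ge0_le0 ?subr_le0 ?ltW.
  have := E0 y; rewrite mulrC => h; rewrite ler_wpM2r ?(ltW h)//; nra.
apply: (@integral_Rpos_derive_le _ f (fun y => - (4 / e) * (1 + E y)^-1)).
- move=> y y0.
  have dE := is_derive_expR_ln e s y0; rewrite -/E -/(E y) in dE.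
  have dV : is_derive y 1 (fun z => (1 + E z)^-1) (- (1 + E y) ^- 2 *: (E y * (e * y^-1))).
    apply: is_deriveV => //.
    by apply: is_derive_eq; rewrite add0r mul1r.
  by apply: is_derive_eq; rewrite /f /GRing.scale/= !mulNr mulrN opprK mulrA.
- move=> y y0.
  have cE : {for y, continuous E}.
    have [d _] := is_derive_expR_ln e s y0.
    by apply/differentiable_continuous/derivable1_diffP.
  apply: continuousM; first exact: cst_continuous.
  apply: continuousM.
    apply: continuousV; first by rewrite expf_neq0.
    apply: (@continuous_comp _ _ _ (fun z => 1 + E z) (fun u : R => u ^+ 2)); last exact: exprn_continuous.
    by apply: continuousD => //; exact: cst_continuous.
  apply: continuousM => //; apply: continuousM; first exact: cst_continuous.
  by apply: inv_continuous; rewrite gt_eqF.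
- move=> y y0; rewrite /f !mulr_ge0 ?invr_ge0 ?exprn_ge0 ?addr_ge0 ?ltW//.
- move=> x y x0 y0.
  have h1 : (1 + E x)^-1 <= 1 by rewrite invf_le1 ?addr_gt0// lerDl ltW.
  have h2 : 0 <= (1 + E y)^-1 by rewrite invr_ge0 addr_ge0 ?ltW.
  have : 0 < 4 / e by rewrite divr_gt0.
  by move: (4/e) h1 h2 => c h1 h2 c0; nra.
Qed.

End dilation_kernel.

(** * Tonelli's theorem on measurable rectangles *)

Section tonelli.
Context d1 d2 (X : measurableType d1) (Y : measurableType d2) (R : realType).
Variables (m1 : {sigma_finite_measure set X -> \bar R}) (m2 : {sigma_finite_measure set Y -> \bar R}).
Local Open Scope ereal_scope.

Let restrictX (A : set X) (B : set Y) (f : X * Y -> \bar R) x :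
  \int[m2]_y (f \_ (A `*` B)) (x, y) = ((fun x => \int[m2]_(y in B) f (x, y)) \_ A) x.
Proof.
rewrite patchE; case: ifPn => [Ax|nAx].
  rewrite [RHS]integral_mkcond; apply: eq_integral => y _.
  by rewrite !patchE in_setX Ax.
apply: integral0_eq => y _; rewrite patchE in_setX (negbTE nAx)//.
Qed.

Let restrictY (A : set X) (B : set Y) (f : X * Y -> \bar R) y :
  \int[m1]_x (f \_ (A `*` B)) (x, y) = ((fun y => \int[m1]_(x in A) f (x, y)) \_ B) y.
Proof.
rewrite patchE; case: ifPn => [By|nBy].
  rewrite [RHS]integral_mkcond; apply: eq_integral => x _.
  by rewrite !patchE in_setX By andbT.
apply: integral0_eq => x _; rewrite patchE in_setX (negbTE nBy) andbF//.
Qed.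

Let measurable_patch (A : set X) (B : set Y) (f : X * Y -> \bar R) :
  measurable A -> measurable B -> measurable_fun setT f ->
  measurable_fun setT (f \_ (A `*` B)).
Proof.
move=> mA mB mf; apply/(measurable_restrict f) => //; first exact: measurableX.
by rewrite setTI; exact: measurable_funTS.
Qed.

Let patch_ge0 (A : set X) (B : set Y) (f : X * Y -> \bar R) :
  (forall z, 0 <= f z) -> forall z, 0 <= (f \_ (A `*` B)) z.
Proof. by move=> f0 z; rewrite patchE; case: ifP. Qed.

Lemma fubini_tonelli_in (A : set X) (B : set Y) (f : X * Y -> \bar R) :
  measurable A -> measurable B -> measurable_fun setT f -> (forall z, 0 <= f z) ->
  \int[m1]_(x in A) \int[m2]_(y in B) f (x, y) = \int[m2]_(y in B) \int[m1]_(x in A) f (x, y).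
Proof.
move=> mA mB mf f0.
rewrite integral_mkcond [RHS]integral_mkcond.
under eq_integral do rewrite -restrictX.
under [RHS]eq_integral do rewrite -restrictY.
exact: (@fubini_tonelli _ _ _ _ _ m1 m2 _ (measurable_patch mA mB mf) (@patch_ge0 A B _ f0)).
Qed.

Lemma measurable_fun_integral_in (B : set Y) (f : X * Y -> \bar R) :
  measurable B -> measurable_fun setT f -> (forall z, 0 <= f z) ->
  measurable_fun setT (fun x => \int[m2]_(y in B) f (x, y)).
Proof.
move=> mB mf f0.
have := @measurable_fun_fubini_tonelli_F _ _ _ _ _ m2 _ (measurable_patch (@measurableT _ X) mB mf) (@patch_ge0 setT B _ f0).
rewrite /fubini_F; under eq_fun do rewrite restrictX.
by rewrite patch_setT.
Qed.

End tonelli.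

Lemma gt0_powRD (R : realType) (x a b : R) : 0 < x -> x `^ (a + b) = x `^ a * x `^ b.
Proof. by move=> x0; rewrite powRD// (gt_eqF x0) implybT. Qed.

Section jensen.
Context d (X : measurableType d) (R : realType) (mu : {measure set X -> \bar R}).

(* Instead of Hoelder's inequality: h <= h^p c^(1-p) + c for every c > 0, with c
   close to the L^p norm of h. *)
Lemma integral_kernel_powR (D : set X) (k h : X -> R) (m p : R) :
  measurable D -> measurable_fun D k -> measurable_fun D h ->
  (forall x, 0 <= k x) -> (forall x, 0 <= h x) -> 0 <= m -> 1 <= p ->
  (\int[mu]_(x in D) (k x)%:E <= m%:E)%E ->
  ((\int[mu]_(x in D) (k x * h x)%:E) `^ p <=
    ((1 + m) `^ p)%:E * \int[mu]_(x in D) (k x * h x `^ p)%:E)%E.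
Proof.
move=> mD mk mh k0 h0 m0 p1 km.
have p0 : 0 < p by exact: lt_le_trans p1.
have khp0 x : 0 <= k x * h x `^ p by rewrite mulr_ge0 ?powR_ge0.
have mhp : measurable_fun D (fun x => h x `^ p).
  by apply: (@measurableT_comp _ _ _ _ _ _ (fun z => z `^ p)).
have mk' : measurable_fun D (fun x => (k x)%:E) by exact/measurable_EFinP.
have mkhp' : measurable_fun D (fun x => (k x * h x `^ p)%:E).
  by apply/measurable_EFinP; exact: measurable_funM.
set J := (\int[mu]_(x in D) (k x * h x `^ p)%:E)%E.
have J0 : (0 <= J)%E by apply: integral_ge0 => x _; rewrite lee_fin.
have m1 : 0 < 1 + m by rewrite ltr_pwDl.
have [Joo|Jfin] := eqVneq J +oo%E.
  by rewrite Joo gt0_muley ?leey// lte_fin powR_gt0.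
have [j jE] : exists j, J = j%:E.
  exists (fine J); rewrite fineK// ge0_fin_numE// lt_neqAle Jfin leey//.
have j0 : 0 <= j by rewrite jE lee_fin in J0.
have bound (c : R) : 0 < c -> j <= c `^ p ->
    (\int[mu]_(x in D) (k x * h x)%:E <= (c * (1 + m))%:E)%E.
  move=> c0 jc.
  have hc x : h x <= h x `^ p * c `^ (1 - p) + c.
    have [hxc|/ltW cx] := lerP (h x) c; first by rewrite ler_wpDl// mulr_ge0 ?powR_ge0.
    rewrite ler_wpDr ?(ltW c0)//.
    have hx0 : 0 < h x by exact: lt_le_trans cx.
    have e : h x = h x `^ p * h x `^ (1 - p).
      by rewrite -gt0_powRD// addrC subrK powRr1// ltW.
    rewrite {1}e ler_wpM2l ?powR_ge0//.
    rewrite -(opprB p 1) !powRN lef_pV2 ?posrE ?powR_gt0//.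
    by rewrite ge0_ler_powR ?nnegrE ?subr_ge0 ?(ltW c0)// ltW.
  apply: (@le_trans _ _ (\int[mu]_(x in D) ((c `^ (1 - p))%:E * (k x * h x `^ p)%:E + c%:E * (k x)%:E))%E).
    apply: ge0_integral_mono => x _; first by rewrite lee_fin mulr_ge0.
    rewrite -!EFinM -EFinD lee_fin.
    have := ler_wpM2l (k0 x) (hc x); congr (_ <= _); ring.
  have Z1 : measurable_fun D (fun x => (c `^ (1 - p))%:E * (k x * h x `^ p)%:E)%E.
    by apply: emeasurable_funM => //; exact: measurable_cst.
  have Z2 : measurable_fun D (fun x => c%:E * (k x)%:E)%E.
    by apply: emeasurable_funM => //; exact: measurable_cst.
  rewrite ge0_integralD//; last 2 first.
  - by move=> x _; rewrite -EFinM lee_fin mulr_ge0 ?powR_ge0.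
  - by move=> x _; rewrite -EFinM lee_fin mulr_ge0// ltW.
  rewrite !ge0_integralZl//; last 4 first.
  - by move=> x _; rewrite lee_fin.
  - by rewrite lee_fin ltW.
  - by move=> x _; rewrite lee_fin.
  - by rewrite lee_fin powR_ge0.
  rewrite -/J jE mulrDr mulr1 EFinD leeD//.
    rewrite -EFinM lee_fin.
    have e : c `^ (1 - p) * c `^ p = c by rewrite -gt0_powRD// subrK powRr1// ltW.
    by rewrite -[leRHS]e ler_wpM2l ?powR_ge0.
  by rewrite EFinM lee_wpmul2l// lee_fin ltW.
have main : (\int[mu]_(x in D) (k x * h x)%:E <= (j `^ p^-1 * (1 + m))%:E)%E.
  apply/lee_addgt0Pr => e e0.
  (* The slack keeps the level [c] positive when [j = 0]; after multiplication by [1 + m] it costs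
     exactly [e]. *)
  have c0 : 0 < j `^ p^-1 + e / (1 + m) by rewrite ltr_wpDl ?powR_ge0// divr_gt0.
  have := bound _ c0.
  rewrite mulrDl mulfVK ?gt_eqF// -EFinD; apply.
  rewrite -{1}[j]powRr1// -{1}(mulVf (lt0r_neq0 p0)) powRrM.
  apply: ge0_ler_powR; rewrite ?nnegrE ?powR_ge0 ?(ltW p0) ?(ltW c0)//.
  by rewrite lerDl divr_ge0 ?ltW.
apply: (@le_trans _ _ ((j `^ p^-1 * (1 + m))%:E `^ p)%E).
  apply: gt0_ler_poweR; rewrite ?(ltW p0)// in_itv/= leey andbT.
    by apply: integral_ge0 => x _; rewrite lee_fin mulr_ge0.
  by rewrite lee_fin mulr_ge0 ?powR_ge0// ltW.
rewrite poweR_EFin powRM ?powR_ge0 ?(ltW m1)//.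
by rewrite -powRrM mulVf ?gt_eqF// powRr1// mulrC jE EFinM.
Qed.

End jensen.

Section hardy.
Context {R : realType}.
Implicit Types (e s x y p b delta lam : R) (h f : R -> R).
Notation leb := (@lebesgue_measure R).

Lemma in_Rpos x : (Rpos : set R) x = (0 < x) :> Prop.
Proof. by rewrite /= in_itv/= andbT. Qed.

Lemma measurable_Rpos : measurable (Rpos : set R).
Proof. exact: measurable_itv. Qed.

Definition hardy e h s : \bar R := (\int[leb]_(y in Rpos) (dker e s y / y * h y)%:E)%E.

Let dkery_ge0 e s y : 0 < y -> 0 <= dker e s y / y.
Proof. by move=> y0; rewrite divr_ge0 ?dker_ge0 ?ltW. Qed.

Lemma hardy_ge0 e h s : (forall y, 0 <= h y) -> (0 <= hardy e h s)%E.
Proof.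
move=> h0; apply: integral_ge0 => y; rewrite in_Rpos => y0.
by rewrite lee_fin mulr_ge0 ?dkery_ge0.
Qed.

Lemma measurable_hardy e h : (forall y, 0 <= h y) -> measurable_fun setT h ->
  measurable_fun setT (hardy e h).
Proof.
move=> h0 mh.
(* On the half-line [|y|] is [y], but it makes the integrand nonnegative on the whole plane, as
   measurability of a parametric integral requires. *)
have -> : hardy e h = fun s => (\int[leb]_(y in Rpos) (dker e s y / `|y| * h y)%:E)%E.
  apply/funext => s; apply: eq_integral => y /set_mem; rewrite in_Rpos => y0.
  by rewrite gtr0_norm.
apply: (@measurable_fun_integral_in _ _ _ _ _ leb Rpos (fun z => (dker e z.1 z.2 / `|z.2| * h z.2)%:E)).
- exact: measurable_Rpos.
- by rewrite /dker; meas.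
- by move=> z; rewrite lee_fin !mulr_ge0 ?dker_ge0 ?invr_ge0.
Qed.

(** The Jensen-type inequality for the kernel [dker e s y / y], whose mass is at most [4 / e] for
    every [s]. *)
Lemma hardy_powR e h s p : 0 < e -> 0 < s -> 1 <= p ->
  (forall y, 0 <= h y) -> measurable_fun setT h ->
  (hardy e h s `^ p <= ((1 + 4 / e) `^ p)%:E * hardy e (fun y => (h y `^ p)%R) s)%E.
Proof.
move=> e0 s0 p1 h0 mh.
have e4 : 0 <= 4 / e by rewrite divr_ge0 ?ltW.
have k0 y : 0 <= dker e s y / `|y| by rewrite mulr_ge0 ?dker_ge0 ?invr_ge0.
have mk : measurable_fun (Rpos : set R) (fun y => dker e s y / `|y|) by rewrite /dker; meas.
have km : (\int[leb]_(y in Rpos) (dker e s y / `|y|)%:E <= (4 / e)%:E)%E.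
  apply: le_trans (integral_dker e0 s0).
  by apply: ge0_integral_mono => y; rewrite in_Rpos lee_fin => // y0; rewrite gtr0_norm.
have := @integral_kernel_powR _ _ _ leb _ _ _ _ _ measurable_Rpos mk (measurable_funTS mh) k0 h0 e4 p1 km.
congr (_ `^ _ <= _ * _)%E; apply: eq_integral => y /set_mem; rewrite in_Rpos => y0;
  by rewrite gtr0_norm.
Qed.

Lemma hardy_le_mass e h s : 0 <= e -> (forall y, 0 <= h y) ->
  (hardy e h s <= \int[leb]_(y in Rpos) (h y / y)%:E)%E.
Proof.
move=> e0 h0; apply: ge0_integral_mono => y; rewrite in_Rpos => y0.
  by rewrite lee_fin mulr_ge0 ?dkery_ge0.
rewrite lee_fin mulrAC ler_wpM2r ?invr_ge0 ?(ltW y0)//.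
by rewrite -[leRHS]mul1r ler_wpM2r ?dker_le1.
Qed.

(** [dker] is symmetric, so after Tonelli the inner integral in [x] is again the mass of the kernel,
    at most [4 / e]. With [hardy_powR] this is boundedness on L^p(dy/y). *)
Lemma integral_hardy e h : 0 < e -> (forall y, 0 <= h y) -> measurable_fun setT h ->
  (\int[leb]_(x in Rpos) ((x^-1)%:E * hardy e h x) <=
    (4 / e)%:E * \int[leb]_(y in Rpos) (h y / y)%:E)%E.
Proof.
move=> e0 h0 mh.
pose F (z : R * R) := (dker e z.1 z.2 / `|z.1| * (h z.2 / `|z.2|))%:E.
have F0 z : (0 <= F z)%E by rewrite lee_fin !mulr_ge0 ?dker_ge0 ?invr_ge0.
have mF : measurable_fun setT F by rewrite /F /dker; meas.
apply: (@le_trans _ _ (\int[leb]_(x in Rpos) \int[leb]_(y in Rpos) F (x, y))%E).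
  apply: ge0_integral_mono => x; rewrite in_Rpos => x0.
    by rewrite mule_ge0 ?hardy_ge0// lee_fin invr_ge0 ltW.
  have x1 : 0 <= x^-1 by rewrite invr_ge0 ltW.
  rewrite /hardy -ge0_integralZl//; last 2 first.
  - by rewrite /dker; meas.
  - move=> y; rewrite in_Rpos => y0; by rewrite lee_fin mulr_ge0 ?dkery_ge0.
  apply: ge0_integral_mono => y; rewrite in_Rpos => y0.
    by rewrite -EFinM lee_fin !mulr_ge0 ?dker_ge0 ?invr_ge0 ?(ltW y0) ?(ltW x0).
  by rewrite /F/= -EFinM lee_fin !gtr0_norm// le_eqVlt; apply/orP; left; apply/eqP; ring.
rewrite fubini_tonelli_in//.
apply: (@le_trans _ _ (\int[leb]_(y in Rpos) ((4 / e)%:E * (h y / y)%:E))%E); last first.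
  have e4 : 0 <= 4 / e by rewrite divr_ge0 ?ltW.
  rewrite ge0_integralZl//; first by meas.
  by move=> y; rewrite in_Rpos => y0; rewrite lee_fin divr_ge0 ?(ltW y0).
apply: ge0_integral_mono => y; rewrite in_Rpos => y0; first by apply: integral_ge0.
have hy0 : 0 <= h y / y by rewrite divr_ge0 ?(ltW y0).
apply: (@le_trans _ _ (\int[leb]_(x in Rpos) ((h y / y)%:E * (dker e y x / x)%:E))%E).
  apply: ge0_integral_mono => x //; rewrite in_Rpos => x0.
  by rewrite /F/= -EFinM lee_fin !gtr0_norm// dkerC le_eqVlt; apply/orP; left; apply/eqP; ring.
rewrite ge0_integralZl//.
- by rewrite muleC lee_wpmul2r ?lee_fin//; exact: integral_dker.
- by rewrite /dker; meas.
- by move=> x; rewrite in_Rpos => x0; rewrite lee_fin dkery_ge0.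
Qed.

(** With q = L/lam, the set is one side of the threshold s = q^(1/b), and on it x^(b p - 1) equals
    q^p times [dker (|b| p) s x / x]. The kernel mass then bounds the measure for both signs of b at
    once. For b = 0 the set can be the whole half-line, of infinite measure dx/x. *)
Lemma power_measure_tail (b p lam L : R) : b != 0 -> 0 < p -> 0 < lam -> 0 <= L ->
  ((lam `^ p)%:E * power_measure (b * p - 1) [set x : R | (0 < x)%R /\ (lam < x `^ (- b) * L)%R]
    <= (4 / (`|b| * p) * L `^ p)%:E)%E.
Proof.
move=> b0 p0 lam0; rewrite le_eqVlt => /predU1P[<-|L0].
  rewrite (_ : [set x | _] = set0) ?measure0 ?mule0.
    by rewrite lee_fin mulr_ge0 ?powR_ge0 ?divr_ge0 ?mulr_ge0 ?(ltW p0).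
  by apply/seteqP; split => x //= -[_]; rewrite mulr0 ltNge ltW.
have bp0 : 0 < `|b| * p by rewrite mulr_gt0 ?normr_gt0.
pose q := L / lam; have q0 : 0 < q by rewrite divr_gt0.
pose s := expR (ln q / b).
have s0 : 0 < s by exact: expR_gt0.
set A := [set x | _].
have AR : A `&` Rpos `<=` Rpos by move=> x [].
have q1 : 0 <= q `^ p by exact: powR_ge0.
have : (power_measure (b * p - 1) A <= (q `^ p)%:E * (4 / (`|b| * p))%:E)%E.
  apply: (@le_trans _ _ ((q `^ p)%:E * \int[leb]_(y in Rpos) (dker (`|b| * p) s y / y)%:E)%E); last first.
    by rewrite lee_wpmul2l ?lee_fin//; exact: integral_dker.
  rewrite -ge0_integralZl//; last 2 first.
  - by rewrite /dker; meas.
  - by move=> x; rewrite in_Rpos => x0; rewrite lee_fin dkery_ge0.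
  apply: (@le_trans _ _ (\int[leb]_(y in A `&` Rpos) ((q `^ p)%:E * (dker (`|b| * p) s y / y)%:E))%E); last first.
    apply: ge0_integral_subset => // x; rewrite in_Rpos => x0.
    by rewrite -EFinM lee_fin mulr_ge0 ?dkery_ge0.
  apply: ge0_integral_mono => x [[x0 lx] _]; first by rewrite lee_fin powR_ge0.
  rewrite -EFinM lee_fin.
  rewrite gt0_powRD// powR_inv1 ?(ltW x0)// mulrA ler_wpM2r ?invr_ge0 ?(ltW x0)//.
  rewrite /powR !gt_eqF// /dker -expRD ler_expR /s expRK.
  have blnx : b * ln x < ln q.
    rewrite -ltr_expR lnK ?posrE// /q ltr_pdivlMr// mulrC -ltr_pdivlMr ?expR_gt0//.
    move: lx; rewrite /powR gt_eqF// mulNr expRN.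
    by rewrite mulrC.
  have -> : `|b| * p * `|ln q / b - ln x| = p * (ln q - b * ln x).
    rewrite -(gtr0_norm (_ : 0 < ln q - b * ln x)) ?subr_gt0//.
    rewrite mulrAC -normrM mulrC; congr (_ * `| _ |).
    by field.
  lra.
move=> h; apply: le_trans (lee_wpmul2l _ h) _; first by rewrite lee_fin powR_ge0.
rewrite -!EFinM lee_fin /q.
rewrite mulrA -powRM ?divr_ge0 ?(ltW lam0) ?(ltW L0)//.
by rewrite (_ : lam * (L / lam) = L) 1?mulrC//; field; rewrite gt_eqF.
Qed.

End hardy.

(** * The local maximal function *)

Section local_maximal.
Context {R : realType}.
Implicit Types (s x y p r delta lam : R) (f g : R -> R).
Notation leb := (@lebesgue_measure R).

(** The restriction [r < x / 2] keeps the ball inside (x/2, 3x/2), where every power weight is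
    comparable to a constant. For [x <= 0] no radius is admissible and the supremum is [-oo]. *)
Definition local_maximal f x : \bar R :=
  ereal_sup [set ((2 * r)^-1%:E * \int[leb]_(y in ball x r) (f y)%:E)%E
            | r in [set r | 0 < r < x / 2]].

Lemma local_maximal_gtP f x (a : \bar R) : (a < local_maximal f x)%E <->
  exists2 r, 0 < r < x / 2 & (a < (2 * r)^-1%:E * \int[leb]_(y in ball x r) (f y)%:E)%E.
Proof.
split=> [/ereal_sup_gt[_ [r rx <-] h]|[r rx h]]; first by exists r.
by apply: lt_le_trans h _; apply: ereal_sup_ubound; exists r.
Qed.

Lemma local_maximal_gt0 f x (a : \bar R) : (a < local_maximal f x)%E -> 0 < x.
Proof. by move=> /local_maximal_gtP[r /andP[r0 /(lt_trans r0)]]; lra. Qed.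

Lemma local_maximal_ge0 f x : (forall y, 0 <= f y) -> 0 < x -> (0 <= local_maximal f x)%E.
Proof.
move=> f0 x0.
apply: (@le_trans _ _ (((2 * (x / 4))^-1)%:E * \int[leb]_(y in ball x (x / 4)) (f y)%:E)%E).
  rewrite mule_ge0 ?lee_fin ?invr_ge0//; first lra.
  by apply: integral_ge0 => y _; rewrite lee_fin.
by apply: ereal_sup_ubound; exists (x / 4) => //=; apply/andP; split; lra.
Qed.

(** If the average over [ball x r] exceeds [a], then for x' within d of x the ball of radius r + d
    about x' contains that ball, and for small d the larger denominator still leaves an average
    above [a]. *)
Lemma open_local_maximal_gt f (a : R) : (forall y, 0 <= f y) ->
  open [set x | (a%:E < local_maximal f x)%E].
Proof.
move=> f0; rewrite openE => x /= /local_maximal_gtP[r /andP[r0 rx] ar].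
set I := integral _ _ _ in ar.
have I0 : (0 <= I)%E by apply: integral_ge0 => y _; rewrite lee_fin.
(* The integral may be infinite; a real lower bound [i] that still exceeds [a * (2 * r)] replaces
   it. *)
have [i [i0 iI ai]] : exists i : R, [/\ 0 <= i, (i%:E <= I)%E & a * (2 * r) < i].
  have r20 : 0 < 2 * r by rewrite mulr_gt0.
  have [Ioo|Ifin] := eqVneq I +oo%E.
    exists (Num.max 0 (a * (2 * r) + 1)); rewrite Ioo leey le_max lexx/=; split => //.
    by rewrite lt_max; apply/orP; right; lra.
  exists (fine I).
  have If : I \is a fin_num by rewrite ge0_fin_numE// lt_neqAle Ifin leey.
  split; rewrite ?fine_ge0 ?fineK//.
  by move: ar; rewrite -(fineK If) -EFinM lte_fin ltr_pdivlMl// mulrC.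
(* Two constraints on [d]: the enlarged radius must stay admissible at x', and the loss in the
   denominator must stay within the slack. The second is void for [a <= 0]. *)
have [d [d0 rdx ad]] : exists d, [/\ 0 < d, r + d < (x - d) / 2 & a * (2 * (r + d)) < i].
  have [a0|a0] := lerP a 0.
    exists ((x / 2 - r) / 4); split; [lra|lra|].
    have : 0 < (x / 2 - r) / 4 by lra.
    move: (_ / _) => d d0; nra.
  exists (Num.min ((x / 2 - r) / 4) ((i - a * (2 * r)) / (4 * a))); split.
  - by rewrite lt_min !divr_gt0//; lra.
  - have : Num.min ((x / 2 - r) / 4) ((i - a * (2 * r)) / (4 * a)) <= (x / 2 - r) / 4.
      by rewrite ge_min lexx.
    move: (Num.min _ _) => d; lra.
  - have : Num.min ((x / 2 - r) / 4) ((i - a * (2 * r)) / (4 * a)) <= (i - a * (2 * r)) / (4 * a).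
      by rewrite ge_min lexx orbT.
    move: (Num.min _ _) => d; rewrite ler_pdivlMr ?mulr_gt0//; nra.
apply/nbhs_ballP; exists d => //= x'; rewrite /ball/= => xx'.
apply/local_maximal_gtP; exists (r + d).
  apply/andP; split; first lra.
  move: xx'; rewrite ltr_norml => /andP[h1 h2]; lra.
have rd0 : 0 < 2 * (r + d) by lra.
apply: (@lt_le_trans _ _ ((2 * (r + d))^-1%:E * i%:E)%E).
  by rewrite -EFinM lte_fin ltr_pdivlMl// mulrC.
apply: lee_wpmul2l; first by rewrite lee_fin invr_ge0 ltW.
apply: le_trans iI _; apply: ge0_integral_subset => y; first by rewrite lee_fin.
rewrite /ball/= => xy; have -> : x' - y = (x - y) - (x - x') by ring.
by apply: le_lt_trans (ler_normB _ _) _; lra.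
Qed.

Lemma measurable_local_maximal f : (forall y, 0 <= f y) ->
  measurable_fun setT (local_maximal f).
Proof.
move=> f0; apply: lower_semicontinuous_measurable; apply/lower_semicontinuousP => a.
exact: open_local_maximal_gt.
Qed.

(** For x in [s, 2s] every admissible ball lies in [s/2, 3s], so the local maximal function is at
    most the Hardy-Littlewood maximal function of [f] cut off to [s/2, 4s]. The factor 3 is that of
    the classical maximal inequality. *)
Lemma local_maximal_gt_le s lam f : 0 < s -> 0 < lam ->
  (forall y, 0 <= f y) -> measurable_fun setT f ->
  (lam%:E * leb ([set x | (lam%:E < local_maximal f x)%E] `&` `[s%R, (2 * s)%R]) <=
    3%:E * \int[leb]_(y in `[(s / 2)%R, (4 * s)%R]) (f y)%:E)%E.
Proof.
move=> s0 lam0 f0 mf; set B := (X in integral _ X _).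
have mB : measurable B by exact: measurable_itv.
have mfB : measurable_fun B (fun y => (f y)%:E) by apply/measurable_EFinP; exact: measurable_funTS.
have [Boo|Bfin] := eqVneq (\int[leb]_(y in B) (f y)%:E)%E +oo%E.
  by rewrite Boo gt0_muley ?leey// lte_fin.
have fB : leb.-integrable B (EFin \o f).
  apply/integrableP; split => //.
  under eq_integral do rewrite /= ger0_norm//.
  by rewrite lt_neqAle Bfin leey.
have lf := integrable_locally mB fB.
have := maximal_inequality lf lam0; rewrite /=.
have -> : (\int[leb]_(y in setT) `|(f \_ B) y|%:E = \int[leb]_(y in B) (f y)%:E)%E.
  rewrite [RHS]integral_mkcond; apply: eq_integral => y _; rewrite !patchE.
  by case: ifP => _; rewrite ?normr0// ger0_norm.
move=> h.
apply: (@le_trans _ _ (lam%:E * ((3 / lam)%:E * \int[leb]_(y in B) (f y)%:E))%E); last first.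
  by rewrite muleA -EFinM (_ : lam * (3 / lam) = 3)//; field; rewrite gt_eqF.
rewrite lee_wpmul2l ?lee_fin ?(ltW lam0)//; apply: le_trans h.
apply: le_measure; rewrite ?inE.
- apply: measurableI; last exact: measurable_itv.
  by apply: open_measurable; exact: open_local_maximal_gt.
- apply: open_measurable.
  have /lower_semicontinuousP := lower_semicontinuous_HL_maximal lf; exact.
move=> x [/= /local_maximal_gtP[r /andP[r0 rx] h]]; rewrite in_itv/= => /andP[sx xs].
apply: lt_le_trans h _.
apply: (@le_trans _ _ (iavg (f \_ B) (ball x r))); last first.
  by apply: ereal_sup_ubound; exists r => //=; rewrite in_itv/= r0.
rewrite /iavg lebesgue_measure_ball ?(ltW r0)//.
rewrite inver mulrn_eq0/= gt_eqF// mulr_natl lee_wpmul2l ?lee_fin ?invr_ge0 ?mulrn_wge0 ?(ltW r0)//.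
rewrite le_eqVlt; apply/orP; left; apply/eqP; apply: eq_integral => y /set_mem.
rewrite /ball/= ltr_norml => /andP[h1 h2].
rewrite patchE ifT ?ger0_norm//; apply/mem_set; rewrite /B/= in_itv/=; lra.
Qed.

End local_maximal.

Lemma integral_if d (X : measurableType d) (R : realType) (mu : {measure set X -> \bar R})
    (D A : set X) (P : X -> bool) (g : X -> R) :
  A `<=` D -> (forall x, D x -> P x <-> A x) ->
  (\int[mu]_(x in D) (if P x then g x else 0)%:E = \int[mu]_(x in A) (g x)%:E)%E.
Proof.
move=> AD PA; rewrite integral_mkcond [RHS]integral_mkcond; apply: eq_integral => x _.
rewrite !patchE; have [/set_mem Dx|nDx] := boolP (x \in D).
  have [Px|nPx] := boolP (P x); first by rewrite ifT//; apply/mem_set/PA.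
  by rewrite ifF//; apply/negP => /set_mem/(PA _ Dx); apply/negP.
by rewrite ifF//; apply/negP => /set_mem/AD Dx; move/negP: nDx; apply; exact/mem_set.
Qed.

Section weighted_local_maximal.
Context {R : realType}.
Implicit Types (s x y p r a b delta lam : R) (f g : R -> R).
Notation leb := (@lebesgue_measure R).

Lemma powR_le_comparable a s x : 0 < x -> x / 4 <= s <= 4 * x ->
  s `^ a <= 4 `^ `|a| * x `^ a.
Proof.
move=> x0 /andP[xs sx]; have s0 : 0 < s by apply: lt_le_trans xs; rewrite divr_gt0.
rewrite /powR !gt_eqF// -expRD ler_expR -lerBlDr -mulrBr.
apply: le_trans (ler_norm _) _; rewrite normrM ler_wpM2l//.
have l1 : ln s <= ln 4 + ln x by rewrite -lnM ?posrE// ler_ln ?posrE// mulr_gt0.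
have l2 : ln x <= ln 4 + ln s by rewrite -lnM ?posrE// ler_ln ?posrE ?mulr_gt0//; lra.
by rewrite ler_norml; lra.
Qed.

Lemma integral_cst_itv a b c : a <= b ->
  (\int[leb]_(y in `[a, b]) c%:E = (c * (b - a))%:E)%E.
Proof.
move=> ab; rewrite integral_cst//= lebesgue_measure_itv/= lte_fin.
move: ab; rewrite le_eqVlt => /predU1P[->|ab]; last by rewrite ab EFinM EFinB.
by rewrite ltxx mule0 subrr mulr0.
Qed.

(** A continuous version of the decomposition into dyadic blocks. The s with s <= x <= 2s fill
    [x/2, x], so x^delta is comparable to the integral of s^(delta-1) over them. After Tonelli the
    unweighted estimate applies on each [s, 2s], and a second use of Tonelli reassembles the weight
    at y. The constant is 2K from the first step times 6K from the last. *)
Lemma power_measure_local_maximal_gt delta : exists2 C, 0 < C & forall f lam, 0 < lam ->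
  (forall y, 0 <= f y) -> measurable_fun setT f ->
  (lam%:E * power_measure delta [set x | (lam%:E < local_maximal f x)%E] <=
   C%:E * \int[leb]_(y in Rpos) (y `^ delta * f y)%:E)%E.
Proof.
pose K : R := 4 `^ `|delta - 1|.
have K0 : 0 < K by exact: powR_gt0.
exists (12 * K ^+ 2); first by rewrite mulr_gt0 ?exprn_gt0.
move=> f lam lam0 f0 mf; set A := [set x | _].
have oA : open A by exact: open_local_maximal_gt.
have mA : measurable (A : set (measurableTypeR R)) by exact: open_measurable.
have AR : A `<=` Rpos by move=> x /local_maximal_gt0; rewrite in_Rpos.
have AI : A `&` Rpos = A by rewrite setIidl.
have xd x : 0 < x -> x `^ delta = x `^ (delta - 1) * x.
  by move=> x0; rewrite -{3}(powRr1 (ltW x0)) -gt0_powRD// subrK.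
pose F (z : R * R) := (if (z.2 <= z.1) && (z.1 <= 2 * z.2) then `|z.2| `^ (delta - 1) * lam else 0)%:E.
have mF : measurable_fun setT F by rewrite /F; meas.
have F0 z : (0 <= F z)%E by rewrite /F lee_fin; case: ifP => // _; rewrite mulr_ge0 ?powR_ge0// ltW.
pose G (z : R * R) := (if (z.2 / 2 <= z.1) && (z.1 <= 4 * z.2) then `|z.2| `^ (delta - 1) * (3 * f z.1) else 0)%:E.
have mG : measurable_fun setT G by rewrite /G; meas.
have G0 z : (0 <= G z)%E by rewrite /G lee_fin; case: ifP => // _; rewrite !mulr_ge0 ?powR_ge0.
have step1 : (((2 * K)^-1 * lam)%:E * power_measure delta A <=
    \int[leb]_(x in A) \int[leb]_(s in Rpos) F (x, s))%E.
  rewrite /power_measure AI -ge0_integralZl//; last 3 first.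
  - by meas.
  - by move=> x _; rewrite lee_fin powR_ge0.
  - by rewrite lee_fin mulr_ge0 ?invr_ge0 ?mulr_ge0// ltW.
  apply: ge0_integral_mono => x Ax.
    by rewrite -EFinM lee_fin !mulr_ge0 ?invr_ge0 ?powR_ge0 ?mulr_ge0 ?(ltW K0) ?(ltW lam0).
  have x0 : 0 < x by have := AR _ Ax; rewrite in_Rpos.
  rewrite /F/=. rewrite (@integral_if _ _ _ leb _ `[x / 2, x]); last 2 first.
  - by move=> s; rewrite in_Rpos/= in_itv/=; lra.
  - by move=> s _; rewrite /= in_itv/=; split => /andP[? ?]; apply/andP; split; lra.
  apply: (@le_trans _ _ (\int[leb]_(s in `[(x / 2)%R, x]) (K^-1 * x `^ (delta - 1) * lam)%:E)%E).
    rewrite integral_cst_itv; last lra.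
    rewrite -EFinM lee_fin xd// le_eqVlt; apply/orP; left; apply/eqP.
    by field; rewrite gt_eqF.
  apply: ge0_integral_mono => s /=; rewrite in_itv/= => sx.
    by rewrite lee_fin !mulr_ge0 ?invr_ge0 ?powR_ge0 ?(ltW K0) ?(ltW lam0).
  have s0 : 0 < s by lra.
  rewrite lee_fin ler_wpM2r ?(ltW lam0)// ler_pdivrMl// gtr0_norm//.
  by apply: powR_le_comparable => //; lra.
have step2 s : 0 < s -> (\int[leb]_(x in A) F (x, s) <= \int[leb]_(y in Rpos) G (y, s))%E.
  move=> s0; rewrite /F/= (@integral_if _ _ _ leb _ (A `&` `[s, 2 * s])); last 2 first.
  - by move=> x [].
  - move=> x Ax; rewrite /= in_itv/=; split=> [h|[_ h]//]; split => //.
  rewrite /G/= (@integral_if _ _ _ leb _ `[s / 2, 4 * s]); last 2 first.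
  - by move=> y; rewrite in_Rpos/= in_itv/=; lra.
  - by move=> y _; rewrite /= in_itv/=.
  rewrite gtr0_norm// integral_cst//=; last by apply: measurableI => //; exact: measurable_itv.
  under [leRHS]eq_integral do rewrite EFinM EFinM.
  rewrite EFinM ge0_integralZl//; last 3 first.
  - by meas.
  - by move=> y _; rewrite -EFinM lee_fin mulr_ge0.
  - by rewrite lee_fin powR_ge0.
  rewrite ge0_integralZl//; last 2 first.
  - by meas.
  - by move=> y _; rewrite lee_fin.
  rewrite -muleA lee_wpmul2l ?lee_fin ?powR_ge0//.
  exact: local_maximal_gt_le.
have step3 y : 0 < y -> (\int[leb]_(s in Rpos) G (y, s) <= (6 * K * (y `^ delta * f y))%:E)%E.
  move=> y0; rewrite /G/= (@integral_if _ _ _ leb _ `[y / 4, 2 * y]); last 2 first.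
  - by move=> s; rewrite in_Rpos/= in_itv/=; lra.
  - by move=> s _; rewrite /= in_itv/=; split => /andP[? ?]; apply/andP; split; lra.
  apply: (@le_trans _ _ (\int[leb]_(s in `[(y / 4)%R, (2 * y)%R]) (K * y `^ (delta - 1) * (3 * f y))%:E)%E).
    apply: ge0_integral_mono => s /=; rewrite in_itv/= => sy.
      by rewrite lee_fin !mulr_ge0 ?powR_ge0.
    have s0 : 0 < s by lra.
    rewrite lee_fin ler_wpM2r ?mulr_ge0// gtr0_norm//.
    by apply: powR_le_comparable => //; lra.
  rewrite integral_cst_itv; last lra.
  rewrite lee_fin xd//.
  have := f0 y; have := powR_ge0 y (delta - 1); move: (y `^ _) (f y) => u v u0 v0.
  have w0 : 0 <= K * u * (3 * v) by rewrite !mulr_ge0 ?(ltW K0).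
  have -> : 6 * K * (u * y * v) = K * u * (3 * v) * (2 * y) by ring.
  by rewrite ler_wpM2l//; lra.
have tot : (((2 * K)^-1 * lam)%:E * power_measure delta A <=
    (6 * K)%:E * \int[leb]_(y in Rpos) (y `^ delta * f y)%:E)%E.
  apply: le_trans step1 _.
  rewrite fubini_tonelli_in//.
  apply: (@le_trans _ _ (\int[leb]_(s in Rpos) \int[leb]_(y in Rpos) G (y, s))%E).
    apply: ge0_integral_mono => s; rewrite in_Rpos => s0; last exact: step2.
    by apply: integral_ge0 => x _; exact: F0.
  rewrite -(@fubini_tonelli_in _ _ _ _ _ leb leb Rpos Rpos G)//.
  rewrite -ge0_integralZl//; last 3 first.
  - by meas.
  - by move=> y _; rewrite lee_fin mulr_ge0 ?powR_ge0.
  - by rewrite lee_fin mulr_ge0 ?(ltW K0).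
  apply: ge0_integral_mono => y; rewrite in_Rpos => y0; last by rewrite -EFinM; exact: step3.
  by apply: integral_ge0 => x _; exact: G0.
have K2 : (0 <= (2 * K)%:E)%E by rewrite lee_fin mulr_ge0// ltW.
have := lee_wpmul2l K2 tot; rewrite !muleA -!EFinM.
rewrite (_ : 2 * K * ((2 * K)^-1 * lam) = lam); last by field; rewrite gt_eqF.
by rewrite (_ : 2 * K * (6 * K) = 12 * K ^+ 2)//; ring.
Qed.

End weighted_local_maximal.

(** * Strong type of the local maximal function by Marcinkiewicz interpolation *)

Section marcinkiewicz.
Context {R : realType}.
Implicit Types (s x y p r a b delta lam : R) (f g : R -> R).
Notation leb := (@lebesgue_measure R).

(** Keeping only the levels in [a/2, a[ already gives (a/2)^p, hence the factor 2^p. For [a = +oo]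
    the integral diverges because the integrand is at least 1 on every [1, 1 + b]. *)
Lemma layer_cake_le (a : \bar R) p : 1 <= p -> (0 <= a)%E ->
  (a `^ p <= (2 `^ p)%:E * \int[leb]_(lam in Rpos) (if (lam%:E < a)%E then lam `^ (p - 1) else 0)%:E)%E.
Proof.
move=> p1; have p0 : 0 < p by exact: lt_le_trans p1.
have i0 lam : 0 <= (if (lam%:E < a)%E then lam `^ (p - 1) else 0) by case: ifP => // _; exact: powR_ge0.
have I0 : (0 <= \int[leb]_(lam in Rpos) (if (lam%:E < a)%E then lam `^ (p - 1) else 0)%:E)%E.
  by apply: integral_ge0 => x _; rewrite lee_fin.
case: a i0 I0 => [a| |] i0 I0 a0 //; last first.
- rewrite [X in (_ * X)%E](_ : _ = +oo%E) ?gt0_muley ?leey ?lte_fin ?powR_gt0//.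
  apply/eqyP => b b0.
  apply: (@le_trans _ _ (\int[leb]_(lam in `[1%R, (1 + b)%R]) 1%:E)%E).
    by rewrite integral_cst_itv ?lerDl ?(ltW b0)// mul1r addrC addKr.
  apply: (@le_trans _ _ (\int[leb]_(lam in `[1%R, (1 + b)%R]) (if (lam%:E < +oo)%E then lam `^ (p - 1) else 0)%:E)%E).
    apply: ge0_integral_mono => lam /=; rewrite in_itv/= => /andP[l1 _]; first by rewrite lee_fin.
    have q0 : 0 <= p - 1 by rewrite subr_ge0.
    by rewrite ltry lee_fin -[leLHS](powRr0 lam) ler_powR.
  apply: ge0_integral_subset => [lam _|lam]; first by rewrite lee_fin.
  by rewrite in_Rpos /= in_itv/=; lra.
- rewrite lee_fin in a0; rewrite poweR_EFin.
  move: a0; rewrite le_eqVlt => /predU1P[<-|a0].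
    rewrite powR0 ?gt_eqF//; apply: mule_ge0; first by rewrite lee_fin powR_ge0.
    by apply: integral_ge0 => l _; rewrite lee_fin; case: ifP => // _; exact: powR_ge0.
  apply: (@le_trans _ _ ((2 `^ p)%:E * (\int[leb]_(lam in `[(a / 2)%R, a[) ((a / 2) `^ (p - 1))%:E))%E).
    rewrite integral_cst//= lebesgue_measure_itv/= lte_fin ifT; last lra.
    rewrite -EFinB -!EFinM lee_fin.
    have -> : a - a / 2 = a / 2 by field.
    have a2 : 0 < a / 2 by rewrite divr_gt0.
    rewrite -{2}(powRr1 (ltW a2)) -gt0_powRD// subrK -powRM ?(ltW a2)//.
    by rewrite mulrC divfK.
  rewrite lee_wpmul2l ?lee_fin ?powR_ge0//.
  apply: (@le_trans _ _ (\int[leb]_(lam in `[(a / 2)%R, a[) (if (lam%:E < a%:E)%E then lam `^ (p - 1) else 0)%:E)%E).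
    apply: ge0_integral_mono => lam /=; rewrite in_itv/= => /andP[l1 l2]; first by rewrite lee_fin powR_ge0.
    rewrite lte_fin l2 lee_fin; apply: ge0_ler_powR; rewrite ?nnegrE ?subr_ge0//; lra.
  apply: ge0_integral_subset => [lam _|lam]; first by rewrite lee_fin.
  by rewrite in_Rpos /= in_itv/=; lra.
Qed.

(** Below [b] the power lam^(p-1) equals b^p times [dker p b lam / lam], so the kernel mass [4 / p]
    bounds the integral. *)
Lemma integral_powR_lt_le p b : 0 < p -> 0 <= b ->
  (\int[leb]_(lam in Rpos) (if lam < b then lam `^ (p - 1) else 0)%:E <= (4 / p * b `^ p)%:E)%E.
Proof.
move=> p0; rewrite le_eqVlt => /predU1P[<-|b0].
  rewrite integral0_eq ?lee_fin ?mulr_ge0 ?powR_ge0 ?invr_ge0 ?(ltW p0)//.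
  by move=> x; rewrite in_Rpos => x0; rewrite ifF// le_gtF// ltW.
apply: (@le_trans _ _ (\int[leb]_(lam in Rpos) ((b `^ p)%:E * (dker p b lam / lam)%:E))%E).
  apply: ge0_integral_mono => x; rewrite in_Rpos => x0.
    by rewrite lee_fin; case: ifP => // _; exact: powR_ge0.
  rewrite -EFinM lee_fin; case: ifP => [xb|_].
    rewrite gt0_powRD// powR_inv1 ?(ltW x0)// mulrA ler_wpM2r ?invr_ge0 ?(ltW x0)//.
    rewrite /dker /powR !gt_eqF// -expRD ler_expR gtr0_norm; first lra.
    by rewrite subr_gt0 ltr_ln.
  by rewrite mulr_ge0 ?powR_ge0 ?divr_ge0 ?dker_ge0 ?(ltW x0).
rewrite ge0_integralZl ?lee_fin ?powR_ge0//.
- by rewrite mulrC EFinM lee_wpmul2l ?lee_fin ?powR_ge0//; exact: integral_dker.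
- by rewrite /dker; meas.
- by move=> x; rewrite in_Rpos => x0; rewrite lee_fin divr_ge0 ?dker_ge0 ?(ltW x0).
Qed.

(** The values of [f] not exceeding lam/2 contribute at most lam/2 to any average. *)
Lemma local_maximal_truncate f lam x : 0 < lam ->
  (forall y, 0 <= f y) -> measurable_fun setT f -> (lam%:E < local_maximal f x)%E ->
  ((lam / 2)%:E < local_maximal (fun y => (if lam / 2 < f y then f y else 0)%R) x)%E.
Proof.
move=> lam0 f0 mf /local_maximal_gtP[r rx h]; apply/local_maximal_gtP; exists r => //.
move: rx => /andP[r0 _].
pose g y := if lam / 2 < f y then f y else 0.
change ((lam / 2)%:E < (2 * r)^-1%:E * \int[leb]_(y in ball x r) (g y)%:E)%E.
have g0 y : 0 <= g y by rewrite /g; case: ifP.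
have mg : measurable_fun setT g by rewrite /g; meas.
have r2 : 0 < (2 * r)^-1 by rewrite invr_gt0 mulr_gt0.
have fg : (\int[leb]_(y in ball x r) (f y)%:E <=
    \int[leb]_(y in ball x r) (g y)%:E + (2 * r * (lam / 2))%:E)%E.
  have -> : ((2 * r * (lam / 2))%:E = \int[leb]_(y in ball x r) (lam / 2)%:E)%E.
    rewrite integral_cst; last exact: measurable_ball.
    by rewrite [X in (_ * X)%E]lebesgue_measure_ball ?(ltW r0)// -EFinM mulrC mulr_natl.
  have l20 : 0 <= lam / 2 by rewrite divr_ge0// ltW.
  rewrite -ge0_integralD//; [|exact: measurable_ball|by move=> y _; rewrite lee_fin|by meas].
  apply: ge0_integral_mono => y _; first by rewrite lee_fin.
  rewrite -EFinD lee_fin /g.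
  by case: ifPn; rewrite -?leNgt; lra.
move: h; set I := integral _ _ _; set J := integral _ _ _ => h.
have IJ : (I <= J + (2 * r * (lam / 2))%:E)%E by exact: fg.
have J0 : (0 <= J)%E by apply: integral_ge0 => y _; rewrite lee_fin.
have := lt_le_trans h (lee_wpmul2l (_ : 0 <= (2 * r)^-1%:E)%E IJ).
rewrite lee_fin (ltW r2) => /(_ isT).
rewrite ge0_muleDr ?lee_fin ?mulr_ge0 ?(ltW r0) ?divr_ge0 ?(ltW lam0)//.
rewrite -EFinM mulrA mulVf ?mul1r ?gt_eqF ?mulr_gt0//.
by rewrite -lteBlDr// -EFinB (_ : lam - lam / 2 = lam / 2)//; field.
Qed.

(** Layer cake in the level l, then the weak (1,1) bound at level l/2 for [f] truncated below l/2.
    After Tonelli the level integral of l^(p-2) over l < 2 f(y) is of order f(y)^(p-1) / (p-1),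
    which is where p > 1 enters. *)
Lemma integral_local_maximal_powR delta p : 1 < p -> exists2 C, 0 < C & forall f,
  (forall y, 0 <= f y) -> measurable_fun setT f ->
  (\int[leb]_(x in Rpos) ((x `^ delta)%:E * local_maximal f x `^ p) <=
   C%:E * \int[leb]_(y in Rpos) (y `^ delta * f y `^ p)%:E)%E.
Proof.
move=> p1; have [C C0 weak] := power_measure_local_maximal_gt delta.
have p0 : 0 < p by exact: lt_trans p1.
have p10 : 0 < p - 1 by rewrite subr_gt0.
exists (2 `^ p * (2 * C) * (4 / (p - 1) * 2 `^ (p - 1))).
  by rewrite !mulr_gt0 ?powR_gt0 ?invr_gt0.
move=> f f0 mf; have mM := measurable_local_maximal f0.
pose F (z : R * R) := (if (z.2%:E < local_maximal f z.1)%E then `|z.2| `^ (p - 1) * `|z.1| `^ delta else 0)%:E.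
have F0 z : (0 <= F z)%E by rewrite /F lee_fin; case: ifP => // _; rewrite mulr_ge0 ?powR_ge0.
have mF : measurable_fun setT F.
  apply/measurable_EFinP; apply: measurable_fun_ifT; [|by meas|by meas].
  apply: measurable_fun_lte; first by meas.
  exact: (measurableT_comp mM measurable_fst).
pose G (z : R * R) := (if z.2 < 2 * f z.1 then `|z.2| `^ (p - 1 - 1) * (`|z.1| `^ delta * f z.1) else 0)%:E.
have G0 z : (0 <= G z)%E by rewrite /G lee_fin; case: ifP => // _; rewrite !mulr_ge0 ?powR_ge0.
have mG : measurable_fun setT G by rewrite /G; meas.
have step1 : (\int[leb]_(x in Rpos) ((x `^ delta)%:E * local_maximal f x `^ p) <=
    (2 `^ p)%:E * \int[leb]_(x in Rpos) \int[leb]_(lam in Rpos) F (x, lam))%E.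
  have mI : measurable_fun setT (fun x => \int[leb]_(lam in Rpos) F (x, lam))%E.
    exact: (@measurable_fun_integral_in _ _ _ _ _ leb Rpos F).
  have p20 : (0 <= (2 `^ p)%:E)%E by rewrite lee_fin powR_ge0.
  have I0 (x : R) : Rpos x -> (0 <= \int[leb]_(lam in Rpos) F (x, lam))%E.
    by move=> _; apply: integral_ge0 => l _; exact: F0.
  have <- := @ge0_integralZl _ _ _ leb Rpos (measurable_Rpos) _ (measurable_funTS mI) _ I0 p20.
  apply: ge0_integral_mono => x; rewrite in_Rpos => x0.
    by rewrite mule_ge0 ?lee_fin ?powR_ge0 ?poweR_ge0.
  have := layer_cake_le (ltW p1) (local_maximal_ge0 f0 x0).
  move=> /(lee_wpmul2l (_ : 0 <= (x `^ delta)%:E)%E); rewrite lee_fin powR_ge0 => /(_ isT).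
  move=> /le_trans; apply; rewrite muleCA lee_wpmul2l ?lee_fin ?powR_ge0//.
  rewrite -ge0_integralZl ?lee_fin ?powR_ge0//; last 2 first.
  - apply/measurable_EFinP; apply: measurable_funTS; apply: measurable_fun_ifT; [|by meas|by meas].
    by apply: measurable_fun_lte; meas.
  - by move=> l _; rewrite lee_fin; case: ifP => // _; exact: powR_ge0.
  apply: ge0_integral_mono => l; rewrite in_Rpos => l0.
    by rewrite mule_ge0 ?lee_fin ?powR_ge0//; case: ifP => // _; exact: powR_ge0.
  rewrite /F/= -EFinM !gtr0_norm// lee_fin; case: ifP => _; last by rewrite mulr0.
  by rewrite mulrC.
have step2 l : 0 < l -> (\int[leb]_(x in Rpos) F (x, l) <=
    (2 * C)%:E * \int[leb]_(y in Rpos) G (y, l))%E.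
  move=> l0; pose g := fun y => (if l / 2 < f y then f y else 0).
  have g0 y : 0 <= g y by rewrite /g; case: ifP.
  have mg : measurable_fun setT g by rewrite /g; meas.
  pose A := [set x | ((l / 2)%:E < local_maximal g x)%E].
  have mA : measurable (A : set (measurableTypeR R)).
    by apply: open_measurable; exact: open_local_maximal_gt.
  apply: (@le_trans _ _ ((l `^ (p - 1))%:E * power_measure delta A)%E).
    rewrite /power_measure -ge0_integralZl ?lee_fin ?powR_ge0//; last 3 first.
    - by apply: measurableI.
    - by meas.
    - by move=> x _; rewrite lee_fin powR_ge0.
    rewrite [leRHS]integral_mkcond [leLHS]integral_mkcond.
    apply: ge0_integral_mono => x _; rewrite !patchE; first by case: ifP.
    have [/set_mem xR|nx] := boolP (x \in Rpos); last first.
      by rewrite ifF// in_setI (negbTE nx) andbF.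
    have x0 : 0 < x by rewrite -in_Rpos.
    rewrite /F/= !gtr0_norm//; case: ifP => [lM|_].
      rewrite ifT ?EFinM//; apply/mem_set; split => //.
      exact: local_maximal_truncate.
    by case: ifP => _//; rewrite mule_ge0 ?lee_fin ?powR_ge0.
  have l2 : 0 < l / 2 by rewrite divr_gt0.
  have c0 : (0 <= (2 * l `^ (p - 1 - 1))%:E)%E by rewrite lee_fin mulr_ge0 ?powR_ge0.
  have := lee_wpmul2l c0 (weak g (l / 2) l2 g0 mg).
  rewrite !muleA -!EFinM.
  have -> : 2 * l `^ (p - 1 - 1) * (l / 2) = l `^ (p - 1).
    rewrite -[in RHS](subrK 1 (p - 1)) [in RHS]gt0_powRD// powRr1 ?(ltW l0)//.
    by field.
  move=> /le_trans; apply.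
  have -> : 2 * l `^ (p - 1 - 1) * C = 2 * C * l `^ (p - 1 - 1) by ring.
  rewrite EFinM -muleA lee_wpmul2l ?lee_fin ?mulr_ge0 ?(ltW C0)//.
  rewrite -ge0_integralZl ?lee_fin ?powR_ge0//; last 2 first.
  - by meas.
  - by move=> y _; rewrite lee_fin mulr_ge0 ?powR_ge0.
  apply: ge0_integral_mono => y; rewrite in_Rpos => y0.
    by rewrite -EFinM lee_fin !mulr_ge0 ?powR_ge0.
  rewrite -EFinM lee_fin /G/= !gtr0_norm// /g ltr_pdivrMr// mulrC.
  by rewrite [f y * 2]mulrC; case: ifP => _; rewrite ?mulr0 ?mul0r// mulrC.
apply: le_trans step1 _.
rewrite fubini_tonelli_in//.
rewrite -(mulrA (2 `^ p)) EFinM -muleA lee_wpmul2l ?lee_fin ?powR_ge0//.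
apply: (@le_trans _ _ (\int[leb]_(l in Rpos) ((2 * C)%:E * \int[leb]_(y in Rpos) G (y, l)))%E).
  apply: ge0_integral_mono => l; rewrite in_Rpos => l0; last exact: step2.
  by apply: integral_ge0 => x _; exact: F0.
have C2 : 0 <= 2 * C by rewrite mulr_ge0// ltW.
rewrite ge0_integralZl ?lee_fin//; last 2 first.
- apply: measurable_funTS.
  apply: (@measurable_fun_integral_in _ _ _ _ _ leb Rpos (fun z => G (z.2, z.1))) => //.
  apply: (measurableT_comp mG); apply: measurable_fun_pair; [exact: measurable_snd|exact: measurable_fst].
- by move=> l _; apply: integral_ge0 => x _; exact: G0.
rewrite [in leRHS](EFinM (2 * C)) -muleA lee_wpmul2l ?lee_fin//.
rewrite -(@fubini_tonelli_in _ _ _ _ _ leb leb Rpos Rpos G)//.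
have c0 : 0 <= 4 / (p - 1) * 2 `^ (p - 1) by rewrite !mulr_ge0 ?powR_ge0 ?invr_ge0 ?(ltW p10).
rewrite -ge0_integralZl ?lee_fin//; last 2 first.
- by meas.
- by move=> y _; rewrite lee_fin mulr_ge0 ?powR_ge0.
apply: ge0_integral_mono => y; rewrite in_Rpos => y0.
  by apply: integral_ge0 => x _; exact: G0.
have w0 : 0 <= y `^ delta * f y by rewrite mulr_ge0 ?powR_ge0.
apply: (@le_trans _ _ ((y `^ delta * f y)%:E * \int[leb]_(l in Rpos) (if l < 2 * f y then l `^ (p - 1 - 1) else 0)%:E)%E).
  rewrite -ge0_integralZl ?lee_fin//; last 2 first.
  - by meas.
  - by move=> l _; rewrite lee_fin; case: ifP => // _; exact: powR_ge0.
  apply: ge0_integral_mono => l; rewrite in_Rpos => l0; first exact: G0.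
  rewrite /G/= -EFinM lee_fin !gtr0_norm//; case: ifP => _; rewrite ?mulr0//.
  by rewrite mulrC.
have f20 : 0 <= 2 * f y by rewrite mulr_ge0.
have w0E : (0 <= (y `^ delta * f y)%:E)%E by rewrite lee_fin.
apply: le_trans (lee_wpmul2l w0E (integral_powR_lt_le p10 f20)) _.
rewrite -EFinM lee_fin powRM// le_eqVlt; apply/orP; left; apply/eqP.
have -> : f y `^ p = f y * f y `^ (p - 1) by rewrite mulr_powRB1.
ring.
Qed.

End marcinkiewicz.

(** * Gaussian averages and the local maximal function *)

Section gaussian.
Context {R : realType}.
Implicit Types (s x y p r a b c u : R) (f g : R -> R).
Notation leb := (@lebesgue_measure R).

Lemma local_maximal_le_ae f c x : 0 <= c -> (forall y, 0 <= f y) -> measurable_fun setT f ->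
  {ae leb, forall y, 0 < y -> f y <= c} -> (local_maximal f x <= c%:E)%E.
Proof.
move=> c0 f0 mf fc; rewrite leNgt; apply/negP => /local_maximal_gtP[r /andP[r0 rx]].
apply/negP; rewrite -leNgt.
apply: (@le_trans _ _ ((2 * r)^-1%:E * \int[leb]_(y in ball x r) c%:E)%E).
  rewrite lee_wpmul2l ?lee_fin ?invr_ge0 ?mulr_ge0 ?(ltW r0)//.
  apply: ae_ge0_le_integral => //.
  - exact: measurable_ball.
  - by move=> y _; rewrite lee_fin.
  - by meas.
  - move: fc; apply: filterS; first exact: (ae_filter_ringOfSetsType leb).
    move=> y /= fyc; rewrite /ball/= ltr_norml => /andP[h1 h2].
    by rewrite lee_fin; apply: fyc; lra.
rewrite integral_cst; last exact: measurable_ball.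
rewrite [X in (_ * (_ * X))%E]lebesgue_measure_ball ?(ltW r0)// -!EFinM lee_fin -mulr_natl.
by rewrite le_eqVlt; apply/orP; left; apply/eqP; field; rewrite gt_eqF.
Qed.

(** For r > 0 this is 1/r below 1 and 1/r^3 above: a density for writing a Gaussian as a
    superposition of indicators of balls. It is chosen so that w(r) r = [dker 1 1 r / r] has finite
    mass. *)
Let w r : R := dker 1 1 r / r ^+ 2.

(** Only radii in ]m, 2m] with m = max(u, 1) are kept, which gives at least m (2m)^(-3) = 1 / (8
    m^2). Since m^2/4 <= 1 + u^2/4 <= exp(u^2/4), the factor 32 suffices. *)
Let expR_sqr_le u : 0 <= u ->
  ((expR (- (u ^+ 2 / 4)))%:E <= 32%:E * \int[leb]_(r in Rpos) (if u < r then w r else 0)%:E)%E.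
Proof.
move=> u0; pose m := Num.max u 1.
have [mu m1] : u <= m /\ 1 <= m by rewrite /m !le_max !lexx orbT.
have m0 : 0 < m by exact: lt_le_trans m1.
have w0 r : 0 <= w r by rewrite mulr_ge0 ?dker_ge0 ?invr_ge0 ?sqr_ge0.
apply: (@le_trans _ _ (32%:E * \int[leb]_(r in `]m, (2 * m)%R]) ((2 * m) ^- 3)%:E)%E).
  rewrite integral_cst//= lebesgue_measure_itv/= lte_fin ifT; last lra.
  rewrite -EFinB -!EFinM lee_fin expRN.
  have h : 1 + u ^+ 2 / 4 <= expR (u ^+ 2 / 4) by exact: expR_ge1Dx.
  have m2 : m ^+ 2 / 4 <= 1 + u ^+ 2 / 4.
    by rewrite /m; case: (lerP u 1) => u1; nra.
  rewrite (_ : 32 * _ = (m ^+ 2 / 4)^-1); last by field; rewrite gt_eqF.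
  rewrite lef_pV2 ?posrE ?expR_gt0 ?divr_gt0 ?exprn_gt0//.
  exact: le_trans m2 h.
rewrite lee_wpmul2l ?lee_fin//.
apply: (@le_trans _ _ (\int[leb]_(r in `]m, (2 * m)%R]) (if u < r then w r else 0)%:E)%E).
  apply: ge0_integral_mono => r /=; rewrite in_itv/= => /andP[r1 r2].
    by rewrite lee_fin invr_ge0 exprn_ge0// mulr_ge0 ?(ltW m0).
  have r0 : 0 < r by exact: lt_trans r1.
  rewrite lee_fin ifT; last by exact: le_lt_trans r1.
  rewrite /w /dker ln1 mul1r sub0r normrN ger0_norm; last by rewrite ln_ge0//; lra.
  rewrite expRN lnK ?posrE// -invfM -exprS lef_pV2 ?posrE ?exprn_gt0 ?mulr_gt0//.
  by rewrite lerXn2r ?nnegrE ?mulr_ge0 ?(ltW m0) ?(ltW r0).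
apply: ge0_integral_subset => [r _|r]; first by rewrite lee_fin; case: ifP.
by rewrite in_Rpos /= in_itv/=; lra.
Qed.

(** The Gaussian is dominated by a superposition of indicators of balls of radius a r. If a r < x/2
    the ball is admissible for the local maximal function; otherwise 1/a <= 2r/x and the integral
    over all of [x/2, 2x] takes over. Both cases carry the density 2 w(r) r, of mass at most 8, so
    the constant is 32 times 8. *)
Lemma gaussian_local_le f a x : 0 < a -> 0 < x ->
  (forall y, 0 <= f y) -> measurable_fun setT f ->
  (\int[leb]_(y in `[(x / 2)%R, (2 * x)%R]) (a^-1 * expR (- (((x - y) / a) ^+ 2 / 4)) * f y)%:E <=
   256%:E * (local_maximal f x + x^-1%:E * \int[leb]_(y in `[(x / 2)%R, (2 * x)%R]) (f y)%:E))%E.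
Proof.
move=> a0 x0 f0 mf; set J := (X in integral _ X _).
have mJ : measurable J by exact: measurable_itv.
set D := (\int[leb]_(y in J) (f y)%:E)%E.
have D0 : (0 <= D)%E by apply: integral_ge0 => y _; rewrite lee_fin.
have M0 := local_maximal_ge0 f0 x0.
have xD0 : (0 <= x^-1%:E * D)%E by rewrite mule_ge0// lee_fin invr_ge0 ltW.
set Q := (local_maximal f x + _)%E.
have Q0 : (0 <= Q)%E by rewrite adde_ge0.
have w0 r : 0 <= w r by rewrite mulr_ge0 ?dker_ge0 ?invr_ge0 ?sqr_ge0.
pose H (z : R * R) := (if `|x - z.1| / a < z.2 then w z.2 * (a^-1 * f z.1) else 0)%:E.
have H0 z : (0 <= H z)%E.
  rewrite /H lee_fin; case: ifP => // _; apply: mulr_ge0; first exact: w0.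
  by rewrite mulr_ge0 ?invr_ge0 ?(ltW a0).
have mH : measurable_fun setT H by rewrite /H /w /dker; meas.
have af0 y : 0 <= a^-1 * f y by rewrite mulr_ge0 ?invr_ge0 ?(ltW a0).
have mI : measurable_fun setT (fun y => \int[leb]_(r in Rpos) H (y, r))%E.
  exact: (@measurable_fun_integral_in _ _ _ _ _ leb Rpos H).
apply: (@le_trans _ _ (32%:E * \int[leb]_(y in J) \int[leb]_(r in Rpos) H (y, r))%E).
  have I0 y : J y -> (0 <= \int[leb]_(r in Rpos) H (y, r))%E.
    by move=> _; apply: integral_ge0 => r _; exact: H0.
  have c32 : (0 <= 32%:E :> \bar R)%E by rewrite lee_fin.
  have <- := @ge0_integralZl _ _ _ leb J mJ _ (measurable_funTS mI) _ I0 c32.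
  apply: ge0_integral_mono => y _.
    by rewrite lee_fin -mulrA mulrCA mulr_ge0 ?expR_ge0.
  have u0 : 0 <= `|x - y| / a by rewrite divr_ge0// ltW.
  have afE : (0 <= (a^-1 * f y)%:E)%E by rewrite lee_fin.
  have := lee_wpmul2l afE (expR_sqr_le u0).
  have e : (`|x - y| / a) ^+ 2 = ((x - y) / a) ^+ 2 by rewrite !expr_div_n real_normK ?num_real.
  rewrite e -EFinM mulrAC => h; apply: le_trans h _.
  rewrite muleCA lee_wpmul2l//.
  rewrite -ge0_integralZl//; last 2 first.
  - rewrite /w /dker; meas.
  - by move=> r _; rewrite lee_fin; case: ifP.
  apply: ge0_integral_mono => r _; first by rewrite mule_ge0// lee_fin; case: ifP.
  rewrite /H/= -EFinM lee_fin; case: ifP => _; last by rewrite mulr0.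
  by rewrite mulrC.
rewrite fubini_tonelli_in//.
have step r : 0 < r -> (\int[leb]_(y in J) H (y, r) <= (2 * (dker 1 1 r / r))%:E * Q)%E.
  move=> r0.
  have wr : w r * r = dker 1 1 r / r by rewrite /w; field; rewrite gt_eqF.
  have wa0 : 0 <= w r / a by exact: divr_ge0 (w0 r) (ltW a0).
  have wr0 : 0 <= 2 * (w r * r) by rewrite mulr_ge0// (mulr_ge0 (w0 r) (ltW r0)).
  pose B := J `&` ball x (a * r).
  have mB : measurable (B : set (measurableTypeR R)) by apply: measurableI => //; exact: measurable_ball.
  have Hif : (\int[leb]_(y in J) H (y, r) = (w r / a)%:E * \int[leb]_(y in B) (f y)%:E)%E.
    rewrite -ge0_integralZl ?lee_fin ?wa0//; last 2 first.
    - by meas.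
    - by move=> y _; rewrite lee_fin.
    rewrite /H/= (@integral_if _ _ _ leb _ B).
    - by apply: eq_integral => y _; rewrite -EFinM mulrA.
    - by move=> y [].
    - move=> y Jy; rewrite ltr_pdivrMr// mulrC /B/= /ball/=; split=> [h|[_ h]//]; split => //.
  have B0 : (0 <= \int[leb]_(y in B) (f y)%:E)%E by apply: integral_ge0 => y _; rewrite lee_fin.
  rewrite Hif -wr.
  have [rx|rx] := ltP (a * r) (x / 2).
    apply: (@le_trans _ _ ((2 * (w r * r))%:E * local_maximal f x)%E); last first.
      by rewrite lee_wpmul2l ?lee_fin ?wr0// leeDl.
    have -> : w r / a = 2 * (w r * r) * (2 * (a * r))^-1 by field; rewrite !gt_eqF.
    rewrite EFinM -muleA lee_wpmul2l ?lee_fin ?wr0//.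
    apply: (@le_trans _ _ ((2 * (a * r))^-1%:E * \int[leb]_(y in ball x (a * r)) (f y)%:E)%E).
      rewrite lee_wpmul2l ?lee_fin ?invr_ge0 ?mulr_ge0 ?(ltW r0) ?(ltW a0)//.
      by apply: ge0_integral_subset => [y _|y []//]; rewrite lee_fin.
    by apply: ereal_sup_ubound; exists (a * r) => //=; rewrite rx mulr_gt0.
  apply: (@le_trans _ _ ((2 * (w r * r))%:E * (x^-1%:E * D))%E); last first.
    by rewrite lee_wpmul2l ?lee_fin ?wr0// leeDr.
  rewrite muleA -EFinM.
  apply: lee_pmul => //.
  - rewrite lee_fin (_ : 2 * (w r * r) * x^-1 = w r * (2 * r / x)); last by ring.
    rewrite ler_wpM2l ?w0// ler_pdivlMr// ler_pdivrMl//; lra.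
  - by apply: ge0_integral_subset => [y _|y []//]; rewrite lee_fin.
apply: (@le_trans _ _ (32%:E * (\int[leb]_(r in Rpos) ((2 * (dker 1 1 r / r))%:E * Q)))%E).
  rewrite lee_wpmul2l ?lee_fin//.
  apply: ge0_integral_mono => r; rewrite in_Rpos => r0; last exact: step.
  by apply: integral_ge0 => y _; exact: H0.
rewrite ge0_integralZr//; last 2 first.
- by rewrite /dker; meas.
- by move=> r; rewrite in_Rpos => r0; rewrite lee_fin mulr_ge0 ?divr_ge0 ?dker_ge0 ?(ltW r0).
rewrite muleA lee_wpmul2r//.
under eq_integral do rewrite EFinM.
rewrite ge0_integralZl ?lee_fin//; last 2 first.
- by rewrite /dker; meas.
- by move=> r; rewrite in_Rpos => r0; rewrite lee_fin divr_ge0 ?dker_ge0 ?(ltW r0).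
rewrite muleA -EFinM.
apply: (@le_trans _ _ ((32 * 2)%:E * (4 / 1)%:E)%E).
  by rewrite lee_wpmul2l ?lee_fin//; exact: integral_dker.
by rewrite -EFinM lee_fin; lra.
Qed.

End gaussian.

(** * The Gamma function and modified Bessel functions *)

Section gamma.
Context {R : realType}.
Implicit Types (s x y u v p : R).
Notation leb := (@lebesgue_measure R).

Lemma powR_expRN_bounded p : 0 <= p ->
  exists2 C, 0 < C & forall v, 0 < v -> v `^ p * expR (- v) <= C.
Proof.
move=> p0; pose n := Num.trunc p.
exists (1 + n.+1`!%:R); first by rewrite ltr_pwDl.
move=> v v0.
have C1 : (1 : R) <= 1 + n.+1`!%:R by rewrite lerDl.
have [v1|v1] := lerP v 1.
  have e1 : expR (- v) <= 1 by rewrite -expR0 ler_expR oppr_le0 ltW.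
  have p1 : v `^ p <= 1.
    have e : 1 = 1 `^ p :> R by rewrite powR1.
    by rewrite [leRHS]e ge0_ler_powR ?nnegrE// ltW.
  apply: le_trans C1; rewrite -[leRHS]mulr1; apply: ler_pM => //; exact: powR_ge0.
rewrite expRN ler_pdivrMr ?expR_gt0//.
have pn : p <= n.+1%:R by apply/ltW/truncnS_gt.
apply: (@le_trans _ _ (v ^+ n.+1)).
  by rewrite -powR_mulrn ?(ltW v0)// ler_powR// ltW.
have h := expR_ge1Dxn n (ltW v0).
apply: (@le_trans _ _ (n.+1`!%:R * expR v)); last first.
  by rewrite ler_wpM2r ?expR_ge0// lerDr.
by rewrite -ler_pdivrMl ?ltr0n ?fact_gt0// mulrC; lra.
Qed.

Let gf s u : R := u `^ (s - 1) * expR (- u).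

Let gf_ge0 s u : 0 <= gf s u.
Proof. by rewrite mulr_ge0 ?powR_ge0 ?expR_ge0. Qed.

Let measurable_gf s : measurable_fun (Rpos : set R) (gf s).
Proof. by rewrite /gf; meas. Qed.

Lemma integral_gamma_lty s : 0 < s -> (\int[leb]_(u in Rpos) (gf s u)%:E < +oo)%E.
Proof.
move=> s0.
(* The exponent 2s turns u^s exp(-u) into at most C u^(-s) for u > 1, so that the integrand is
   dominated by [dker s 1 u / u] on both sides of 1. *)
have [C C0 hC] := @powR_expRN_bounded (2 * s) (ltW (mulr_gt0 (ltr0n R 2) s0)).
apply: (@le_lt_trans _ _ ((1 + C)%:E * \int[leb]_(u in Rpos) (dker s 1 u / u)%:E)%E).
  rewrite -ge0_integralZl ?lee_fin//; last 3 first.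
  - by rewrite /dker; meas.
  - by move=> u; rewrite in_Rpos => u0; rewrite lee_fin divr_ge0 ?dker_ge0 ?(ltW u0).
  - by rewrite addr_ge0// ltW.
  apply: ge0_integral_mono => u; rewrite in_Rpos => u0; first by rewrite lee_fin.
  rewrite -EFinM lee_fin /gf gt0_powRD// powR_inv1 ?(ltW u0)//.
  rewrite mulrAC mulrA ler_wpM2r ?invr_ge0 ?(ltW u0)//.
  rewrite /dker ln1 sub0r normrN.
  have [u1|u1] := lerP u 1.
    rewrite ler0_norm ?ln_le0// mulrN opprK.
    have -> : expR (s * ln u) = u `^ s by rewrite /powR gt_eqF.
    rewrite mulrC ler_wpM2r ?powR_ge0//.
    apply: (@le_trans _ _ 1); last by rewrite lerDl ltW.
    by rewrite -expR0 ler_expR oppr_le0 ltW.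
  rewrite ger0_norm ?ln_ge0 ?(ltW u1)//.
  have -> : expR (- (s * ln u)) = (u `^ s)^-1 by rewrite expRN /powR gt_eqF.
  rewrite ler_pdivlMr ?powR_gt0// mulrAC -gt0_powRD// -mulr2n -mulr_natl.
  by apply: le_trans (hC _ u0) _; rewrite lerDr.
apply: (@le_lt_trans _ _ ((1 + C)%:E * (4 / s)%:E)%E).
  by rewrite lee_wpmul2l ?lee_fin ?addr_ge0 ?(ltW C0)//; exact: integral_dker.
by rewrite -EFinM ltry.
Qed.

Let Gamma_EFin s : 0 < s -> (Gamma s)%:E = (\int[leb]_(u in Rpos) (gf s u)%:E)%E.
Proof.
move=> s0; rewrite /Gamma /Rintegral fineK// ge0_fin_numE; first exact: integral_gamma_lty.
by apply: integral_ge0 => u _; rewrite lee_fin gf_ge0.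
Qed.

Lemma Gamma_gt0 s : 0 < s -> 0 < Gamma s.
Proof.
move=> s0; rewrite -lte_fin Gamma_EFin//.
pose c : R := Num.min 1 (2 `^ (s - 1)) * expR (- 2).
have c0 : 0 < c by rewrite mulr_gt0 ?expR_gt0// lt_min ltr01 powR_gt0.
apply: (@lt_le_trans _ _ c%:E); first by rewrite lte_fin.
apply: (@le_trans _ _ (\int[leb]_(u in `[1%R, 2%R]) c%:E)%E).
  rewrite integral_cst//= lebesgue_measure_itv/= lte_fin ltr1n -EFinB -EFinM lee_fin; lra.
apply: (@le_trans _ _ (\int[leb]_(u in `[1%R, 2%R]) (gf s u)%:E)%E); last first.
  apply: ge0_integral_subset => [u _|u]; first by rewrite lee_fin.
  by rewrite in_Rpos/= in_itv/=; lra.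
apply: ge0_integral_mono => u /=; rewrite in_itv/= => /andP[u1 u2].
  by rewrite lee_fin ltW.
rewrite lee_fin; apply: ler_pM; rewrite ?expR_ge0 ?ler_expR ?lerN2//.
rewrite ge_min; have [s1|/ltW s1] := lerP 1 s.
  by rewrite -{1}(powRr0 u) ler_powR// subr_ge0.
apply/orP; right.
rewrite -(opprB 1 s) !powRN lef_pV2 ?posrE ?powR_gt0//; last lra.
rewrite ge0_ler_powR ?nnegrE ?subr_ge0//; lra.
Qed.

Let cvg_powRN s : 0 < s -> (n.+2%:R : R) `^ (- s) @[n --> \oo] --> (0 : R).
Proof.
move=> s0; apply/cvgrPdist_lt => e e0; near=> n.
rewrite sub0r normrN ger0_norm ?powR_ge0// powRN.
rewrite -[ltRHS]invrK ltf_pV2 ?posrE ?powR_gt0 ?invr_gt0//.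
have -> : e^-1 = (e^-1 `^ s^-1) `^ s.
  by rewrite -powRrM mulVf ?gt_eqF// powRr1// invr_ge0 ltW.
apply: gt0_ltr_powR; rewrite ?nnegrE ?powR_ge0//.
apply: (@lt_trans _ _ n%:R); last by rewrite ltr_nat.
near: n; exact: nbhs_infty_gtr.
Unshelve. all: by end_near. Qed.

(** Integration by parts: -u^s exp(-u) is an antiderivative of the difference of the two integrands.
    The identity is proved on the intervals [1/(n+2), n+2], along which the boundary terms tend to
    0. *)
Lemma GammaS s : 0 < s -> Gamma (s + 1) = s * Gamma s.
Proof.
move=> s0.
have s10 : 0 < s + 1 by rewrite addr_gt0.
(* For u > 0 this is u^s; the vanishing [ln 1] puts it into the form whose derivative is already
   known. *)
pose E u : R := expR (s * (ln u - ln 1)).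
have EE u : 0 < u -> E u = u `^ s by move=> u0; rewrite /E ln1 subr0 /powR gt_eqF.
pose F u : R := - (E u * expR (- u)).
pose f u : R := gf (s + 1) u - s * gf s u.
have g1 u : gf (s + 1) u = u `^ s * expR (- u) by rewrite /gf addrK.
have cp p u : 0 < u -> {for u, continuous (fun u : R => u `^ p)}.
  move=> u0; apply/differentiable_continuous/derivable1_diffP.
  by apply: derivable_powR; rewrite in_itv/= andbT.
have ce u : {for u, continuous (fun u : R => expR (- u))}.
  apply: (@continuous_comp _ _ _ -%R expR); last exact: continuous_expR.
  exact: opp_continuous.
have cgf p u : 0 < u -> {for u, continuous (gf p)}.
  by move=> u0; apply: continuousM; [exact: cp|exact: ce].
have cf u : 0 < u -> {for u, continuous f}.
  move=> u0; apply: continuousB; first exact: cgf.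
  by apply: continuousM; [exact: cst_continuous|exact: cgf].
have dF u : 0 < u -> is_derive u 1 F (f u).
  move=> u0; have dE := is_derive_expR_ln s 1 u0; rewrite -/E -/(E u) in dE.
  have de : is_derive u 1 (fun v : R => expR (- v)) (expR (- u) * (- 1)).
    have dN : is_derive u 1 (fun v : R => - v) (- 1) by apply: is_derive_eq.
    exact: (@is_derive1_comp _ expR (fun v : R => - v) u _ _ (is_derive_expR _) dN).
  apply: is_derive_eq; rewrite /f g1 /gf gt0_powRD// powR_inv1 ?(ltW u0)// EE//.
  by rewrite /GRing.scale/=; ring.
have lt2 n : (n.+2%:R^-1 : R) < n.+2%:R.
  by apply: (@lt_trans _ _ 1); rewrite ?invf_lt1 ?ltr1n ?ltr0n.
have n0 n : 0 < (n.+2%:R^-1 : R) by rewrite invr_gt0.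
pose J n : set R := `[n.+2%:R^-1, n.+2%:R]%classic.
have JR n : J n `<=` Rpos by move=> u; rewrite in_Rpos /J/= in_itv/= => /andP[+ _]; exact: lt_le_trans.
have mJ n : measurable (J n : set (measurableTypeR R)) by exact: measurable_itv.
have iJ p n : 0 < p -> leb.-integrable (J n) (EFin \o gf p).
  move=> p0; apply/integrableP; split.
    by apply/measurable_EFinP; apply: measurable_funS (measurable_gf p) => //; exact: JR.
  under eq_integral do rewrite /= ger0_norm//.
  by apply: le_lt_trans (integral_gamma_lty p0); apply: ge0_integral_subset => // u _; rewrite lee_fin.
have cvgJ p : 0 < p -> \int[leb]_(u in J n) gf p u @[n --> \oo] --> Gamma p.
  move=> p0; have h := @cvg_integral_Rpos R (gf p) (measurable_gf p) (fun x _ => gf_ge0 p x).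
  by apply: fine_cvg; rewrite Gamma_EFin.
have eqJ n : \int[leb]_(u in J n) gf (s + 1) u - s * \int[leb]_(u in J n) gf s u =
    F n.+2%:R - F n.+2%:R^-1.
  apply: EFin_inj; rewrite -(integral_derive_gt (n0 n) (lt2 n) dF cf).
  have isg : leb.-integrable (J n) (EFin \o (fun u => s * gf s u)).
    by rewrite (_ : _ \o _ = fun u => s%:E * (gf s u)%:E)%E//; exact: (@integrableZl _ _ _ leb (J n) (mJ n) s (EFin \o gf s) (iJ s n s0)).
  transitivity ((\int[leb]_(u in J n) f u)%:E).
    by rewrite /f (RintegralB (mJ n) (iJ _ n s10) isg) (RintegralZl s (mJ n) (iJ _ n s0)).
  rewrite /Rintegral fineK//; apply: integrable_fin_num => //.
  by rewrite /f; apply: (@integrableB _ _ _ leb _ (mJ n) _ _ (iJ _ n s10) isg).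
have [C C0 hC] := powR_expRN_bounded (ltW s10).
have lim0 : F n.+2%:R - F n.+2%:R^-1 @[n --> \oo] --> (0 : R).
  have F1 : F n.+2%:R @[n --> \oo] --> (0 : R).
    apply: (@squeeze_cvgr _ _ _ _ (fun n => - (C * n.+2%:R `^ (- 1))) (fun=> 0)).
    - apply: nearW => n; rewrite oppr_le0 mulr_ge0 ?expR_ge0// andbT lerN2 EE//.
      rewrite powR_inv1// ler_pdivlMr// mulrAC; have := hC n.+2%:R; rewrite gt0_powRD// powRr1//.
      exact.
    - rewrite -oppr0 -(mulr0 C); apply: cvgN; apply: cvgM; first exact: cvg_cst.
      exact: cvg_powRN.
    - exact: cvg_cst.
  have F2 : F n.+2%:R^-1 @[n --> \oo] --> (0 : R).
    apply: (@squeeze_cvgr _ _ _ _ (fun n => - (n.+2%:R `^ (- s))) (fun=> 0)).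
    - apply: nearW => n; rewrite oppr_le0 mulr_ge0 ?expR_ge0// andbT lerN2 EE//.
      rewrite powRN -powR_inv1// -powRrM mulN1r powRN -[leRHS]mulr1 ler_wpM2l ?invr_ge0 ?powR_ge0//.
    - rewrite -oppr0; apply: cvgN; exact: cvg_powRN.
    - exact: cvg_cst.
  by rewrite -(subrr 0); apply: cvgB.
have lim1 : F n.+2%:R - F n.+2%:R^-1 @[n --> \oo] --> Gamma (s + 1) - s * Gamma s.
  under eq_fun do rewrite -eqJ.
  by apply: cvgB; [exact: cvgJ|apply: cvgM; [exact: cvg_cst|exact: cvgJ]].
apply/eqP; rewrite -subr_eq0; apply/eqP.
exact: cvg_unique lim1 lim0.
Qed.

End gamma.

(** * Quotients of Pochhammer symbols *)

Section pochhammer.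
Context {R : realType}.
Implicit Types (u v x y lam a : R).

Definition rising u k : R := \prod_(j < k) (j%:R + u).

Lemma risingS u k : rising u k.+1 = rising u k * (k%:R + u).
Proof. by rewrite /rising big_ord_recr. Qed.

Lemma rising0 u : rising u 0 = 1.
Proof. by rewrite /rising big_ord0. Qed.

Lemma rising_gt0 u k : 0 < u -> 0 < rising u k.
Proof. by move=> u0; apply: prodr_gt0 => j _; rewrite ltr_wpDl. Qed.

Lemma rising_recl u k : rising u k.+1 = u * rising (u + 1) k.
Proof.
rewrite /rising big_ord_recl/= add0r; congr (_ * _); apply: eq_bigr => j _.
by rewrite /bump/= natrD; ring.
Qed.

(** A shifted harmonic sum, equal to ln k up to a bounded error. The bounds on both sides telescope
    ln(1 + z) <= z, with z = 1/(k + v) for the lower one and z = -1/(k + 1 + v) for the upper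
    one. *)
Let harm v k : R := \sum_(j < k) (j%:R + v)^-1.

Let harm_ge v k : 0 < v -> ln (k%:R + v) - ln v <= harm v k.
Proof.
move=> v0; elim: k => [|k IH]; first by rewrite add0r subrr /harm big_ord0.
rewrite /harm big_ord_recr/= -/(harm v k).
have kv : 0 < k%:R + v by rewrite ltr_wpDl.
have h : ln (1 + (k%:R + v)^-1) <= (k%:R + v)^-1.
  by apply: le_ln1Dx; rewrite (@lt_trans _ _ 0)// invr_gt0.
have -> : k.+1%:R + v = (k%:R + v) * (1 + (k%:R + v)^-1).
  by rewrite -natr1; field; rewrite gt_eqF.
rewrite lnM ?posrE// ?addr_gt0 ?invr_gt0//; lra.
Qed.

Let harm_le v k : 0 < v -> harm v k.+1 <= v^-1 + ln (k%:R + v) - ln v.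
Proof.
move=> v0; elim: k => [|k IH].
  by rewrite add0r addrK /harm big_ord1 add0r.
rewrite /harm big_ord_recr/= -/(harm v k.+1).
have kv : 0 < k%:R + v by rewrite ltr_wpDl.
have kv1 : 0 < k.+1%:R + v by rewrite ltr_wpDl.
have kv1' : (k.+1%:R + v)^-1 < 1 by rewrite invf_lt1// -natr1; lra.
have h : ln (1 - (k.+1%:R + v)^-1) <= - (k.+1%:R + v)^-1.
  by apply: le_ln1Dx; lra.
have e : k%:R + v = (k.+1%:R + v) * (1 - (k.+1%:R + v)^-1).
  by rewrite mulrBr mulr1 mulfV ?gt_eqF// -natr1; ring.
move: IH; rewrite e lnM ?posrE ?subr_gt0//; lra.
Qed.

(** With d = u - v each factor is (j + u)/(j + v) = 1 + d/(j + v) <= exp(d/(j + v)), so the quotient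
    is at most exp(d harm). As harm differs from ln(k + 1) by a bounded amount, the power (k + 1)^d
    results for either sign of d. Exchanging [u] and [v] gives the opposite bound. *)
Lemma rising_ratio_le u v : 0 < u -> 0 < v ->
  exists2 C, 0 < C & forall k, rising u k / rising v k <= C * k.+1%:R `^ (u - v).
Proof.
move=> u0 v0; pose d := u - v.
exists (expR (`|d| * (v^-1 + `|ln v| + `|ln v|))); first exact: expR_gt0.
move=> k.
have ratio : rising u k / rising v k <= expR (d * harm v k).
  elim: k => [|k IH]; first by rewrite !rising0 /harm big_ord0 mulr0 expR0 divr1.
  rewrite !risingS /harm big_ord_recr/= -/(harm v k) [in leRHS]mulrDr expRD.
  have kv : 0 < k%:R + v by rewrite ltr_wpDl.
  rewrite invfM mulrACA; apply: ler_pM => //.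
  - by rewrite divr_ge0// ltW// rising_gt0.
  - by rewrite divr_ge0 ?(ltW kv)// addr_ge0// ltW.
  - apply: le_trans (expR_ge1Dx _); rewrite /d le_eqVlt; apply/orP; left; apply/eqP.
    by field; rewrite gt_eqF.
apply: le_trans ratio _.
rewrite /powR gt_eqF// -expRD ler_expR -/d.
have kv : 0 < k%:R + v by rewrite ltr_wpDl.
have k1 : 0 < (k.+1%:R : R) by [].
have lnv : `|ln (k%:R + v) - ln k.+1%:R| <= `|ln v|.
  have [v1|v1] := lerP 1 v.
    rewrite ger0_norm; last by rewrite subr_ge0 ler_ln ?posrE// -natr1 lerD2l.
    rewrite (ger0_norm (ln_ge0 v1)) lerBlDr -lnM ?posrE// ler_ln ?posrE ?mulr_gt0//.
    have : (0 : R) <= k%:R by []. rewrite -natr1; nra.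
  rewrite ler0_norm; last by rewrite subr_le0 ler_ln ?posrE// -natr1 lerD2l ltW.
  rewrite (ler0_norm (ln_le0 (ltW v1))) opprB lerBlDr -lerBlDl opprK -lnM ?posrE//.
  rewrite ler_ln ?posrE ?mulr_gt0//.
  have : (0 : R) <= k%:R by []. rewrite -natr1; nra.
have lv := ler_norm (ln v); have lv' := ler_norm (- ln v); rewrite normrN in lv'.
have i0 : 0 < v^-1 by rewrite invr_gt0.
have hh : `|harm v k - ln k.+1%:R| <= v^-1 + `|ln v| + `|ln v|.
  move: lnv; rewrite !ler_norml => /andP[l1 l2]; apply/andP; split.
    have := harm_ge k v0; lra.
  have := harm_le k v0.
  rewrite /harm big_ord_recr/= -/(harm v k) => h.
  have : 0 < (k%:R + v)^-1 by rewrite invr_gt0.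
  lra.
rewrite -lerBlDr -mulrBr; apply: le_trans (ler_norm _) _.
by rewrite normrM ler_wpM2l.
Qed.

End pochhammer.

(** * Moments of the Taylor terms of cosh *)

Section even_exponential.
Context {R : realType}.
Implicit Types (lam y a : R).

Definition expR_even_coeff lam k : R := lam ^+ (2 * k) / (2 * k)`!%:R.
Local Notation b := expR_even_coeff.

Let b_ge0 lam k : 0 <= b lam k.
Proof. by rewrite divr_ge0// exprn_even_ge0// mul2n odd_double. Qed.

Lemma cvg_expR_even lam : series (b lam) n @[n --> \oo] --> (expR lam + expR (- lam)) / 2.
Proof.
have e n : series (b lam) n =
    (series (exp_coeff lam) (2 * n)%N + series (exp_coeff (- lam)) (2 * n)%N) / 2.
  elim: n => [|n IH]; first by rewrite muln0 /series/= !big_nil addr0 mul0r.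
  rewrite /series/= big_nat_recr//= -[X in X + _]/(series (b lam) n) IH.
  have -> : (2 * n.+1 = (2 * n).+2)%N by rewrite mulnS.
  rewrite !big_nat_recr//= /series/= /exp_coeff/= /b.
  have e1 : (- lam) ^+ (2 * n) = lam ^+ (2 * n) by rewrite !exprM sqrrN.
  have e2 : (- lam) ^+ (2 * n).+1 = - lam ^+ (2 * n).+1 by rewrite !exprS e1 mulNr.
  rewrite e1 e2; lra.
under eq_fun do rewrite e.
have sub x : series (exp_coeff x) (2 * n)%N @[n --> \oo] --> expR x.
  have h : series (exp_coeff x) n @[n --> \oo] --> expR x by exact: is_cvg_series_exp_coeff.
  apply: cvg_comp h; apply/cvgnyPge => A; near=> n.
  apply: (@leq_trans n); last by rewrite leq_pmull.
  by near: n; exact: nbhs_infty_ge.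
apply: cvgM; last exact: cvg_cst.
by apply: cvgD; exact: sub.
Unshelve. all: by end_near. Qed.

Lemma nondecreasing_series_ge0 (c : R^nat) : (forall n, 0 <= c n) -> nondecreasing_seq (series c).
Proof.
move=> c0; apply/nondecreasing_seqP => n.
by rewrite /series/= big_nat_recr//= lerDl.
Qed.

Lemma expR_even_le lam n : 0 <= lam -> series (b lam) n <= expR lam.
Proof.
move=> l0; have h := @cvg_expR_even lam.
have := nondecreasing_cvgn_le (nondecreasing_series_ge0 (b_ge0 lam)).
move=> /(_ (cvgP _ h) n); rewrite (cvg_lim _ h)// => /le_trans; apply.
have : expR (- lam) <= expR lam by rewrite ler_expR; lra.
lra.
Qed.

(** This recurrence trades a factor lam^2 for one of order k^2 together with a shift of the index;
    both moment bounds rest on it. *)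
Let bS lam k : b lam k.+1 * ((2 * k%:R + 1) * (2 * k%:R + 2)) = lam ^+ 2 * b lam k.
Proof.
rewrite /b (_ : 2 * k.+1 = (2 * k).+2)%N ?mulnS// !factS !natrM.
have -> : (2 * k).+1%:R = 2 * k%:R + 1 :> R by rewrite -natr1 natrM.
have -> : (2 * k).+2%:R = 2 * k%:R + 2 :> R by rewrite -2!natr1 natrM; ring.
have k0 : 0 <= k%:R :> R by [].
rewrite !exprS; field.
by rewrite !gt_eqF ?ltr0n ?fact_gt0//; lra.
Qed.

(* The terms lam^(2k)/(2k)! concentrate at k of order lam: all moments of (1+lam)/(k+1) are bounded. *)
Lemma expR_even_neg_moment m : exists2 C, 0 < C & forall lam n, 0 <= lam ->
  \sum_(0 <= k < n) b lam k * ((1 + lam) / k.+1%:R) ^+ (2 * m) <= C * expR lam.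
Proof.
elim: m => [|m [C C0 IH]].
  exists 1 => // lam n l0; rewrite mul1r; apply: le_trans (expR_even_le n l0).
  by rewrite /series/= ler_sum// => k _; rewrite muln0 expr0 mulr1.
exists ((2 + 8 * 4 ^+ m) * C); first by rewrite mulr_gt0// addr_gt0// mulr_gt0// exprn_gt0.
move=> lam n l0.
pose T k := b lam k * ((1 + lam) / k.+1%:R) ^+ (2 * m).
have T0 k : 0 <= T k by apply: mulr_ge0 (b_ge0 _ _) _; rewrite exprn_ge0 ?divr_ge0 ?addr_ge0.
(* Two powers are removed at a time: (1 + lam)^2 is at most 2 (k+1)^2 + 2 lam^2, and the recurrence
   absorbs lam^2 / (k+1)^2 into 4 times the next term. Passing from k+1 to k+2 in the remaining 2m
   powers costs 4^m. *)
have step k : b lam k * ((1 + lam) / k.+1%:R) ^+ (2 * m.+1) <= 2 * T k + 8 * 4 ^+ m * T k.+1.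
  have k1 : 0 < k.+1%:R :> R by [].
  have kk : k.+1%:R = k%:R + 1 :> R by rewrite natr1.
  have kk2 : k.+2%:R = k.+1%:R + 1 :> R by rewrite natr1.
  have k0 : 0 <= k%:R :> R by [].
  rewrite mulnS exprD mulrCA -/(T k).
  have h1 : ((1 + lam) / k.+1%:R) ^+ 2 <= 2 + 2 * (lam ^+ 2 / k.+1%:R ^+ 2).
    rewrite expr_div_n ler_pdivrMr ?exprn_gt0//.
    rewrite mulrDl -mulrA divfK ?expf_neq0 ?gt_eqF//.
    have : 1 <= k.+1%:R ^+ 2 :> R by rewrite exprn_ege1// kk lerDr.
    have : 0 <= (1 - lam) ^+ 2 by exact: sqr_ge0.
    nra.
  have h2 : lam ^+ 2 / k.+1%:R ^+ 2 * b lam k <= 4 * b lam k.+1.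
    rewrite mulrAC -bS ler_pdivrMr ?exprn_gt0//.
    have := b_ge0 lam k.+1; move: (b lam k.+1) => B B0.
    have hk : (2 * k%:R + 1) * (2 * k%:R + 2) <= 4 * k.+1%:R ^+ 2 :> R by rewrite kk; nra.
    have := ler_wpM2l B0 hk; lra.
  have h3 : ((1 + lam) / k.+1%:R) ^+ (2 * m) <= 4 ^+ m * ((1 + lam) / k.+2%:R) ^+ (2 * m).
    have X0 : 0 <= (1 + lam) / k.+1%:R by rewrite divr_ge0 // addr_ge0.
    have Y0 : 0 <= (1 + lam) / k.+2%:R by rewrite divr_ge0 // addr_ge0.
    have XY : (1 + lam) / k.+1%:R <= 2 * ((1 + lam) / k.+2%:R).
      rewrite mulrCA ler_wpM2l ?addr_ge0// ler_pdivlMr// ler_pdivrMl// kk2 kk; lra.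
    rewrite (_ : 4 = 2 ^+ 2 :> R); last by ring.
    by rewrite -exprM -exprMn lerXn2r ?nnegrE ?X0 ?XY// (mulr_ge0 _ Y0).
  apply: (@le_trans _ _ ((2 + 2 * (lam ^+ 2 / k.+1%:R ^+ 2)) * T k)); first by rewrite ler_wpM2r.
  rewrite mulrDl lerD2l.
  have p1 : 0 <= lam ^+ 2 / k.+1%:R ^+ 2 * b lam k.
    by apply: mulr_ge0 (b_ge0 _ _); rewrite divr_ge0 ?sqr_ge0.
  have p2 : 0 <= ((1 + lam) / k.+1%:R) ^+ (2 * m) by rewrite exprn_ge0 ?divr_ge0// addr_ge0.
  have := ler_pM p1 p2 h2 h3; rewrite /T.
  move: (b lam k) (b lam k.+1) (_ ^+ (2 * m)) (_ ^+ (2 * m)) (lam ^+ 2 / _) (4 ^+ m) => *; lra.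
apply: (@le_trans _ _ (2 * \sum_(0 <= k < n) T k + 8 * 4 ^+ m * \sum_(0 <= k < n.+1) T k)).
  rewrite big_nat_recl// !mulr_sumr.
  apply: (@le_trans _ _ (\sum_(0 <= k < n) (2 * T k + 8 * 4 ^+ m * T k.+1))); first exact: ler_sum.
  rewrite big_split/= lerD2l mulrDr -mulr_sumr lerDr.
  by apply: mulr_ge0 (T0 0%N); rewrite mulr_ge0 ?exprn_ge0.
have e4 : 0 <= 8 * 4 ^+ m :> R by rewrite mulr_ge0// exprn_ge0.
have := ler_wpM2l e4 (IH lam n.+1 l0); have := ler_wpM2l (ler0n R 2) (IH lam n l0).
rewrite -/T; lra.
Qed.

(** The recurrence gives (k+2)^2 b_(k+1) <= 2 lam^2 b_k. The square is enough: the exponent to be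
    controlled later is mu + 1/2, which stays above -2. *)
Lemma expR_even_pos_moment lam n : 0 <= lam ->
  \sum_(0 <= k < n) b lam k * (k.+1%:R / (1 + lam)) ^+ 2 <= 2 * expR lam.
Proof.
move=> l0; have l1 : 0 < 1 + lam by rewrite ltr_pwDl.
have e1 : 1 <= expR lam by rewrite -expR0 ler_expR.
have step k : b lam k.+1 * k.+2%:R ^+ 2 <= 2 * lam ^+ 2 * b lam k.
  have := bS lam k; have := b_ge0 lam k.+1; move: (b lam k.+1) (b lam k) => B B' B0 e.
  have k0 : 0 <= k%:R :> R by [].
  have h : k.+2%:R ^+ 2 <= 2 * ((2 * k%:R + 1) * (2 * k%:R + 2)) :> R by rewrite -2!natr1; nra.
  by have := ler_wpM2l B0 h; lra.
have bound : \sum_(0 <= k < n) b lam k * k.+1%:R ^+ 2 <= 1 + 2 * lam ^+ 2 * expR lam.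
  case: n => [|n]; first by rewrite big_nil addr_ge0 ?mulr_ge0 ?sqr_ge0 ?expR_ge0.
  rewrite big_nat_recl//; apply: lerD; first by rewrite /b muln0 expr0 fact0 divr1 mul1r expr1n.
  apply: (@le_trans _ _ (\sum_(0 <= k < n) 2 * lam ^+ 2 * b lam k)); first exact: ler_sum.
  by rewrite -mulr_sumr ler_wpM2l ?mulr_ge0 ?sqr_ge0//; exact: expR_even_le.
have -> : \sum_(0 <= k < n) b lam k * (k.+1%:R / (1 + lam)) ^+ 2 =
    (\sum_(0 <= k < n) b lam k * k.+1%:R ^+ 2) / (1 + lam) ^+ 2.
  by rewrite mulr_suml; apply: eq_bigr => k _; rewrite expr_div_n mulrA.
rewrite ler_pdivrMr ?exprn_gt0//; apply: le_trans bound _; nra.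
Qed.

Lemma powR_le_moments m y a : -2 <= a <= (2 * m)%:R -> 0 < y ->
  y `^ a <= 1 + y ^+ (2 * m) + y^-1 ^+ 2.
Proof.
move=> /andP[a1 a2] y0; have yi0 : 0 < y^-1 by rewrite invr_gt0.
have := exprn_gt0 (2 * m) y0; have := exprn_gt0 2 yi0.
have [y1|y1] := lerP 1 y.
  have : y `^ a <= y ^+ (2 * m) by rewrite -powR_mulrn ?(ltW y0)// ler_powR.
  lra.
have : y `^ a <= y^-1 ^+ 2; last lra.
rewrite -powR_mulrn ?(ltW yi0)// -powR_inv1 ?(ltW y0)// -powRrM mulN1r.
by rewrite ger_powR// y0 ltW.
Qed.

(** A pointwise Chebyshev device. If y leaves [1/M, M], one of the squares exceeds 1 and the left
    side is not positive; inside, y^a >= M^(-|a|). Summation then needs only second moments of y and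
    of 1/y. *)
Lemma powR_ge_moments M y a : 1 <= M -> 0 < y ->
  M `^ (- `|a|) * (1 - (y / M) ^+ 2 - (y^-1 / M) ^+ 2) <= y `^ a.
Proof.
move=> M1 y0; have M0 : 0 < M by exact: lt_le_trans M1.
have yi0 : 0 < y^-1 by rewrite invr_gt0.
have c0 := powR_gt0 (- `|a|) M0.
have ya := powR_gt0 a y0.
have s1 := sqr_ge0 (y / M); have s2 := sqr_ge0 (y^-1 / M).
have [yM|yM] := lerP y M; last first.
  have : 1 < (y / M) ^+ 2 by rewrite exprn_egt1// ltr_pdivlMr// mul1r.
  move=> h; apply: le_trans (ltW ya); rewrite mulr_ge0_le0 ?(ltW c0)//; lra.
have [yM'|yM'] := lerP y^-1 M; last first.
  have : 1 < (y^-1 / M) ^+ 2 by rewrite exprn_egt1// ltr_pdivlMr// mul1r.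
  move=> h; apply: le_trans (ltW ya); rewrite mulr_ge0_le0 ?(ltW c0)//; lra.
apply: (@le_trans _ _ (M `^ (- `|a|))).
  by rewrite -[leRHS]mulr1 ler_wpM2l ?(ltW c0)//; lra.
rewrite /powR !gt_eqF// ler_expR mulNr.
have lM : `|ln y| <= ln M.
  rewrite ler_norml ler_ln ?posrE// yM andbT lerNl -lnV ?posrE// ler_ln ?posrE//.
have := ler_norm (- (a * ln y)); rewrite normrN normrM.
have := ler_wpM2l (normr_ge0 a) lM; lra.
Qed.

End even_exponential.

(** * Two-sided bounds for the modified Bessel function *)

Section bessel_series.
Context {R : realType}.
Implicit Types (mu w u a : R).
Local Notation b := expR_even_coeff.

(* [bessel_series mu (w^2)] is Gamma(mu+1) w^(-mu) I_mu(2w). *)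
Definition bessel_series_coeff mu k : R := (k`!%:R * rising (mu + 1) k)^-1.
Definition bessel_series mu u : R := limn (pseries (bessel_series_coeff mu) u).

Lemma bessel_series_coeff_gt0 mu k : -1 < mu -> 0 < bessel_series_coeff mu k.
Proof.
by move=> mu1; rewrite invr_gt0 mulr_gt0 ?ltr0n ?fact_gt0// rising_gt0//; lra.
Qed.

(** Rests on (2k)! = 4^k k! (1/2)_k. At mu = -1/2 the quotient of Pochhammer symbols is 1 and the
    series is cosh(2w); other parameters are weighted versions of it. *)
Lemma bessel_series_coeffE mu w k : -1 < mu ->
  bessel_series_coeff mu k * (w ^+ 2) ^+ k =
  b (2 * w) k * (rising 2^-1 k / rising (mu + 1) k).
Proof.
move=> mu1.
have fE : ((2 * k)`!%:R = 4 ^+ k * k`!%:R * rising 2^-1 k :> R).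
  elim: k => [|k IH]; first by rewrite muln0 expr0 rising0 !mulr1.
  have a1 : (2 * k).+1%:R = 2 * k%:R + 1 :> R by rewrite -natr1 natrM.
  have a2 : (2 * k).+2%:R = 2 * k%:R + 2 :> R by rewrite -2!natr1 natrM; ring.
  rewrite (_ : 2 * k.+1 = (2 * k).+2)%N ?mulnS// 2!factS 2!natrM IH a1 a2 risingS exprS factS natrM -natr1.
  by field.
have r1 : rising (mu + 1) k != 0 by rewrite gt_eqF// rising_gt0//; lra.
have r2 : rising 2^-1 k != 0 :> R by rewrite gt_eqF// rising_gt0// invr_gt0.
have k0 : k`!%:R != 0 :> R by rewrite gt_eqF// ltr0n fact_gt0.
have f0 : 4 ^+ k != 0 :> R by rewrite expf_neq0.
have e : (2 * w) ^+ (2 * k) = 4 ^+ k * (w ^+ 2) ^+ k.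
  by rewrite exprM (_ : (2 * w) ^+ 2 = 4 * w ^+ 2) ?exprMn//; ring.
by rewrite /bessel_series_coeff /b fE e; field; rewrite r1 r2 k0 f0.
Qed.

(** With a = mu + 1/2 and y_k = (1 + lam)/(k + 1), the weight of the k-th cosh term is at most C
    (k+1)^(-a) = C (1 + lam)^(-a) y_k^a, and the moment bounds sum the powers of y_k. Partial sums
    are used because convergence of the series is deduced from this. *)
Lemma bessel_series_partial_le mu : -1 < mu -> exists2 C, 0 < C &
  forall w n, 0 <= w -> pseries (bessel_series_coeff mu) (w ^+ 2) n <=
    C * (1 + 2 * w) `^ (- (mu + 2^-1)) * expR (2 * w).
Proof.
move=> mu1; set a := mu + 2^-1.
have half : 0 < 2^-1 :> R by rewrite invr_gt0.
have mu10 : 0 < mu + 1 by lra.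
have [C C0 hC] := rising_ratio_le half mu10.
pose m := (Num.trunc `|a|).+1.
have [D D0 hD] := @expR_even_neg_moment R m.
exists (C * (1 + D + 2)); first by rewrite mulr_gt0// !addr_gt0.
move=> w n w0; set lam := 2 * w.
have l0 : 0 <= lam by rewrite mulr_ge0.
have l1 : 0 < 1 + lam by rewrite ltr_pwDl.
have am : -2 <= a <= (2 * m)%:R.
  apply/andP; split; first by rewrite /a; lra.
  apply: le_trans (ler_norm _) _; apply/ltW/(lt_le_trans (truncnS_gt _)).
  by rewrite ler_nat leq_pmull.
pose y k := (1 + lam) / k.+1%:R.
have y0 k : 0 < y k by rewrite divr_gt0.
have hk k : bessel_series_coeff mu k * (w ^+ 2) ^+ k <=
    C * (1 + lam) `^ (- a) * (b lam k + b lam k * (y k) ^+ (2 * m) + b lam k * (k.+1%:R / (1 + lam)) ^+ 2).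
  rewrite bessel_series_coeffE// -/lam.
  have b0 : 0 <= b lam k by rewrite /b divr_ge0 ?exprn_ge0.
  have e : k.+1%:R `^ (2^-1 - (mu + 1)) = (1 + lam) `^ (- a) * y k `^ a.
    rewrite (_ : 2^-1 - (mu + 1) = - a); last by rewrite /a; lra.
    rewrite /y powRM ?(ltW l1) ?invr_ge0// -powR_inv1// -powRrM mulN1r mulrA -gt0_powRD//.
    by rewrite addNr powRr0 mul1r.
  have := powR_le_moments am (y0 k).
  rewrite {2}/y invf_div => h.
  apply: (@le_trans _ _ (b lam k * (C * ((1 + lam) `^ (- a) * y k `^ a)))).
    by rewrite ler_wpM2l// -e.
  have c0 : 0 <= b lam k * (C * (1 + lam) `^ (- a)) by apply: mulr_ge0 => //; rewrite mulr_ge0 ?powR_ge0 ?(ltW C0).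
  have := ler_wpM2l c0 h; lra.
apply: (@le_trans _ _ (\sum_(0 <= k < n) (C * (1 + lam) `^ (- a) * (b lam k + b lam k * (y k) ^+ (2 * m) + b lam k * (k.+1%:R / (1 + lam)) ^+ 2)))).
  by rewrite /pseries /series/=; apply: ler_sum => k _; exact: hk.
rewrite -mulr_sumr !big_split/=.
have h1 := expR_even_le n l0; have h2 := hD lam n l0; have h3 := expR_even_pos_moment n l0.
rewrite /series/= in h1.
have c0 : 0 <= C * (1 + lam) `^ (- a) by rewrite mulr_ge0 ?powR_ge0 ?(ltW C0).
apply: (@le_trans _ _ (C * (1 + lam) `^ (- a) * (expR lam + D * expR lam + 2 * expR lam))).
  by rewrite ler_wpM2l// lerD// lerD.
rewrite le_eqVlt; apply/orP; left; apply/eqP; ring.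
Qed.

Lemma is_cvg_bessel_series mu u : -1 < mu -> 0 <= u -> cvgn (pseries (bessel_series_coeff mu) u).
Proof.
move=> mu1 u0; have [C C0 h] := bessel_series_partial_le mu1.
apply: nondecreasing_is_cvgn.
  apply: nondecreasing_series_ge0 => k; rewrite mulr_ge0 ?exprn_ge0//.
  exact/ltW/bessel_series_coeff_gt0.
exists (C * (1 + 2 * Num.sqrt u) `^ (- (mu + 2^-1)) * expR (2 * Num.sqrt u)) => _ [n _ <-].
by have := h (Num.sqrt u) n (sqrtr_ge0 u); rewrite sqr_sqrtr.
Qed.

Lemma bessel_series_le mu : -1 < mu -> exists2 C, 0 < C & forall w, 0 <= w ->
  bessel_series mu (w ^+ 2) <= C * (1 + 2 * w) `^ (- (mu + 2^-1)) * expR (2 * w).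
Proof.
move=> mu1; have [C C0 h] := bessel_series_partial_le mu1; exists C => // w w0.
apply: limr_le; first by apply: is_cvg_bessel_series => //; exact: sqr_ge0.
by apply: nearW => n; exact: h.
Qed.

(** The same weights bounded from below: terms with y_k in [1/M, M] carry most of the cosh series,
    and there the weight is of order (1 + lam)^(-a). *)
Lemma bessel_series_ge mu : -1 < mu -> exists2 c, 0 < c & forall w, 0 <= w ->
  c * (1 + 2 * w) `^ (- (mu + 2^-1)) * expR (2 * w) <= bessel_series mu (w ^+ 2).
Proof.
move=> mu1; set a := mu + 2^-1.
have half : 0 < 2^-1 :> R by rewrite invr_gt0.
have mu10 : 0 < mu + 1 by lra.
have [C C0 hC] := rising_ratio_le mu10 half.
have [D D0 hD] := @expR_even_neg_moment R 1.
(* Since M^2 >= 4 (D + 2), the two tails cost at most exp(lam)/4, while the cosh series itself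
   contributes at least exp(lam)/2. *)
pose M : R := 1 + 4 * (D + 2).
have M1 : 1 <= M by rewrite lerDl; lra.
have M0 : 0 < M by lra.
exists (C^-1 * M `^ (- `|a|) / 4); first by rewrite !mulr_gt0 ?invr_gt0 ?powR_gt0.
move=> w w0; set lam := 2 * w.
have l0 : 0 <= lam by rewrite mulr_ge0.
have l1 : 0 < 1 + lam by rewrite ltr_pwDl.
pose y k := (1 + lam) / k.+1%:R.
have y0 k : 0 < y k by rewrite divr_gt0.
pose c := C^-1 * (1 + lam) `^ (- a) * M `^ (- `|a|).
have c0 : 0 < c by rewrite !mulr_gt0 ?invr_gt0 ?powR_gt0.
have hk k : c * (b lam k - (M ^- 2 * (b lam k * (y k) ^+ (2 * 1)) + M ^- 2 * (b lam k * (k.+1%:R / (1 + lam)) ^+ 2))) <=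
    bessel_series_coeff mu k * (w ^+ 2) ^+ k.
  rewrite bessel_series_coeffE// -/lam.
  have b0 : 0 <= b lam k by rewrite /b divr_ge0 ?exprn_ge0.
  have r1 : 0 < rising (mu + 1) k by rewrite rising_gt0.
  have r2 : 0 < rising 2^-1 k :> R by rewrite rising_gt0.
  have e' : (1 + lam) `^ (- a) * y k `^ a = k.+1%:R `^ (- a).
    rewrite /y powRM ?(ltW l1) ?invr_ge0// -powR_inv1// -powRrM mulN1r mulrA -gt0_powRD//.
    by rewrite addNr powRr0 mul1r.
  have e : k.+1%:R `^ (mu + 1 - 2^-1) = ((1 + lam) `^ (- a) * y k `^ a)^-1.
    by rewrite e' powRN invrK (_ : mu + 1 - 2^-1 = a)// /a; lra.
  have ratio : C^-1 * ((1 + lam) `^ (- a) * y k `^ a) <= rising 2^-1 k / rising (mu + 1) k.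
    rewrite -[leLHS]invrK -[leRHS]invrK lef_pV2 ?posrE ?invr_gt0 ?divr_gt0//; last first.
      by rewrite mulr_gt0 ?invr_gt0// mulr_gt0 ?powR_gt0.
    by rewrite invf_div invfM invrK -e.
  apply: le_trans (ler_wpM2l b0 ratio).
  have := powR_ge_moments a M1 (y0 k).
  have yZ : (y k)^-1 = k.+1%:R / (1 + lam) by rewrite invf_div.
  rewrite yZ => h.
  have d0 : 0 <= b lam k * (C^-1 * (1 + lam) `^ (- a)) by apply: mulr_ge0 => //; rewrite mulr_ge0 ?powR_ge0 ?invr_ge0 ?(ltW C0).
  have := ler_wpM2l d0 h.
  have sq (x : R) : (x / M) ^+ 2 = M ^- 2 * x ^+ 2 by rewrite expr_div_n mulrC.
  rewrite muln1 !sq /c; move: (y k ^+ 2) ((k.+1%:R / (1 + lam)) ^+ 2) (M ^- 2) => *; lra.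
have key n : c * (series (b lam) n - expR lam / 4) <= pseries (bessel_series_coeff mu) (w ^+ 2) n.
  apply: (@le_trans _ _ (\sum_(0 <= k < n) c * (b lam k - (M ^- 2 * (b lam k * (y k) ^+ (2 * 1)) + M ^- 2 * (b lam k * (k.+1%:R / (1 + lam)) ^+ 2))))).
    rewrite -mulr_sumr ler_wpM2l ?(ltW c0)// sumrB big_split/= -!mulr_sumr /series/= lerD2l lerN2.
    rewrite -mulrDr.
    have h2 := hD lam n l0; have h3 := expR_even_pos_moment n l0.
    rewrite mulrC ler_pdivrMr ?exprn_gt0//.
    apply: le_trans (lerD h2 h3) _.
    have E0 := expR_gt0 lam.
    have : 4 * (D + 2) <= M ^+ 2 by rewrite /M; nra.
    nra.
  by rewrite /pseries /series/=; apply: ler_sum => k _; exact: hk.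
have cv := is_cvg_bessel_series mu1 (sqr_ge0 w).
have cve := @cvg_expR_even R lam.
have cvl : c * (series (b lam) n - expR lam / 4) @[n --> \oo] --> c * ((expR lam + expR (- lam)) / 2 - expR lam / 4).
  by apply: cvgM; [exact: cvg_cst|apply: cvgB => //; exact: cvg_cst].
apply: (@le_trans _ _ (c * ((expR lam + expR (- lam)) / 2 - expR lam / 4))).
  have E0 := expR_gt0 (- lam).
  have -> : C^-1 * M `^ (- `|a|) / 4 * (1 + lam) `^ (- a) * expR lam = c * (expR lam / 4) by rewrite /c; lra.
  rewrite ler_wpM2l ?(ltW c0)//; lra.
rewrite -(cvg_lim _ cvl)//; apply: ler_lim => //; first exact: cvgP cvl.
by apply: nearW => n; exact: key.
Qed.

(** Continuity through termwise differentiation: the derived series is that of parameter mu + 1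
    divided by mu + 1, so the first and second derived series converge too. They are taken at u + 1,
    strictly beyond u. *)
Lemma continuous_bessel_series mu u : -1 < mu -> 0 <= u -> {for u, continuous (bessel_series mu)}.
Proof.
move=> mu1 u0.
have diff nu : -1 < nu -> pseries_diffs (bessel_series_coeff nu) = (fun k => (nu + 1)^-1 * bessel_series_coeff (nu + 1) k).
  move=> nu1; apply/funext => k; rewrite /pseries_diffs /bessel_series_coeff rising_recl factS natrM.
  have n1 : nu + 1 != 0 by rewrite gt_eqF//; lra.
  have r1 : rising (nu + 1 + 1) k != 0 by rewrite gt_eqF// rising_gt0//; lra.
  have k0 : k`!%:R != 0 :> R by rewrite gt_eqF// ltr0n fact_gt0.
  by field; rewrite n1 r1 k0/= addrC natr1 pnatr_eq0.
have u10 : 0 <= u + 1 by rewrite addr_ge0.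
have cvZ nu c : -1 < nu -> cvgn (pseries (fun k => c * bessel_series_coeff nu k) (u + 1)).
  move=> nu1.
  have -> : pseries (fun k => c * bessel_series_coeff nu k) (u + 1) =
      (fun n => c * pseries (bessel_series_coeff nu) (u + 1) n).
    apply/funext => n; rewrite /pseries /series/= mulr_sumr.
    by apply: eq_bigr => k _; rewrite mulrA.
  by apply: is_cvgMr; exact: is_cvg_bessel_series.
have := @pseries_snd_diffs R (bessel_series_coeff mu) (u + 1) u.
case.
- exact: is_cvg_bessel_series.
- by rewrite diff//; apply: cvZ; lra.
- rewrite diff//.
  have -> : pseries_diffs (fun k => (mu + 1)^-1 * bessel_series_coeff (mu + 1) k) =
      fun k => (mu + 1)^-1 * (mu + 1 + 1)^-1 * bessel_series_coeff (mu + 1 + 1) k.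
    apply/funext => k; have := congr1 (fun f => f k) (diff (mu + 1) (ltr_wpDr ler01 mu1)).
    by rewrite /pseries_diffs mulrCA => ->; rewrite mulrA.
  by apply: cvZ; lra.
- by rewrite !ger0_norm//; lra.
- by move=> d _; apply/differentiable_continuous/derivable1_diffP.
Qed.

Lemma besselIE mu w : -1 < mu -> 0 < w ->
  besselI mu (2 * w) = w `^ mu / Gamma (mu + 1) * bessel_series mu (w ^+ 2).
Proof.
move=> mu1 w0; have mu10 : 0 < mu + 1 by lra.
have G0 := Gamma_gt0 mu10.
have GE k : Gamma (k%:R + mu + 1) = Gamma (mu + 1) * rising (mu + 1) k.
  elim: k => [|k IH]; first by rewrite add0r rising0 mulr1.
  rewrite -natr1 (_ : k%:R + 1 + mu + 1 = k%:R + mu + 1 + 1); last by ring.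
  have kp : 0 < k%:R + mu + 1 by rewrite -addrA ltr_wpDl.
  by rewrite (GammaS kp) IH risingS addrA mulrC mulrA.
rewrite /besselI /bessel_series.
have -> : besselI_coeff mu (2 * w) = (fun k => w `^ mu / Gamma (mu + 1) * (bessel_series_coeff mu k * (w ^+ 2) ^+ k)).
  apply/funext => k; rewrite /besselI_coeff GE /bessel_series_coeff.
  rewrite (_ : 2 * w / 2 = w); last by field.
  rewrite gt0_powRD// -natrM powR_mulrn ?(ltW w0)// exprM.
  have r1 : rising (mu + 1) k != 0 by rewrite gt_eqF// rising_gt0.
  have k0 : k`!%:R != 0 :> R by rewrite gt_eqF// ltr0n fact_gt0.
  by field; rewrite r1 k0 gt_eqF.
have -> : series (fun k => w `^ mu / Gamma (mu + 1) * (bessel_series_coeff mu k * (w ^+ 2) ^+ k)) =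
   (fun n => w `^ mu / Gamma (mu + 1) * pseries (bessel_series_coeff mu) (w ^+ 2) n).
  by apply/funext => n; rewrite /pseries /series/= mulr_sumr.
apply/cvg_lim => //; apply: cvgM; first exact: cvg_cst.
exact: is_cvg_bessel_series mu1 (sqr_ge0 w).
Qed.

Lemma bessel_series_ge0 mu u : -1 < mu -> 0 <= u -> 0 <= bessel_series mu u.
Proof.
move=> mu1 u0; apply: limr_ge; first exact: is_cvg_bessel_series.
apply: nearW => n; rewrite /pseries /series/=; apply: sumr_ge0 => k _.
by rewrite mulr_ge0 ?exprn_ge0//; exact/ltW/bessel_series_coeff_gt0.
Qed.

Lemma bessel_series_homo mu u v : -1 < mu -> 0 <= u -> u <= v ->
  bessel_series mu u <= bessel_series mu v.
Proof.
move=> mu1 u0 uv; have v0 := le_trans u0 uv.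
apply: ler_lim; [exact: is_cvg_bessel_series|exact: is_cvg_bessel_series|].
apply: nearW => n; rewrite /pseries /series/=; apply: ler_sum => k _.
rewrite ler_wpM2l ?lerXn2r ?nnegrE//; exact/ltW/bessel_series_coeff_gt0.
Qed.

End bessel_series.

(** * Two-sided kernel bounds *)

Section kernel.
Context {R : realType}.
Variable nu : R.
Hypothesis nu1 : nu < 1.
Implicit Types (t x y a : R).

Let mu1 : -1 < - nu. Proof. by rewrite ltrN2. Qed.

(** The factor (x y)^nu of the classical kernel cancels against the leading power of I_(-nu),
    leaving t^(nu-1) and the exotic factor (x y)^(-2 nu) times a series that is regular at 0. *)
Lemma exotic_kernelE : exists2 c, 0 < c & forall t x y, 0 < t -> 0 < x -> 0 < y ->
  exotic_kernel nu t x y = c * (t `^ (nu - 1) * (x * y) `^ (- (2 * nu)) *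
    expR (- (x ^+ 2 + y ^+ 2) / (4 * t)) * bessel_series (- nu) ((x * y / (4 * t)) ^+ 2)).
Proof.
have G0 : 0 < Gamma (- nu + 1) by apply: Gamma_gt0; move: mu1; lra.
exists (2^-1 * 4 `^ nu / Gamma (- nu + 1)).
  by rewrite divr_gt0// mulr_gt0 ?invr_gt0 ?powR_gt0.
move=> t x y t0 x0 y0; rewrite /exotic_kernel /bessel_kernel.
have xy0 : 0 < x * y by rewrite mulr_gt0.
have w0 : 0 < x * y / (4 * t) by rewrite divr_gt0// mulr_gt0.
have -> : x * y / (2 * t) = 2 * (x * y / (4 * t)) by field; rewrite gt_eqF.
rewrite besselIE// opprK.
have -> : (x * y / (4 * t)) `^ (- nu) = 4 `^ nu * t `^ nu / (x * y) `^ nu.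
  have t40 : 0 <= 4 * t by rewrite mulr_ge0// ltW.
  have h : (4 * t)^-1 `^ (- nu) = 4 `^ nu * t `^ nu.
    by rewrite -(powR_inv1 t40) -powRrM mulN1r opprK powRM// ltW.
  by rewrite powRM ?(ltW xy0) ?invr_ge0// h powRN mulrC.
rewrite [t `^ (nu - 1)]gt0_powRD// powR_inv1 ?(ltW t0)//.
have n0 : (x * y) `^ nu != 0 by rewrite gt_eqF// powR_gt0.
by field; rewrite n0 !gt_eqF.
Qed.

Lemma exotic_kernel_ge0 t x y : 0 < t -> 0 < x -> 0 < y -> 0 <= exotic_kernel nu t x y.
Proof.
have [c c0 h] := exotic_kernelE => t0 x0 y0; rewrite h// !mulr_ge0 ?powR_ge0 ?expR_ge0 ?(ltW c0)//.
by rewrite bessel_series_ge0 ?sqr_ge0.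
Qed.

(** The size of the kernel at time a^2 times the density y^(2 nu + 1), up to constants. The power of
    1 + x y / (2 a^2) is the algebraic factor of the Bessel bound at order -nu. *)
Definition exotic_profile a x y : R :=
  a `^ (2 * nu - 2) * x `^ (- (2 * nu)) * y * (1 + x * y / (2 * a ^+ 2)) `^ (nu - 2^-1) *
    expR (- (((x - y) / a) ^+ 2 / 4)).


(** Completing the square: the exponential growth of the Bessel series at w = x y / (4 a^2) turns
    exp(-(x^2 + y^2)/(4 a^2)) into a Gaussian in x - y. *)
Let weightE a x y (B : R) : 0 < a -> 0 < x -> 0 < y ->
  (a ^+ 2) `^ (nu - 1) * (x * y) `^ (- (2 * nu)) * expR (- (x ^+ 2 + y ^+ 2) / (4 * a ^+ 2)) * B * y `^ (2 * nu + 1) =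
  a `^ (2 * nu - 2) * x `^ (- (2 * nu)) * y * expR (- (((x - y) / a) ^+ 2 / 4)) * (B / expR (2 * (x * y / (4 * a ^+ 2)))).
Proof.
move=> a0 x0 y0.
have -> : (a ^+ 2) `^ (nu - 1) = a `^ (2 * nu - 2).
  by rewrite -(powR_mulrn 2 (ltW a0)) -powRrM; congr (_ `^ _); ring.
rewrite powRM ?(ltW x0) ?(ltW y0)//.
have e1 : y `^ (- (2 * nu)) * y `^ (2 * nu + 1) = y.
  by rewrite -gt0_powRD// addrA addNr add0r powRr1// ltW.
pose E1 := expR (- (((x - y) / a) ^+ 2 / 4)); pose E2 := expR (2 * (x * y / (4 * a ^+ 2))).
have -> : expR (- (x ^+ 2 + y ^+ 2) / (4 * a ^+ 2)) = E1 / E2.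
  by rewrite /E1 /E2 -expRN -expRD; congr expR; field; rewrite gt_eqF.
rewrite -/E1 -/E2; clearbody E1 E2.
rewrite -[in RHS]e1; ring.
Qed.

Lemma exotic_kernel_le : exists2 C, 0 < C & forall a x y, 0 < a -> 0 < x -> 0 < y ->
  exotic_kernel nu (a ^+ 2) x y * y `^ (2 * nu + 1) <= C * exotic_profile a x y.
Proof.
have [c c0 kE] := exotic_kernelE; have [C C0 hC] := bessel_series_le mu1.
exists (c * C); first by rewrite mulr_gt0.
move=> a x y a0 x0 y0; rewrite kE ?exprn_gt0//.
set w := x * y / (4 * a ^+ 2).
have w0 : 0 < w by rewrite divr_gt0 ?mulr_gt0 ?exprn_gt0.
have := hC w (ltW w0); rewrite (_ : - (- nu + 2^-1) = nu - 2^-1); last by ring.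
rewrite -ler_pdivrMr ?expR_gt0// => h.
rewrite -(mulrA c C) -(mulrA c (_ * _)) ler_wpM2l ?(ltW c0)// weightE// -/w /exotic_profile.
have -> : x * y / (2 * a ^+ 2) = 2 * w by rewrite /w; field; rewrite gt_eqF.
have P0 : 0 <= a `^ (2 * nu - 2) * x `^ (- (2 * nu)) * y * expR (- (((x - y) / a) ^+ 2 / 4)).
  by rewrite !mulr_ge0 ?powR_ge0 ?expR_ge0 ?(ltW y0).
have := ler_wpM2l P0 h; congr (_ <= _); ring.
Qed.

Lemma exotic_kernel_ge : exists2 c, 0 < c & forall a x y, 0 < a -> 0 < x -> 0 < y ->
  c * exotic_profile a x y <= exotic_kernel nu (a ^+ 2) x y * y `^ (2 * nu + 1).
Proof.
have [c c0 kE] := exotic_kernelE; have [C C0 hC] := bessel_series_ge mu1.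
exists (c * C); first by rewrite mulr_gt0.
move=> a x y a0 x0 y0; rewrite kE ?exprn_gt0//.
set w := x * y / (4 * a ^+ 2).
have w0 : 0 < w by rewrite divr_gt0 ?mulr_gt0 ?exprn_gt0.
have := hC w (ltW w0); rewrite (_ : - (- nu + 2^-1) = nu - 2^-1); last by ring.
rewrite -ler_pdivlMr ?expR_gt0// => h.
rewrite -(mulrA c C) -(mulrA c (_ * _)) ler_wpM2l ?(ltW c0)// weightE// -/w /exotic_profile.
have -> : x * y / (2 * a ^+ 2) = 2 * w by rewrite /w; field; rewrite gt_eqF.
have P0 : 0 <= a `^ (2 * nu - 2) * x `^ (- (2 * nu)) * y * expR (- (((x - y) / a) ^+ 2 / 4)).
  by rewrite !mulr_ge0 ?powR_ge0 ?expR_ge0 ?(ltW y0).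
have := ler_wpM2l P0 h; congr (_ <= _); ring.
Qed.

Let gauss_bound (N : R) : 0 <= N ->
  exists2 C, 0 < C & forall q, 0 < q -> q `^ N * (1 + q) * expR (- (q / 16)) <= C.
Proof.
move=> N0; have [C C0 hC] := powR_expRN_bounded N0.
have [D D0 hD] := powR_expRN_bounded (addr_ge0 N0 ler01).
exists (16 `^ N * (C + 16 * D)); first by rewrite mulr_gt0 ?powR_gt0// addr_gt0// mulr_gt0.
move=> q q0; pose v := q / 16; have v0 : 0 < v by rewrite divr_gt0.
have qv : q = 16 * v by rewrite /v; field.
rewrite -/v qv powRM ?(ltW v0)//.
have h1 := hC v v0; have h2 := hD v v0; rewrite gt0_powRD// powRr1 ?(ltW v0)// in h2.
have c0 := powR_ge0 (16 : R) N.
have := ler_wpM2l c0 h1; have := ler_wpM2l c0 h2.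
move: (16 `^ N) (v `^ N) (expR (- v)) => A B E; lra.
Qed.

Let ratio_powE a z s : 0 < a -> 0 < z -> ((z / a) ^+ 2) `^ s = z `^ (2 * s) * a `^ (- (2 * s)).
Proof.
move=> a0 z0; have za0 : 0 < z / a by rewrite divr_gt0.
rewrite -(powR_mulrn 2 (ltW za0)) -powRrM powRM ?(ltW z0) ?invr_ge0 ?(ltW a0)//.
by rewrite -(powR_inv1 (ltW a0)) -powRrM mulN1r.
Qed.

(** The exponent nu - 1/2 is below 1 and the base is at least 1. Crude, but away from the diagonal
    the Gaussian absorbs a linear factor. *)
Let base_le a x y : 0 < a -> 0 < x -> 0 < y ->
  (1 + x * y / (2 * a ^+ 2)) `^ (nu - 2^-1) <= 1 + x * y / (2 * a ^+ 2).
Proof.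
move=> a0 x0 y0; set b := x * y / _.
have b0 : 0 < b by rewrite divr_gt0 ?mulr_gt0 ?exprn_gt0.
by apply: ler1_powR; move: nu1; lra.
Qed.

(** With q = (x/a)^2 the prefactor is x^(-2) y q^(1-nu). As x - y >= x/2, the Gaussian is at most
    exp(-q/16), which absorbs q^(1-nu) (1 + q) because 1 - nu >= 0. *)
Lemma exotic_profile_le_small : exists2 C, 0 < C & forall a x y, 0 < a -> 0 < y -> y <= x / 2 ->
  exotic_profile a x y <= C * (x `^ (- 2) * y).
Proof.
have N0 : 0 <= 1 - nu by rewrite subr_ge0 ltW.
have [C C0 hC] := gauss_bound N0; exists C => // a x y a0 y0 yx.
have x0 : 0 < x by lra.
pose q := (x / a) ^+ 2; have q0 : 0 < q by rewrite exprn_gt0// divr_gt0.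
have ai0 : 0 < a^-1 by rewrite invr_gt0.
have e1 : a `^ (2 * nu - 2) * x `^ (- (2 * nu)) = x `^ (- 2) * q `^ (1 - nu).
  rewrite ratio_powE// mulrA -gt0_powRD// mulrC; congr (_ `^ _ * _ `^ _); ring.
have b1 : (1 + x * y / (2 * a ^+ 2)) `^ (nu - 2^-1) <= 1 + q.
  apply: le_trans (base_le a0 x0 y0) _; rewrite lerD2l /q expr_div_n.
  rewrite invfM mulrA ler_wpM2r ?invr_ge0 ?sqr_ge0//; nra.
have b2 : expR (- (((x - y) / a) ^+ 2 / 4)) <= expR (- (q / 16)).
  rewrite ler_expR lerN2 /q !expr_div_n.
  have ia : 0 <= (a ^+ 2)^-1 by rewrite invr_ge0 sqr_ge0.
  have : x ^+ 2 / 16 <= (x - y) ^+ 2 / 4 by nra.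
  move=> h; have := ler_wpM2r ia h; congr (_ <= _); ring.
rewrite /exotic_profile e1.
apply: (@le_trans _ _ (x `^ (- 2) * q `^ (1 - nu) * y * (1 + q) * expR (- (q / 16)))).
  apply: ler_pM => //; rewrite ?expR_ge0 ?mulr_ge0 ?powR_ge0 ?(ltW y0)//.
  by rewrite ler_wpM2l// !mulr_ge0 ?powR_ge0 ?(ltW y0).
have xy0 : 0 <= x `^ (- 2) * y by rewrite mulr_ge0 ?powR_ge0 ?(ltW y0).
have := ler_wpM2l xy0 (hC q q0); congr (_ <= _); ring.
Qed.

(** With q = (y/a)^2 the prefactor is x^(-2 nu) y^(2 nu - 1) q^(1-nu). The power gives decay for q <
    1 and the Gaussian for q > 1; together they yield min(q, 1/q)^(1-nu). This decay in a/y is kept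
    for the endpoint b = 2 nu. *)
Lemma exotic_profile_le_large : exists2 C, 0 < C & forall a x y, 0 < a -> 0 < x -> 2 * x <= y ->
  exotic_profile a x y <= C * (x `^ (- (2 * nu)) * y `^ (2 * nu - 1) * dker (2 - 2 * nu) a y).
Proof.
have N0 : 0 <= 1 - nu by rewrite subr_ge0 ltW.
have N1 : 0 <= 2 * (1 - nu) by rewrite mulr_ge0// subr_ge0 ltW.
have [C C0 hC] := gauss_bound (lexx 0).
have [D D0 hD] := gauss_bound N1.
exists (C + D); first by rewrite addr_gt0.
move=> a x y a0 x0 xy; have y0 : 0 < y by lra.
pose q := (y / a) ^+ 2; have q0 : 0 < q by rewrite exprn_gt0// divr_gt0.
have e1 : a `^ (2 * nu - 2) * y = y `^ (2 * nu - 1) * q `^ (1 - nu).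
  rewrite ratio_powE// mulrA -gt0_powRD// mulrC -{1}(powRr1 (ltW y0)).
  by congr (_ `^ _ * _ `^ _); ring.
have b1 : (1 + x * y / (2 * a ^+ 2)) `^ (nu - 2^-1) <= 1 + q.
  apply: le_trans (base_le a0 x0 y0) _; rewrite lerD2l /q expr_div_n.
  rewrite invfM mulrA ler_wpM2r ?invr_ge0 ?sqr_ge0//; nra.
have b2 : expR (- (((x - y) / a) ^+ 2 / 4)) <= expR (- (q / 16)).
  rewrite ler_expR lerN2 /q !expr_div_n.
  have ia : 0 <= (a ^+ 2)^-1 by rewrite invr_ge0 sqr_ge0.
  have : y ^+ 2 / 16 <= (x - y) ^+ 2 / 4 by nra.
  move=> h; have := ler_wpM2r ia h; congr (_ <= _); ring.
have b3 : q `^ (1 - nu) * (1 + q) * expR (- (q / 16)) <= (C + D) * dker (2 - 2 * nu) a y.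
  have lq : ln q = 2 * (ln y - ln a).
    by rewrite /q expr2 lnM ?posrE ?divr_gt0// ln_div ?posrE//; ring.
  have dE : dker (2 - 2 * nu) a y = expR (- ((1 - nu) * `|ln q|)).
    rewrite /dker lq normrM (distrC (ln y)) ger0_norm//; congr expR; ring.
  have [q1|q1] := lerP q 1.
    have -> : dker (2 - 2 * nu) a y = q `^ (1 - nu).
      by rewrite dE ler0_norm ?ln_le0// mulrN opprK /powR gt_eqF.
    have := hC q q0; rewrite powRr0 mul1r => h.
    have qp := powR_ge0 q (1 - nu).
    have := ler_wpM2l qp h; have := mulr_ge0 (ltW D0) qp; lra.
  have -> : dker (2 - 2 * nu) a y = q `^ (nu - 1).
    rewrite dE ger0_norm ?ln_ge0 ?(ltW q1)// /powR gt_eqF//; congr expR; ring.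
  have := hD q q0.
  have e : q `^ (1 - nu) = q `^ (nu - 1) * q `^ (2 * (1 - nu)).
    by rewrite -gt0_powRD//; congr (_ `^ _); ring.
  move=> h; rewrite e.
  have qp := powR_ge0 q (nu - 1).
  have := ler_wpM2l qp h; have := mulr_ge0 (ltW C0) qp; lra.
rewrite /exotic_profile.
have -> : a `^ (2 * nu - 2) * x `^ (- (2 * nu)) * y = x `^ (- (2 * nu)) * y `^ (2 * nu - 1) * q `^ (1 - nu).
  by rewrite -[RHS]mulrA -e1; ring.
apply: (@le_trans _ _ (x `^ (- (2 * nu)) * y `^ (2 * nu - 1) * q `^ (1 - nu) * (1 + q) * expR (- (q / 16)))).
  apply: ler_pM => //; rewrite ?expR_ge0 ?mulr_ge0 ?powR_ge0//.
  by rewrite ler_wpM2l// !mulr_ge0 ?powR_ge0.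
have xy0 : 0 <= x `^ (- (2 * nu)) * y `^ (2 * nu - 1) by rewrite mulr_ge0 ?powR_ge0.
have := ler_wpM2l xy0 b3; congr (_ <= _); ring.
Qed.

(** Here x y / a^2 is comparable to q = (x/a)^2, and the profile is of order a^(-1) (1 + 1/q)^(nu -
    1/2) times the Gaussian. As nu - 1/2 < 1/2, that power is at most sqrt(1 + 1/q) <= 1 + a/x,
    whose second term produces 1/x. *)
Lemma exotic_profile_le_middle : exists2 C, 0 < C & forall a x y, 0 < a -> 0 < x ->
  x / 2 <= y <= 2 * x ->
  exotic_profile a x y <= C * (a^-1 * expR (- (((x - y) / a) ^+ 2 / 4)) + x^-1).
Proof.
pose K : R := 4 `^ `|nu - 2^-1|; have K0 : 0 < K by exact: powR_gt0.
exists (2 * K); first by rewrite mulr_gt0.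
move=> a x y a0 x0 /andP[xy yx]; have y0 : 0 < y by lra.
pose q := (x / a) ^+ 2; have q0 : 0 < q by rewrite exprn_gt0// divr_gt0.
set e := expR _.
have e1 : e <= 1 by rewrite /e -expR0 ler_expR oppr_le0 divr_ge0 ?sqr_ge0.
have e0 : 0 <= e by exact: expR_ge0.
have qE : q = x ^+ 2 / a ^+ 2 by rewrite /q expr_div_n.
have ia : 0 <= (a ^+ 2)^-1 by rewrite invr_ge0 sqr_ge0.
have bE : x * y / (2 * a ^+ 2) = (x * y / 2) / a ^+ 2 by rewrite invfM mulrA.
have bq1 : q / 4 <= x * y / (2 * a ^+ 2).
  have h : x ^+ 2 / 4 <= x * y / 2 by nra.
  by have := ler_wpM2r ia h; rewrite bE qE; congr (_ <= _); ring.
have bq2 : x * y / (2 * a ^+ 2) <= q.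
  have h : x * y / 2 <= x ^+ 2 by nra.
  by have := ler_wpM2r ia h; rewrite bE qE.
have b1 : (1 + x * y / (2 * a ^+ 2)) `^ (nu - 2^-1) <= K * (1 + q) `^ (nu - 2^-1).
  by apply: powR_le_comparable; [lra|apply/andP; split; lra].
have p0 : 0 <= a `^ (2 * nu - 2) * x `^ (- (2 * nu)) by rewrite mulr_ge0 ?powR_ge0.
have step : exotic_profile a x y <= 2 * K * (a `^ (2 * nu - 2) * x `^ (- (2 * nu)) * x * (1 + q) `^ (nu - 2^-1) * e).
  rewrite /exotic_profile -/e.
  apply: (@le_trans _ _ (a `^ (2 * nu - 2) * x `^ (- (2 * nu)) * (2 * x) * (K * (1 + q) `^ (nu - 2^-1)) * e)); last first.
    rewrite le_eqVlt; apply/orP; left; apply/eqP; ring.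
  rewrite ler_wpM2r//; apply: ler_pM => //; rewrite ?p0 ?mulr_ge0 ?powR_ge0 ?(ltW y0)//.
  by rewrite ler_wpM2l.
have K2 : 0 <= 2 * K by rewrite mulr_ge0// ltW.
apply: le_trans step _; rewrite (ler_wpM2l K2)//.
have ax : 0 < a / x by rewrite divr_gt0.
have e2 : a `^ (2 * nu - 2) * x `^ (- (2 * nu)) * x = a^-1 * q `^ (2^-1 - nu).
  rewrite ratio_powE// -{2}(powRr1 (ltW x0)) -mulrA -gt0_powRD// -(powR_inv1 (ltW a0)).
  rewrite mulrCA -gt0_powRD// mulrC; congr (_ `^ _ * _ `^ _); by field.
have e3 : q `^ (2^-1 - nu) * (1 + q) `^ (nu - 2^-1) = (1 + q^-1) `^ (nu - 2^-1).
  have -> : 1 + q^-1 = (1 + q) * q^-1 by field; rewrite gt_eqF.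
  have q10 : 0 <= 1 + q by lra.
  rewrite powRM ?invr_ge0 ?(ltW q0)// -(powR_inv1 (ltW q0)) -powRrM mulN1r opprB mulrC//.
have e4 : (1 + q^-1) `^ (nu - 2^-1) <= 1 + a / x.
  have iq0 : 0 < q^-1 by rewrite invr_gt0.
  apply: (@le_trans _ _ ((1 + q^-1) `^ 2^-1)); first by apply: ler_powR; move: nu1; lra.
  rewrite powR12_sqrt; last lra.
  rewrite -[leRHS]ger0_norm; last lra.
  rewrite -sqrtr_sqr ler_wsqrtr// /q expr_div_n invf_div -expr_div_n; nra.
rewrite e2 -(mulrA a^-1) e3.
apply: (@le_trans _ _ (a^-1 * (1 + a / x) * e)).
  by rewrite ler_wpM2r// ler_wpM2l ?invr_ge0 ?(ltW a0).
have -> : a^-1 * (1 + a / x) * e = a^-1 * e + x^-1 * e by field; rewrite !gt_eqF.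
by rewrite lerD2l -[leRHS]mulr1 ler_wpM2l// invr_ge0 ltW.
Qed.

End kernel.

(** * Integration against a power density *)

Section power_measure_integral.
Context {R : realType}.
Variable delta : R.
Notation leb := (@lebesgue_measure R).
Local Open Scope ereal_scope.

Let integral_nnsfun (h : {nnsfun (measurableTypeR R) >-> R}) :
  \int[power_measure delta]_x (h x)%:E = \int[leb]_(x in Rpos) ((x `^ delta)%:E * (h x)%:E).
Proof.
have md : measurable_fun (Rpos : set (measurableTypeR R)) (fun x => (x `^ delta)%:E) by meas.
rewrite integralT_nnsfun sintegralE.
under [RHS]eq_integral => x _.
  rewrite (fimfunE h x) -fsumEFin// muleC ge0_mule_fsuml; last by move=> y; exact: nnfun_muleindic_ge0.
  over.
rewrite ge0_integral_fsum//; last 2 first.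
- by move=> y; apply: emeasurable_funM => //; apply/measurable_EFinP; apply: measurable_funM => //; exact: measurable_indic.
- by move=> y x _; rewrite mule_ge0 ?lee_fin ?powR_ge0//; exact: nnfun_muleindic_ge0.
apply: eq_fsbigr => r /set_mem[z _ hz].
have r0 : (0 <= r)%R by rewrite -hz.
under [RHS]eq_integral do rewrite EFinM -muleA.
rewrite ge0_integralZl//; last 2 first.
- by apply: emeasurable_funM => //; apply/measurable_EFinP; exact: measurable_indic.
- by move=> x _; rewrite mule_ge0 ?lee_fin ?powR_ge0.
congr (_ * _); rewrite /power_measure [LHS]integral_mkcond [RHS]integral_mkcond.
apply: eq_integral => x _; rewrite !patchE in_setI indicE.
by case: (_ \in Rpos) => //=; case: (_ \in _) => /=; rewrite ?mul1e ?mul0e.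
Qed.

(** For indicators this is how [power_measure] is defined; simple functions follow by linearity and
    nonnegative functions by monotone convergence. *)
Lemma ge0_integral_power_measureT (f : measurableTypeR R -> \bar R) :
  measurable_fun setT f -> (forall x, 0 <= f x) ->
  \int[power_measure delta]_x f x = \int[leb]_(x in Rpos) ((x `^ delta)%:E * f x).
Proof.
move=> mf f0; pose g := nnsfun_approx measurableT mf.
have gf x : f x = limn (fun n => (g n x)%:E).
  by apply/esym/cvg_lim => //; exact: cvg_nnsfun_approx.
transitivity (limn (fun n => \int[power_measure delta]_x (g n x)%:E)).
  under eq_integral do rewrite gf.
  apply: monotone_convergence => //.
  - by move=> n; apply/measurable_EFinP.
  - by move=> n x _; rewrite lee_fin.
  - by move=> x _ a b ab; rewrite lee_fin; exact/lefP/nd_nnsfun_approx.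
under eq_fun do rewrite integral_nnsfun.
transitivity (\int[leb]_(x in Rpos) limn (fun n => (x `^ delta)%:E * (g n x)%:E)).
  rewrite monotone_convergence//.
  - move=> n; apply: emeasurable_funM; first by meas.
    by apply: measurable_funTS; apply/measurable_EFinP.
  - by move=> n x _; rewrite mule_ge0 ?lee_fin ?powR_ge0.
  - move=> x _ a b ab; rewrite lee_wpmul2l ?lee_fin ?powR_ge0//.
    exact/lefP/nd_nnsfun_approx.
apply: eq_integral => x _; apply/cvg_lim => //.
by apply: cvgeZl => //; exact: cvg_nnsfun_approx.
Qed.

Lemma ge0_integral_power_measure (f : measurableTypeR R -> \bar R) :
  measurable_fun (Rpos : set (measurableTypeR R)) f -> (forall x, (0 < x)%R -> 0 <= f x) ->
  \int[power_measure delta]_(x in Rpos) f x = \int[leb]_(x in Rpos) ((x `^ delta)%:E * f x).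
Proof.
move=> mf f0; rewrite integral_mkcond ge0_integral_power_measureT.
- by apply: eq_integral => x xR; rewrite patchE xR.
- by apply/(measurable_restrict f) => //; rewrite setTI.
- by move=> x; rewrite patchE; case: ifPn => // /set_mem; rewrite in_Rpos; exact: f0.
Qed.

End power_measure_integral.

(** * Lower bounds for the kernel in three test regimes *)

Section kernel_lower.
Context {R : realType}.
Variable nu : R.
Hypothesis nu1 : nu < 1.
Implicit Types (t x y a : R).
Local Open Scope ring_scope.

Notation K t x y := (exotic_kernel nu t x y * y `^ (2 * nu + 1)).

(** For |x - y| <= 2a the Gaussian is at least exp(-1), and the base of the remaining power lies in
    [1, 1 + M], so only the prefactor matters. *)
Let profile_ge a x y M : 0 < a -> 0 < x -> 0 < y -> 1 <= M ->
  `|x - y| <= 2 * a -> x * y <= M * a ^+ 2 ->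
  (1 + M) `^ (- `|nu - 2^-1|) * expR (- 1) * (a `^ (2 * nu - 2) * x `^ (- (2 * nu)) * y) <= exotic_profile nu a x y.
Proof.
move=> a0 x0 y0 M1 xya xyM; rewrite /exotic_profile.
have b1 : (1 + M) `^ (- `|nu - 2^-1|) <= (1 + x * y / (2 * a ^+ 2)) `^ (nu - 2^-1).
  set b := x * y / _.
  have b0 : 0 < b by rewrite divr_gt0 ?mulr_gt0 ?exprn_gt0.
  have bM : b <= M.
    rewrite /b ler_pdivrMr ?mulr_gt0 ?exprn_gt0//; apply: le_trans xyM _.
    by rewrite ler_wpM2l//; [lra|rewrite ler_peMl ?sqr_ge0// ler1n].
  have bp : 0 < 1 + b by rewrite addr_gt0.
  have Mp : 0 < 1 + M by rewrite addr_gt0//; exact: lt_le_trans M1.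
  rewrite /powR !gt_eqF// ler_expR.
  have l1 : 0 <= ln (1 + b) by rewrite ln_ge0// lerDl ltW.
  have l2 : ln (1 + b) <= ln (1 + M) by rewrite ler_ln ?posrE// lerD2l.
  have nv := ler_norm (- (nu - 2^-1)); rewrite normrN in nv.
  have := ler_wpM2r l1 nv; have := ler_wpM2l (normr_ge0 (nu - 2^-1)) l2; lra.
have b2 : expR (- 1) <= expR (- (((x - y) / a) ^+ 2 / 4)).
  rewrite ler_expR lerN2 expr_div_n.
  have h : (x - y) ^+ 2 <= 4 * a ^+ 2.
    rewrite -real_normK ?num_real// (_ : 4 * a ^+ 2 = (2 * a) ^+ 2); last by ring.
    by rewrite lerXn2r ?nnegrE// mulr_ge0// ltW.
  by rewrite ler_pdivrMr// mul1r ler_pdivrMr ?exprn_gt0.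
have p0 : 0 <= a `^ (2 * nu - 2) * x `^ (- (2 * nu)) * y by rewrite !mulr_ge0 ?powR_ge0 ?(ltW y0).
have := ler_wpM2l p0 (ler_pM (powR_ge0 _ _) (expR_ge0 _) b1 b2).
by congr (_ <= _); ring.
Qed.

(** Fixed time, x near the origin: the singularity x^(-2 nu) detects the lower endpoint and
    unboundedness on L^oo. *)
Lemma exotic_kernel_ge_unit : exists2 c, 0 < c & forall x y, 0 < x <= 1 -> 1 <= y <= 2 ->
  c * x `^ (- (2 * nu)) <= K 1 x y.
Proof.
have [c c0 hc] := exotic_kernel_ge nu1.
exists (c * ((1 + 2) `^ (- `|nu - 2^-1|) * expR (- 1))).
  by rewrite mulr_gt0// mulr_gt0 ?powR_gt0 ?expR_gt0// addr_gt0.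
move=> x y /andP[x0 x1] /andP[y1 y2]; have y0 : 0 < y by lra.
have := hc 1 x y ltr01 x0 y0; rewrite expr1n; apply: le_trans.
rewrite -mulrA ler_wpM2l ?(ltW c0)//.
have M1 : (1 : R) <= 2 by rewrite ler1n.
have h1 : `|x - y| <= 2 * 1 by rewrite ler_norml; apply/andP; split; lra.
have h2 : x * y <= 2 * 1 ^+ 2 by rewrite expr1n; nra.
apply: le_trans (profile_ge ltr01 x0 y0 M1 h1 h2).
rewrite powR1 mul1r ler_wpM2l ?mulr_ge0 ?powR_ge0 ?expR_ge0//.
by rewrite -[leLHS]mulr1 ler_wpM2l ?powR_ge0.
Qed.

(** Time x^2, the scale that carries mass from y up to x: the resulting decay x^(-2) detects the
    upper endpoint. *)
Lemma exotic_kernel_ge_square : exists2 c, 0 < c & forall x y, 0 < x -> 0 < y <= 2 * x ->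
  c * (x `^ (- 2) * y) <= K (x ^+ 2) x y.
Proof.
have [c c0 hc] := exotic_kernel_ge nu1.
exists (c * ((1 + 2) `^ (- `|nu - 2^-1|) * expR (- 1))).
  by rewrite mulr_gt0// mulr_gt0 ?powR_gt0 ?expR_gt0// addr_gt0.
move=> x y x0 /andP[y0 yx].
apply: le_trans (hc x x y x0 x0 y0).
rewrite -mulrA ler_wpM2l ?(ltW c0)//.
have M1 : (1 : R) <= 2 by rewrite ler1n.
have h1 : `|x - y| <= 2 * x by rewrite ler_norml; apply/andP; split; lra.
have h2 : x * y <= 2 * x ^+ 2 by nra.
apply: le_trans (profile_ge x0 x0 y0 M1 h1 h2).
rewrite ler_wpM2l ?mulr_ge0 ?powR_ge0 ?expR_ge0// ler_wpM2r ?(ltW y0)//.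
by rewrite -gt0_powRD// (_ : 2 * nu - 2 - 2 * nu = - 2)//; ring.
Qed.

(** Time (x - 1)^2 for mass just to the right of 1: the kernel is of order 1/(x - 1), whose
    divergent integral excludes strong type for p = 1. *)
Lemma exotic_kernel_ge_diagonal : exists2 c, 0 < c & forall x y, 1 <= y -> y < x -> x <= 2 ->
  c / (x - 1) <= K ((x - 1) ^+ 2) x y.
Proof.
have [c c0 hc] := exotic_kernel_ge nu1.
pose m : R := 4 `^ (- `|nu - 2^-1|) * (4 `^ (- `|2 * nu|)) * expR (- 1).
have m0 : 0 < m by rewrite !mulr_gt0 ?powR_gt0 ?expR_gt0.
exists (c * m); first by rewrite mulr_gt0.
move=> x y y1 yx x2.
have a0 : 0 < x - 1 by lra.
have x0 : 0 < x by lra.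
have y0 : 0 < y by lra.
apply: le_trans (hc _ x y a0 x0 y0).
rewrite -mulrA ler_wpM2l ?(ltW c0)//.
set a := x - 1 in a0 *.
have ge_comp (s z : R) : 0 < z -> z / 4 <= 1 -> 1 <= 4 * z -> 4 `^ (- `|s|) <= z `^ s.
  move=> z0 z1 z2; have h : z / 4 <= 1 <= 4 * z by rewrite z1 z2.
  have := powR_le_comparable s z0 h; rewrite powR1 powRN.
  by rewrite -ler_pdivrMl ?powR_gt0// mulr1.
rewrite /exotic_profile.
(* Absorbing a^2 into the base leaves a single factor 1/a; the new base a^2 + x y / 2 lies in
   [1/2, 3], so its power is harmless. *)
have bE : a ^+ 2 * (1 + x * y / (2 * a ^+ 2)) = a ^+ 2 + x * y / 2.
  by field; rewrite gt_eqF.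
have b0 : 0 < 1 + x * y / (2 * a ^+ 2) by rewrite addr_gt0// divr_gt0 ?mulr_gt0 ?exprn_gt0.
have a1 : a <= 1 by rewrite /a; lra.
have e1 : a `^ (2 * nu - 2) * (1 + x * y / (2 * a ^+ 2)) `^ (nu - 2^-1) = a^-1 * (a ^+ 2 + x * y / 2) `^ (nu - 2^-1).
  rewrite -bE powRM ?sqr_ge0 ?(ltW b0)// [RHS]mulrA; congr (_ * _).
  rewrite -(powR_mulrn 2 (ltW a0)) -powRrM -(powR_inv1 (ltW a0)) -gt0_powRD//.
  by congr (_ `^ _); field.
have -> : a `^ (2 * nu - 2) * x `^ (- (2 * nu)) * y * (1 + x * y / (2 * a ^+ 2)) `^ (nu - 2^-1) *
   expR (- (((x - y) / a) ^+ 2 / 4)) = a^-1 * ((a ^+ 2 + x * y / 2) `^ (nu - 2^-1) * (x `^ (- (2 * nu)) * y) * expR (- (((x - y) / a) ^+ 2 / 4))).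
  transitivity ((a `^ (2 * nu - 2) * (1 + x * y / (2 * a ^+ 2)) `^ (nu - 2^-1)) * (x `^ (- (2 * nu)) * y) *
    expR (- (((x - y) / a) ^+ 2 / 4))); first by ring.
  by rewrite e1; ring.
rewrite mulrC ler_wpM2l ?invr_ge0 ?(ltW a0)// /m.
have xy1 : 1 <= x * y by rewrite -[leLHS]mulr1; apply: ler_pM => //; lra.
have xy4 : x * y <= 4 by nra.
have a20 : 0 <= a ^+ 2 by exact: sqr_ge0.
have a21 : a ^+ 2 <= 1 by rewrite exprn_ile1// ltW.
apply: ler_pM; rewrite ?mulr_ge0 ?powR_ge0 ?expR_ge0//.
- apply: ler_pM; rewrite ?powR_ge0//; first by apply: ge_comp; lra.
  apply: (@le_trans _ _ (x `^ (- (2 * nu)))); last by rewrite -[leLHS]mulr1 ler_wpM2l ?powR_ge0.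
  by rewrite -normrN; apply: ge_comp; lra.
- rewrite ler_expR lerN2 expr_div_n ler_pdivrMr// mul1r ler_pdivrMr ?exprn_gt0//.
  have h1 : 0 <= x - y by lra.
  have h2 : x - y <= a by rewrite /a; lra.
  nra.
Qed.

End kernel_lower.

(** * Pointwise bound of the semigroup, uniform in time *)

Section pointwise_bound.
Context {R : realType}.
Variable nu : R.
Hypothesis nu1 : nu < 1.
Implicit Types (t x y a p e b delta lam : R) (f : R -> R).
Notation leb := (@lebesgue_measure R).

Definition exotic_integral a f x : \bar R :=
  (\int[leb]_(y in Rpos) (exotic_kernel nu (a ^+ 2) x y * y `^ (2 * nu + 1) * f y)%:E)%E.

(** Model kernels for small y, large y, and the two terms of the comparable range. The cut-offs of
    [k1] and [k2] sit at y = x, beyond the regions they must cover; this only enlarges an upper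
    bound. *)
Let k1 x y : R := if y <= x then x `^ (- 2) * y else 0.
Let k2 a x y : R := if x <= y then x `^ (- (2 * nu)) * y `^ (2 * nu - 1) * dker (2 - 2 * nu) a y else 0.
Let k3 a x y : R := if (x / 2 <= y) && (y <= 2 * x) then a^-1 * expR (- (((x - y) / a) ^+ 2 / 4)) else 0.
Let k4 x y : R := if (x / 2 <= y) && (y <= 2 * x) then x^-1 else 0.

Let k_ge0 a x y : 0 < a -> 0 < x -> 0 < y -> [/\ 0 <= k1 x y, 0 <= k2 a x y, 0 <= k3 a x y & 0 <= k4 x y].
Proof.
move=> a0 x0 y0; split; rewrite /k1 /k2 /k3 /k4; case: ifP => // _.
- by rewrite mulr_ge0 ?powR_ge0 ?(ltW y0).
- by rewrite !mulr_ge0 ?powR_ge0 ?dker_ge0.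
- by rewrite mulr_ge0 ?invr_ge0 ?expR_ge0 ?(ltW a0).
- by rewrite invr_ge0 ltW.
Qed.

Let kernel_le : exists2 C, 0 < C & forall a x y, 0 < a -> 0 < x -> 0 < y ->
  exotic_kernel nu (a ^+ 2) x y * y `^ (2 * nu + 1) <= C * (k1 x y + k2 a x y + k3 a x y + k4 x y).
Proof.
have [C C0 hC] := exotic_kernel_le nu1.
have [D D0 hD] := exotic_profile_le_small nu1.
have [E E0 hE] := exotic_profile_le_large nu1.
have [F F0 hF] := exotic_profile_le_middle nu1.
exists (C * (D + E + F)); first by rewrite mulr_gt0 ?addr_gt0.
move=> a x y a0 x0 y0; apply: le_trans (hC _ _ _ a0 x0 y0) _.
rewrite -(mulrA C) (ler_wpM2l (ltW C0))//.
have [p1 p2 p3 p4] := k_ge0 a0 x0 y0.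
have le3 (u v w z : R) : 0 <= u -> 0 <= v -> 0 <= w -> z <= D * u \/ z <= E * v \/ z <= F * w ->
    z <= (D + E + F) * (u + v + w) by move=> u0 v0 w0; nra.
have -> : k1 x y + k2 a x y + k3 a x y + k4 x y = k1 x y + k2 a x y + (k3 a x y + k4 x y) by ring.
apply: le3 => //; first by rewrite addr_ge0.
have [h1|h1] := lerP y (x / 2).
  left; rewrite /k1 ifT; first by exact: hD.
  by lra.
have [h2|h2] := lerP (2 * x) y.
  right; left; rewrite /k2 ifT; first by exact: hE.
  by lra.
right; right; rewrite /k3 /k4 (ltW h1) (ltW h2) /=.
by apply: hF => //; rewrite (ltW h1) (ltW h2).
Qed.

(** For y <= x the kernel is x^(-b) y^(b-1) (y/x)^(2-b), and lowering the exponent 2 - b to e only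
    increases it. *)
Let k1_le b e x y : 0 <= e -> e <= 2 - b -> 0 < x -> 0 < y ->
  k1 x y <= x `^ (- b) * (dker e x y / y * y `^ b).
Proof.
move=> e0 eb x0 y0; rewrite /k1; case: ifP => [yx|_]; last first.
  by rewrite !mulr_ge0 ?powR_ge0 ?dker_ge0 ?invr_ge0 ?(ltW y0).
rewrite -(powR_inv1 (ltW y0)) -{1}(powRr1 (ltW y0)) /dker /powR !gt_eqF// -!expRD ler_expR.
have l : ln y <= ln x by rewrite ler_ln ?posrE.
rewrite ger0_norm ?subr_ge0//.
have := ler_wpM2r (_ : 0 <= ln x - ln y) eb; rewrite subr_ge0 => /(_ l); lra.
Qed.

(** For x <= y the kernel without its decay in a is x^(-b) y^(b-1) (x/y)^(b - 2 nu); the exponent b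
    - 2 nu is then lowered to e. *)
Let k2_le b e a x y : 0 <= e -> e <= b - 2 * nu -> 0 < x -> 0 < y ->
  k2 a x y <= x `^ (- b) * (dker e x y / y * y `^ b).
Proof.
move=> e0 eb x0 y0; rewrite /k2; case: ifP => [xy|_]; last first.
  by rewrite !mulr_ge0 ?powR_ge0 ?dker_ge0 ?invr_ge0 ?(ltW y0).
apply: (@le_trans _ _ (x `^ (- (2 * nu)) * y `^ (2 * nu - 1))).
  rewrite -[leRHS]mulr1 ler_wpM2l ?mulr_ge0 ?powR_ge0// dker_le1//.
  by move: nu1; lra.
rewrite -(powR_inv1 (ltW y0)) /dker /powR !gt_eqF// -!expRD ler_expR.
have l : ln x <= ln y by rewrite ler_ln ?posrE.
rewrite ler0_norm ?subr_le0//.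
have := ler_wpM2r (_ : 0 <= ln y - ln x) eb; rewrite subr_ge0 => /(_ l); lra.
Qed.

(** At b = 2 nu no decay in x/y is left, so the decay in a/y is kept instead. Integration in y then
    gives x^(-b) times a Hardy average at a, which no longer involves x. *)
Let k2_endpoint a x y : 0 < x -> 0 < y ->
  k2 a x y <= x `^ (- (2 * nu)) * (dker (2 - 2 * nu) a y / y * y `^ (2 * nu)).
Proof.
move=> x0 y0; rewrite /k2; case: ifP => [xy|_]; last first.
  by rewrite !mulr_ge0 ?powR_ge0 ?dker_ge0 ?invr_ge0 ?(ltW y0).
rewrite [y `^ (2 * nu - 1)]gt0_powRD// powR_inv1 ?(ltW y0)// le_eqVlt.
by apply/orP; left; apply/eqP; ring.
Qed.

Let k4_le b e : 0 <= e -> exists2 C, 0 < C & forall x y, 0 < x -> 0 < y ->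
  k4 x y <= C * (x `^ (- b) * (dker e x y / y * y `^ b)).
Proof.
move=> e0; exists (expR ((`|1 - b| + e) * ln 4)); first exact: expR_gt0.
move=> x y x0 y0; rewrite /k4; case: ifP => [/andP[xy yx]|_]; last first.
  by rewrite !mulr_ge0 ?expR_ge0 ?powR_ge0 ?dker_ge0 ?invr_ge0 ?(ltW y0).
rewrite -(powR_inv1 (ltW y0)) -(powR_inv1 (ltW x0)) /dker /powR !gt_eqF// -!expRD ler_expR.
have l1 : ln x <= ln 4 + ln y by rewrite -lnM ?posrE// ler_ln ?posrE ?mulr_gt0//; lra.
have l2 : ln y <= ln 4 + ln x by rewrite -lnM ?posrE// ler_ln ?posrE ?mulr_gt0//; lra.
have h : `|ln x - ln y| <= ln 4 by rewrite ler_norml; apply/andP; split; lra.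
have h1 := ler_wpM2l e0 h.
have h2 : (1 - b) * (ln y - ln x) <= `|1 - b| * ln 4.
  apply: le_trans (ler_norm _) _; rewrite normrM (distrC (ln y)) ler_wpM2l//.
lra.
Qed.

(** The two disjunctions treat the ends of the admissible range separately: either there is room
    [e], and the piece goes into the Hardy term, or b sits at the end and [L] bounds the functional
    that replaces it. The right side is free of [a], so it also bounds the supremum over time. *)
Lemma exotic_integral_le b e : 0 < e -> exists2 C, 0 < C &
  forall f (L : \bar R), (forall y, 0 <= f y) -> measurable_fun setT f -> (0 <= L)%E ->
  (e <= 2 - b \/ b = 2 /\ (\int[leb]_(y in Rpos) (y * f y)%:E <= L)%E) ->
  (e <= b - 2 * nu \/
    b = 2 * nu /\ forall a, 0 < a -> (hardy (2 - 2 * nu) (fun y => `|y| `^ b * f y)%R a <= L)%E) ->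
  forall a x, 0 < a -> 0 < x ->
  (exotic_integral a f x <= C%:E *
    ((x `^ (- b))%:E * hardy e (fun y => `|y| `^ b * f y)%R x + (x `^ (- b))%:E * L + local_maximal f x))%E.
Proof.
move=> e0.
have [C C0 hC] := kernel_le; have [D D0 hD] := k4_le b (ltW e0).
(* 256 comes from the Gaussian estimate, 2 from [k1] and [k2], and 257 D from [k4], which occurs
   once by itself and 256 times inside the Gaussian estimate. *)
pose Z : R := 256 + 2 + 257 * D.
have Z0 : 0 < Z by rewrite /Z; lra.
exists (C * Z); first exact: mulr_gt0.
move=> f L f0 mf L0 case1 case2 a x a0 x0.
set h := fun y => `|y| `^ b * f y.
have h0 y : 0 <= h y by rewrite mulr_ge0 ?powR_ge0.
have mh : measurable_fun setT h by rewrite /h; meas.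
have xb0 : 0 <= x `^ (- b) by exact: powR_ge0.
have mk1 : measurable_fun setT (k1 x) by rewrite /k1; meas.
have mk2 : measurable_fun setT (k2 a x) by rewrite /k2 /dker; meas.
have mif : measurable_fun setT (fun y : R => (x / 2 <= y) && (y <= 2 * x)) by meas.
have mk3 : measurable_fun setT (k3 a x).
  by rewrite /k3; apply: measurable_fun_ifT => //; meas.
have mk4 : measurable_fun setT (k4 x).
  by rewrite /k4; apply: measurable_fun_ifT => //; meas.
pose I (k : R -> R) : \bar R := (\int[leb]_(y in Rpos) (k y * f y)%:E)%E.
have mkf (k : R -> R) : measurable_fun setT k -> measurable_fun (Rpos : set R) (fun y => (k y * f y)%:E).
  by move=> mk; meas.
have Iadd (u v : R -> R) : measurable_fun setT u -> measurable_fun setT v ->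
    (forall y, 0 < y -> 0 <= u y) -> (forall y, 0 < y -> 0 <= v y) ->
    (I (fun y => u y + v y)%R = I u + I v)%E.
  move=> mu mv u0 v0; rewrite /I -ge0_integralD//.
  - by apply: eq_integral => y _; rewrite -EFinD mulrDl.
  - by move=> y; rewrite in_Rpos => y0; rewrite lee_fin mulr_ge0// u0.
  - exact: mkf.
  - by move=> y; rewrite in_Rpos => y0; rewrite lee_fin mulr_ge0// v0.
  - exact: mkf.
have p1 y : 0 < y -> 0 <= k1 x y by move=> y0; have [] := k_ge0 a0 x0 y0.
have p2 y : 0 < y -> 0 <= k2 a x y by move=> y0; have [] := k_ge0 a0 x0 y0.
have p3 y : 0 < y -> 0 <= k3 a x y by move=> y0; have [] := k_ge0 a0 x0 y0.
have p4 y : 0 < y -> 0 <= k4 x y by move=> y0; have [] := k_ge0 a0 x0 y0.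
have p12 y : 0 < y -> 0 <= k1 x y + k2 a x y by move=> y0; rewrite addr_ge0 ?p1 ?p2.
have p123 y : 0 < y -> 0 <= k1 x y + k2 a x y + k3 a x y by move=> y0; rewrite addr_ge0 ?p12 ?p3.
have m12 : measurable_fun setT (fun y => k1 x y + k2 a x y) by exact: measurable_funD.
have m123 : measurable_fun setT (fun y => k1 x y + k2 a x y + k3 a x y) by exact: measurable_funD.
have m1234 : measurable_fun setT (fun y => k1 x y + k2 a x y + k3 a x y + k4 x y) by exact: measurable_funD.
have step1 : (exotic_integral a f x <= C%:E * (I (k1 x) + I (k2 a x) + I (k3 a x) + I (k4 x)))%E.
  rewrite -(Iadd _ _ mk1 mk2 p1 p2) -(Iadd _ _ m12 mk3 p12 p3) -(Iadd _ _ m123 mk4 p123 p4).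
  rewrite /I -ge0_integralZl//; last 3 first.
  - exact: mkf.
  - by move=> y; rewrite in_Rpos => y0; rewrite lee_fin mulr_ge0// addr_ge0 ?p123 ?p4.
  - by rewrite lee_fin ltW.
  apply: ge0_integral_mono => y; rewrite in_Rpos => y0.
    by rewrite lee_fin mulr_ge0// mulr_ge0 ?powR_ge0 ?exotic_kernel_ge0 ?exprn_gt0.
  rewrite -EFinM lee_fin mulrA ler_wpM2r//; exact: hC.
set H := hardy e h x; have H0 : (0 <= H)%E by exact: hardy_ge0.
have Ihardy (k : R -> R) c : 0 <= c -> (forall y, 0 < y -> 0 <= k y) ->
    (forall y, 0 < y -> k y <= c * (x `^ (- b) * (dker e x y / y * y `^ b))) ->
    (I k <= c%:E * ((x `^ (- b))%:E * H))%E.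
  move=> c0 kp kle; rewrite muleA -EFinM /H /hardy -ge0_integralZl//; last 3 first.
  - by rewrite /dker; meas.
  - by move=> y; rewrite in_Rpos => y0; rewrite lee_fin; apply: mulr_ge0 (h0 y); apply: divr_ge0 (ltW y0); exact: dker_ge0.
  - by rewrite lee_fin mulr_ge0.
  apply: ge0_integral_mono => y; rewrite in_Rpos => y0.
    by rewrite lee_fin mulr_ge0//; exact: kp.
  rewrite -EFinM lee_fin; apply: le_trans (ler_wpM2r (f0 y) (kle y y0)) _.
  by rewrite /h gtr0_norm// le_eqVlt; apply/orP; left; apply/eqP; ring.
have I1 : (I (k1 x) <= (x `^ (- b))%:E * H + (x `^ (- b))%:E * L)%E.
  case: case1 => [eb|[b2 hL]].
    apply: (@le_trans _ _ (1%:E * ((x `^ (- b))%:E * H))%E).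
      apply: Ihardy => // y y0.
      by rewrite mul1r; apply: k1_le => //; exact: ltW.
    by rewrite mul1e leeDl// mule_ge0.
  apply: (@le_trans _ _ ((x `^ (- b))%:E * L)%E); last by rewrite leeDr// mule_ge0.
  apply: le_trans (lee_wpmul2l _ hL); last by rewrite lee_fin.
  rewrite -ge0_integralZl ?lee_fin//; last 2 first.
  - by meas.
  - by move=> y; rewrite in_Rpos => y0; rewrite lee_fin mulr_ge0 ?(ltW y0).
  apply: ge0_integral_mono => y; rewrite in_Rpos => y0.
    by rewrite lee_fin mulr_ge0 ?p1 ?p2.
  rewrite -EFinM lee_fin mulrA ler_wpM2r// /k1 b2; case: ifP => // _.
  by rewrite mulr_ge0 ?powR_ge0 ?(ltW y0).
have I2 : (I (k2 a x) <= (x `^ (- b))%:E * H + (x `^ (- b))%:E * L)%E.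
  case: case2 => [eb|[b2 hL]].
    apply: (@le_trans _ _ (1%:E * ((x `^ (- b))%:E * H))%E).
      apply: Ihardy => // y y0.
      by rewrite mul1r; apply: k2_le => //; exact: ltW.
    by rewrite mul1e leeDl// mule_ge0.
  apply: (@le_trans _ _ ((x `^ (- b))%:E * L)%E); last by rewrite leeDr// mule_ge0.
  apply: le_trans (lee_wpmul2l _ (hL a a0)); last by rewrite lee_fin.
  rewrite /hardy -ge0_integralZl ?lee_fin//; last 2 first.
  - by rewrite /dker; meas.
  - by move=> y; rewrite in_Rpos => y0; rewrite lee_fin; apply: mulr_ge0 (h0 y); apply: divr_ge0 (ltW y0); exact: dker_ge0.
  apply: ge0_integral_mono => y; rewrite in_Rpos => y0.
    by rewrite lee_fin mulr_ge0 ?p1 ?p2.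
  rewrite -EFinM lee_fin; apply: le_trans (ler_wpM2r (f0 y) (k2_endpoint a x0 y0)) _.
  by rewrite gtr0_norm// b2 le_eqVlt; apply/orP; left; apply/eqP; ring.
have I4 : (I (k4 x) <= D%:E * ((x `^ (- b))%:E * H))%E.
  by apply: Ihardy => // [|y y0]; [exact: ltW|exact: hD].
have JR : `[x / 2, 2 * x] `<=` (Rpos : set R).
  by move=> y; rewrite in_Rpos/= in_itv/= => /andP[h1 _]; apply: lt_le_trans h1; rewrite divr_gt0.
have I3 : (I (k3 a x) <= 256%:E * (local_maximal f x + I (k4 x)))%E.
  have -> : I (k3 a x) = (\int[leb]_(y in `[(x / 2)%R, (2 * x)%R]) (a^-1 * expR (- (((x - y) / a) ^+ 2 / 4)) * f y)%:E)%E.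
    rewrite /I -(@integral_if _ _ _ leb Rpos `[x / 2, 2 * x] (fun y => (x / 2 <= y) && (y <= 2 * x)))//.
    by apply: eq_integral => y _; rewrite /k3; case: ifP => //; rewrite mul0r.
  have -> : I (k4 x) = (x^-1%:E * \int[leb]_(y in `[(x / 2)%R, (2 * x)%R]) (f y)%:E)%E.
    rewrite -ge0_integralZl ?lee_fin ?invr_ge0 ?(ltW x0)//; last 2 first.
    - by meas.
    - by move=> y _; rewrite lee_fin.
    under [RHS]eq_integral do rewrite -EFinM.
    rewrite /I -(@integral_if _ _ _ leb Rpos `[x / 2, 2 * x] (fun y => (x / 2 <= y) && (y <= 2 * x)))//.
    by apply: eq_integral => y _; rewrite /k4; case: ifP => //; rewrite mul0r.
  exact: gaussian_local_le.
apply: le_trans step1 _; rewrite [in leRHS]EFinM -muleA lee_wpmul2l ?lee_fin ?(ltW C0)//.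
set M := local_maximal f x; have M0 : (0 <= M)%E by exact: local_maximal_ge0.
set XH := ((x `^ (- b))%:E * H)%E; set XL := ((x `^ (- b))%:E * L)%E.
have XH0 : (0 <= XH)%E by rewrite mule_ge0.
have XL0 : (0 <= XL)%E by rewrite mule_ge0.
have I40 : (0 <= I (k4 x))%E.
  apply: integral_ge0 => y; rewrite in_Rpos => y0; by rewrite lee_fin mulr_ge0 ?p4.
apply: (@le_trans _ _ ((XH + XL) + (XH + XL) + 256%:E * (M + D%:E * XH) + D%:E * XH)%E).
  apply: leeD => //; apply: leeD; first exact: leeD.
  apply: le_trans I3 _; apply: lee_wpmul2l; first by rewrite lee_fin ler0n.
  exact: leeD2l.
(* If the right side is finite then so are its three nonnegative summands, and a linear inequality
   between reals remains. *)
have [->|Sf] := eqVneq (XH + XL + M)%E +oo%E.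
  by rewrite gt0_muley ?lte_fin// leey.
have leS (z : \bar R) : (z <= XH + XL + M)%E -> z != +oo%E.
  by apply: contra_leN => /eqP ->; rewrite lt_neqAle Sf leey.
have XHf : XH != +oo%E by apply: leS; rewrite -addeA leeDl// adde_ge0.
have XLf : XL != +oo%E by apply: leS; rewrite addeAC leeDr// adde_ge0.
have Mf : M != +oo%E by apply: leS; rewrite leeDr// adde_ge0.
have fin (z : \bar R) : (0 <= z)%E -> z != +oo%E -> z = (fine z)%:E.
  by move=> z0 zy; rewrite fineK// ge0_fin_numE// lt_neqAle zy leey.
rewrite (fin _ XH0 XHf) (fin _ XL0 XLf) (fin _ M0 Mf).
move: (fine_ge0 XH0) (fine_ge0 XL0) (fine_ge0 M0).
move: (fine XH) (fine XL) (fine M) => u v w u0 v0 w0.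
rewrite -[leLHS]/((u + v + (u + v) + 256 * (w + D * u) + D * u)%:E) -[leRHS]/((Z * (u + v + w))%:E) lee_fin /Z.
have Du := mulr_ge0 (ltW D0) u0; have Dv := mulr_ge0 (ltW D0) v0; have Dw := mulr_ge0 (ltW D0) w0.
lra.
Qed.

End pointwise_bound.

(** * The exotic maximal operator *)

Section operator.
Context {R : realType}.
Variable nu : R.
Hypothesis nu1 : nu < 1.
Implicit Types (t x y a u v : R) (f : measurableTypeR R -> R).
Notation leb := (@lebesgue_measure R).

Let mu1 : -1 < - nu. Proof. by rewrite ltrN2. Qed.

Lemma continuous_exotic_kernel t x y : 0 < t -> 0 < x -> 0 < y ->
  {for x, continuous (fun x => exotic_kernel nu t x y)}.
Proof.
move=> t0 x0 y0; have [c c0 kE] := exotic_kernelE nu1.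
pose g z := c * (t `^ (nu - 1) * (z * y) `^ (- (2 * nu)) *
    expR (- (z ^+ 2 + y ^+ 2) / (4 * t)) * bessel_series (- nu) ((z * y / (4 * t)) ^+ 2)).
have near_eq : \forall z \near x, g z = exotic_kernel nu t z y.
  by near=> z; rewrite kE//; near: z; exact: lt_nbhsr.
suff cg : {for x, continuous g}.
  change (exotic_kernel nu t z y @[z --> x] --> exotic_kernel nu t x y).
  rewrite [X in _ --> X]kE//; apply: cvg_trans cg; exact: near_eq_cvg.
have cid : {for x, continuous (fun z : R => z)} by exact: cvg_id.
have cc (d : R) : {for x, continuous (fun=> d)} by exact: cvg_cst.
have csq (h : R -> R) : {for x, continuous h} -> {for x, continuous (fun z : R => h z ^+ 2)}.
  move=> ch; apply: (@continuous_comp _ _ _ h (fun w : R => w ^+ 2)) => //; exact: exprn_continuous.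
have czy : {for x, continuous (fun z : R => z * y)} by exact: continuousM.
apply: continuousM => //; apply: continuousM; first apply: continuousM; first apply: continuousM => //.
- apply: (@continuous_comp _ _ _ (fun z : R => z * y) (fun w : R => w `^ (- (2 * nu)))) => //.
  apply/differentiable_continuous/derivable1_diffP.
  by apply: derivable_powR; rewrite in_itv/= andbT mulr_gt0.
- apply: (@continuous_comp _ _ _ (fun z : R => - (z ^+ 2 + y ^+ 2) / (4 * t)) expR); last exact: continuous_expR.
  apply: (continuousM _ (cc _)).
  apply: (@continuous_comp _ _ _ (fun z : R => z ^+ 2 + y ^+ 2) -%R); last exact: opp_continuous.
  by apply: continuousD => //; exact: csq.
- apply: (@continuous_comp _ _ _ (fun z : R => (z * y / (4 * t)) ^+ 2) (bessel_series (- nu))).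
    by apply: csq; apply: continuousM.
  by apply: continuous_bessel_series => //; exact: sqr_ge0.
Unshelve. all: by end_near. Qed.

Lemma exotic_kernelC t x y : exotic_kernel nu t x y = exotic_kernel nu t y x.
Proof. by rewrite /exotic_kernel /bessel_kernel (mulrC x y) (addrC (x ^+ 2)). Qed.

Lemma measurable_exotic_kernel t x : 0 < t -> 0 < x ->
  measurable_fun (Rpos : set R) (exotic_kernel nu t x).
Proof.
move=> t0 x0; apply: open_continuous_measurable_fun; first exact: interval_open.
move=> y /set_mem; rewrite in_Rpos => y0.
have e : (fun z => exotic_kernel nu t z x) = exotic_kernel nu t x.
  by apply/funext => z; exact: exotic_kernelC.
by rewrite -e; exact: continuous_exotic_kernel.
Qed.

(** The Bessel series increases with x, and the other factors change by amounts independent of y.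
    Independence of y makes the kernel at [v] a dominating function for all x in [u, v]. *)
Lemma exotic_kernel_mono t u x v y : 0 < t -> 0 < u -> u <= x <= v -> 0 < y ->
  exotic_kernel nu t x y <= (v / u) `^ `|2 * nu| * expR (v ^+ 2 / (4 * t)) * exotic_kernel nu t v y.
Proof.
move=> t0 u0 /andP[ux xv] y0; have [c c0 kE] := exotic_kernelE nu1.
have x0 : 0 < x by exact: lt_le_trans ux.
have v0 : 0 < v by exact: lt_le_trans xv.
have t40 : 0 < 4 * t by rewrite mulr_gt0.
rewrite !kE//.
have h1 : (x * y) `^ (- (2 * nu)) <= (v / u) `^ `|2 * nu| * (v * y) `^ (- (2 * nu)).
  rewrite (powRM _ (ltW x0) (ltW y0)) (powRM _ (ltW v0) (ltW y0)) mulrA ler_wpM2r ?powR_ge0//.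
  have vu0 : 0 < v / u by rewrite divr_gt0.
  rewrite /powR !gt_eqF// -expRD ler_expR -lerBlDr -mulrBr.
  apply: le_trans (ler_norm _) _; rewrite normrM normrN ler_wpM2l// distrC ger0_norm.
    by rewrite ln_div ?posrE// lerB ?ler_ln ?posrE.
  by rewrite subr_ge0 ler_ln ?posrE.
have h2 : expR (- (x ^+ 2 + y ^+ 2) / (4 * t)) <=
    expR (v ^+ 2 / (4 * t)) * expR (- (v ^+ 2 + y ^+ 2) / (4 * t)).
  rewrite -expRD ler_expR -mulrDl ler_wpM2r ?invr_ge0 ?(ltW t40)//.
  by have := sqr_ge0 x; lra.
have xy0 : 0 <= x * y / (4 * t) by rewrite divr_ge0 ?mulr_ge0 ?(ltW x0) ?(ltW y0) ?(ltW t0).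
have h3 : bessel_series (- nu) ((x * y / (4 * t)) ^+ 2) <= bessel_series (- nu) ((v * y / (4 * t)) ^+ 2).
  apply: bessel_series_homo => //; first exact: sqr_ge0.
  rewrite lerXn2r ?nnegrE//; first by rewrite divr_ge0 ?mulr_ge0 ?(ltW v0) ?(ltW y0) ?(ltW t0).
  by rewrite ler_wpM2r ?invr_ge0 ?(ltW t40)// ler_wpM2r ?(ltW y0).
have B0 : 0 <= bessel_series (- nu) ((x * y / (4 * t)) ^+ 2) by rewrite bessel_series_ge0 ?sqr_ge0.
have tp := powR_ge0 t (nu - 1).
have h12 := ler_pM (powR_ge0 _ _) (expR_ge0 _) h1 h2.
have h123 := ler_pM (mulr_ge0 (powR_ge0 _ _) (expR_ge0 _)) B0 h12 h3.
have := ler_wpM2l (mulr_ge0 (ltW c0) tp) h123; congr (_ <= _); ring.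
Qed.

Lemma exotic_integralE t f x : 0 < t -> 0 < x -> measurable_fun setT f ->
  (\int[power_measure (2 * nu + 1)]_(y in Rpos) `|(exotic_kernel nu t x y * f y)%:E| =
   exotic_integral nu (Num.sqrt t) (fun y => `|f y|%R) x)%E.
Proof.
move=> t0 x0 mf.
have mK := measurable_exotic_kernel t0 x0.
rewrite ge0_integral_power_measure//; last first.
  apply: measurableT_comp => //; apply/measurable_EFinP; apply: measurable_funM => //.
  exact: measurable_funTS.
rewrite /exotic_integral sqr_sqrtr ?(ltW t0)//.
apply: eq_integral => y /set_mem; rewrite in_Rpos => y0.
rewrite abse_EFin -EFinM normrM ger0_norm ?exotic_kernel_ge0//; congr EFin; ring.
Qed.

Lemma exotic_semigroup_le t f x : 0 < t -> 0 < x -> measurable_fun setT f ->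
  (`|exotic_semigroup nu t f x|%:E <= exotic_integral nu (Num.sqrt t) (fun y => `|f y|%R) x)%E.
Proof.
move=> t0 x0 mf; rewrite -exotic_integralE//.
have mKf : measurable_fun (Rpos : set (measurableTypeR R)) (fun y => (exotic_kernel nu t x y * f y)%:E).
  apply/measurable_EFinP; apply: measurable_funM; last exact: measurable_funTS.
  exact: measurable_exotic_kernel.
rewrite /exotic_semigroup /Rintegral.
set J := (\int[_]_(y in _) _)%E.
(* For an infinite [J] the real-valued integral defaults to 0, so the bound holds in that case
   too. *)
have [Jf|Jinf] := boolP (J \is a fin_num).
  by rewrite -abse_EFin fineK//; apply: le_abse_integral.
by rewrite (_ : fine J = 0) ?normr0 ?integral_ge0//; case: J Jinf.
Qed.

Lemma exotic_semigroup_ge0E t f x : 0 < t -> 0 < x -> measurable_fun setT f -> (forall y, 0 <= f y) ->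
  exotic_domain nu f ->
  (`|exotic_semigroup nu t f x|%:E = exotic_integral nu (Num.sqrt t) f x)%E.
Proof.
move=> t0 x0 mf f0 Df.
have -> : exotic_integral nu (Num.sqrt t) f x = exotic_integral nu (Num.sqrt t) (fun y => `|f y|%R) x.
  by rewrite /exotic_integral; apply: eq_integral => y _; rewrite ger0_norm.
rewrite -exotic_integralE// /exotic_semigroup /Rintegral.
have iK := Df t x t0 x0.
rewrite -abse_EFin fineK; last exact: integrable_fin_num.
rewrite gee0_abs; last first.
  apply: integral_ge0 => y; rewrite in_Rpos => y0.
  by rewrite lee_fin mulr_ge0// exotic_kernel_ge0.
apply: eq_integral => y /set_mem; rewrite in_Rpos => y0.
by rewrite gee0_abs// lee_fin mulr_ge0// exotic_kernel_ge0.
Qed.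

(** Convergence at one point v >= x suffices, since the kernel at x is at most a constant times the
    kernel at v. The freedom in v avoids the points where the available pointwise bound is
    infinite. *)
Lemma exotic_domainP f : measurable_fun setT f ->
  (forall t x, 0 < t -> 0 < x ->
    exists2 v, x <= v & (exotic_integral nu (Num.sqrt t) (fun y => `|f y|%R) v < +oo)%E) ->
  exotic_domain nu f.
Proof.
move=> mf fin t x t0 x0; have [v xv vfin] := fin t x t0 x0.
have v0 : 0 < v by exact: lt_le_trans xv.
apply/integrableP; split.
  apply/measurable_EFinP; apply: measurable_funM; last exact: measurable_funTS.
  exact: measurable_exotic_kernel.
apply: (@le_lt_trans _ _ (exotic_integral nu (Num.sqrt t) (fun y => `|f y|%R) x)).
  by rewrite -(exotic_integralE t0 x0 mf).
pose c := (v / x) `^ `|2 * nu| * expR (v ^+ 2 / (4 * t)).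
have c0 : 0 <= c by rewrite mulr_ge0 ?powR_ge0 ?expR_ge0.
have mI : measurable_fun (Rpos : set R) (fun y => (exotic_kernel nu (Num.sqrt t ^+ 2) v y * y `^ (2 * nu + 1) * `|f y|)%:E).
  rewrite sqr_sqrtr ?(ltW t0)//; apply/measurable_EFinP; apply: measurable_funM; last by meas.
  by apply: measurable_funM; [exact: measurable_exotic_kernel|meas].
have Kp z y : 0 < z -> 0 < y -> 0 <= exotic_kernel nu (Num.sqrt t ^+ 2) z y * y `^ (2 * nu + 1).
  move=> z0 y0; apply: mulr_ge0 (powR_ge0 _ _); apply: exotic_kernel_ge0 => //.
  by rewrite exprn_gt0// sqrtr_gt0.
have pI y : Rpos y -> (0 <= (exotic_kernel nu (Num.sqrt t ^+ 2) v y * y `^ (2 * nu + 1) * `|f y|)%:E)%E.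
  by rewrite in_Rpos => y0; rewrite lee_fin mulr_ge0// Kp.
apply: (@le_lt_trans _ _ (c%:E * exotic_integral nu (Num.sqrt t) (fun y => `|f y|%R) v)%E); last first.
  have [I0|I0] := eqVneq c 0; first by rewrite I0 mul0e ltry.
  by rewrite lte_mul_pinfty// lee_fin.
rewrite /exotic_integral -ge0_integralZl//.
have xx : x <= x <= v by rewrite lexx.
apply: ge0_integral_mono => y; rewrite in_Rpos => y0.
  by rewrite lee_fin mulr_ge0// Kp.
have h := @exotic_kernel_mono t x x v y t0 x0 xx y0.
rewrite -EFinM lee_fin sqr_sqrtr ?(ltW t0)// mulrA; apply: ler_wpM2r => //.
by rewrite mulrA; apply: ler_wpM2r => //; exact: powR_ge0.
Qed.

(** Dominated convergence on ]x/2, 2x[, with the kernel at 2x as dominating function. *)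
Lemma continuous_exotic_semigroup t f x : 0 < t -> 0 < x -> exotic_domain nu f ->
  {for x, continuous (exotic_semigroup nu t f)}.
Proof.
move=> t0 x0 Df.
pose u := x / 2; pose v := 2 * x.
have u0 : 0 < u by rewrite divr_gt0.
have v0 : 0 < v by rewrite mulr_gt0.
pose c := (v / u) `^ `|2 * nu| * expR (v ^+ 2 / (4 * t)).
have c0 : 0 <= c by rewrite mulr_ge0 ?powR_ge0 ?expR_ge0.
have mR : measurable (Rpos : set (measurableTypeR R)) by exact: measurable_itv.
have uv (z : R) : `]u, v[%classic z -> u <= z <= v /\ 0 < z.
  by rewrite /= in_itv/= => /andP[uz zv]; rewrite (ltW uz) (ltW zv); split => //; exact: lt_trans uz.
have := @continuity_under_integral R _ _ (power_measure (2 * nu + 1))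
  (fun z y => exotic_kernel nu t z y * f y) Rpos mR u v.
move=> /(_ _ _ (fun y => c * (exotic_kernel nu t v y * `|f y|)) _ _ x).
apply.
- by move=> z /uv[_ z0]; exact: Df.
- apply: aeW => y; rewrite in_Rpos => y0 z /set_mem/uv[_ z0].
  have ck : {for z, continuous (fun w : R => exotic_kernel nu t w y * f y)}; last exact: ck.
  have cc : {for z, continuous (fun=> f y : R)} by exact: cvg_cst.
  by apply: continuousM cc; exact: continuous_exotic_kernel.
- have iK := integrable_abse (Df t v t0 v0).
  have := integrableZl mR c iK.
  apply: eq_integrable; first exact: mR.
  move=> y /set_mem; rewrite in_Rpos => y0.
  by rewrite /= -EFinM normrM ger0_norm ?exotic_kernel_ge0.
- move=> z /uv[uzv z0]; apply: aeW => y; rewrite in_Rpos => y0.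
  rewrite normrM ger0_norm ?exotic_kernel_ge0// mulrA ler_wpM2r//.
  exact: exotic_kernel_mono.
- by apply/mem_set; rewrite /= in_itv/= /u /v; apply/andP; split; lra.
Qed.

Lemma exotic_maximal_ge0 f x : (0 <= exotic_maximal nu f x)%E.
Proof.
rewrite /exotic_maximal; case: ifP => // _.
apply: (@le_trans _ _ `|exotic_semigroup nu 1 f x|%:E); first by rewrite lee_fin.
by apply: ereal_sup_ubound; exists 1 => //=; rewrite in_itv/= ltr01.
Qed.

(** On the half-line the operator is a supremum of continuous functions of x, hence lower
    semicontinuous, and the extension by 0 keeps this because the values are nonnegative. *)
Lemma measurable_exotic_maximal f : exotic_domain nu f -> measurable_fun setT (exotic_maximal nu f).
Proof.
move=> Df; apply: lower_semicontinuous_measurable; apply/lower_semicontinuousP => b.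
have [b0|b0] := ltP b 0.
  rewrite (_ : [set x | _] = setT); first exact: openT.
  by apply/seteqP; split => // x _ /=; apply: lt_le_trans (exotic_maximal_ge0 f x); rewrite lte_fin.
rewrite openE => x /=; rewrite {1}/exotic_maximal; case: ifPn => [x0|_]; last by rewrite lte_fin ltNge b0.
move=> /ereal_sup_gt[_ [t t0 <-]]; rewrite lte_fin => bt.
move: t0; rewrite in_Rpos => t0.
have cs := continuous_exotic_semigroup t0 x0 Df.
have cn : `|exotic_semigroup nu t f z| @[z --> x] --> `|exotic_semigroup nu t f x|.
  by apply: cvg_norm; exact: cs.
have n1 : \forall z \near x, b < `|exotic_semigroup nu t f z| by exact: cvgr_gt cn _ bt.
have n2 : \forall z \near x, 0 < z by exact: lt_nbhsr.
apply: filterS2 n1 n2 => z bz z0 /=; rewrite /exotic_maximal z0.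
apply: (@lt_le_trans _ _ `|exotic_semigroup nu t f z|%:E); first by rewrite lte_fin.
by apply: ereal_sup_ubound; exists t => //; rewrite in_Rpos.
Qed.

Lemma exotic_maximal_le f x (B : \bar R) : measurable_fun setT f -> 0 < x ->
  (forall a, 0 < a -> (exotic_integral nu a (fun y => `|f y|%R) x <= B)%E) ->
  (exotic_maximal nu f x <= B)%E.
Proof.
move=> mf x0 h; rewrite /exotic_maximal x0; apply: ge_ereal_sup => _ [t t0 <-]; move: t0; rewrite in_Rpos => t0.
by apply: le_trans (exotic_semigroup_le t0 x0 mf) _; apply: h; rewrite sqrtr_gt0.
Qed.

Lemma exotic_maximal_ge f x a : measurable_fun setT f -> (forall y, 0 <= f y) ->
  exotic_domain nu f -> 0 < x -> 0 < a ->
  (exotic_integral nu a f x <= exotic_maximal nu f x)%E.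
Proof.
move=> mf f0 Df x0 a0; rewrite /exotic_maximal x0.
have a20 : 0 < a ^+ 2 by rewrite exprn_gt0.
have ea : Num.sqrt (a ^+ 2) = a by rewrite sqrtr_sqr gtr0_norm.
have -> : exotic_integral nu a f x = (`|exotic_semigroup nu (a ^+ 2) f x|%R)%:E.
  rewrite -{1}ea.
  apply/esym.
  exact: (exotic_semigroup_ge0E a20 x0 mf f0 Df).
by apply: ereal_sup_ubound; exists (a ^+ 2) => //; rewrite in_Rpos.
Qed.

End operator.

Section power_bounds.
Context d (X : measurableType d) (R : realType).
Implicit Types (p lam : R).
Local Open Scope ereal_scope.

(** Chebyshev's inequality, for functions with extended real values. *)
Lemma powR_measure_gt_le (mu : {measure set X -> \bar R}) (G : X -> \bar R) p lam :
  (0 < p)%R -> (0 < lam)%R -> measurable_fun setT G ->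
  (lam `^ p)%:E * mu [set x | lam%:E < `|G x|] <= \int[mu]_x (`|G x| `^ p).
Proof.
move=> p0 lam0 mG.
have mA : measurable [set x | lam%:E < `|G x|].
  rewrite -[X in measurable X]setTI; apply: emeasurable_fun_o_infty => //.
  exact: measurableT_comp.
apply: (@le_trans _ _ (\int[mu]_(x in [set x | lam%:E < `|G x|]) (`|G x| `^ p))); last first.
  by apply: ge0_integral_subset => // x _; exact: poweR_ge0.
rewrite -(integral_cst mu mA) //; apply: ge0_integral_mono => x /= lx; first by rewrite lee_fin powR_ge0.
rewrite -poweR_EFin; apply: gt0_ler_poweR; rewrite ?(ltW p0) ?(ltW lx)//.
  by rewrite in_itv/= leey andbT lee_fin ltW.
by rewrite in_itv/= leey andbT.
Qed.

Lemma poweRD_le (x y : \bar R) p : (0 <= p)%R -> 0 <= x -> 0 <= y ->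
  (x + y) `^ p <= (2 `^ p)%:E * (x `^ p + y `^ p).
Proof.
move=> p0; wlog xy : x y / x <= y => [h|] x0 y0.
  have [xy|/ltW yx] := leP x y; first exact: h.
  by rewrite addeC [in leRHS]addeC; apply: h.
apply: (@le_trans _ _ ((2%:E * y) `^ p)).
  have i0 (z : \bar R) : 0 <= z -> z \in `[0%E, +oo%E] by rewrite in_itv/= leey andbT.
  apply: gt0_ler_poweR => //; [apply: i0; exact: adde_ge0|by apply: i0; exact: mule_ge0|].
  by rewrite mule_natl mule2n leeD2r.
by rewrite poweRM// poweR_EFin lee_wpmul2l ?lee_fin ?powR_ge0// leeDr// poweR_ge0.
Qed.

End power_bounds.

(** * Weighted inequalities for the Hardy operator and the local maximal function *)

Section weighted.
Context {R : realType}.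
Implicit Types (b p e x y : R) (f : R -> R).
Notation leb := (@lebesgue_measure R).

Let weight b p f y : 0 < y -> 0 < p -> 0 <= f y ->
  (`|y| `^ b * f y) `^ p / y = y `^ (b * p - 1) * f y `^ p.
Proof.
move=> y0 p0 fy0; rewrite gtr0_norm// powRM ?powR_ge0// -powRrM gt0_powRD// powRN powRr1 ?(ltW y0)//.
ring.
Qed.

Section fixed.
Variables (b p e : R) (f : R -> R).
Hypotheses (p1 : 1 <= p) (e0 : 0 < e) (f0 : forall y, 0 <= f y) (mf : measurable_fun setT f).

Let p0 : 0 < p. Proof. exact: lt_le_trans p1. Qed.
Let h y := `|y| `^ b * f y.
Let h0 y : 0 <= h y. Proof. by rewrite mulr_ge0 ?powR_ge0. Qed.
Let mh : measurable_fun setT h. Proof. by rewrite /h; meas. Qed.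
Let N := (\int[leb]_(y in Rpos) (y `^ (b * p - 1) * f y `^ p)%:E)%E.

Let mass : (\int[leb]_(y in Rpos) ((h y `^ p) / y)%:E = N)%E.
Proof. by apply: eq_integral => y /set_mem; rewrite in_Rpos => y0; rewrite weight. Qed.

(** The weights collapse: x^(b p - 1) times (x^(-b))^p is 1/x, which leaves the Hardy operator on
    L^p(dx/x). *)
Lemma integral_weighted_hardy_powR :
  (\int[leb]_(x in Rpos) ((x `^ (b * p - 1))%:E *
      ((x `^ (- b))%:E * hardy e (fun y => `|y| `^ b * f y)%R x) `^ p) <=
   ((1 + 4 / e) `^ p * (4 / e))%:E * N)%E.
Proof.
have mhp : measurable_fun setT (fun y => h y `^ p) by rewrite /h; meas.
have hp0 y : 0 <= h y `^ p by exact: powR_ge0.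
have H0 x : (0 <= hardy e h x)%E by exact: hardy_ge0.
have Hp0 x : (0 <= hardy e (fun y => h y `^ p)%R x)%E by exact: hardy_ge0.
have e40 : 0 <= (1 + 4 / e) `^ p by exact: powR_ge0.
have -> : (((1 + 4 / e) `^ p * (4 / e))%:E * N = ((1 + 4 / e) `^ p)%:E * ((4 / e)%:E * N))%E.
  by rewrite EFinM muleA.
rewrite -mass; apply: le_trans (lee_wpmul2l _ (integral_hardy e0 hp0 mhp)); last by rewrite lee_fin.
rewrite -ge0_integralZl//; first last.
- by move=> x; rewrite in_Rpos => x0; rewrite mule_ge0// lee_fin invr_ge0 ltW.
- apply: emeasurable_funM; first by meas.
  by apply: measurable_funTS; exact: measurable_hardy.
apply: ge0_integral_mono => x; rewrite in_Rpos => x0.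
  by rewrite mule_ge0 ?poweR_ge0// lee_fin powR_ge0.
rewrite poweRM ?lee_fin ?powR_ge0// poweR_EFin muleA -EFinM.
have -> : x `^ (b * p - 1) * (x `^ (- b)) `^ p = x^-1.
  rewrite -powRrM -(gt0_powRD _ _ x0) (_ : _ + _ = -1) ?powR_inv1 ?(ltW x0)//; ring.
rewrite muleCA; apply: lee_wpmul2l; first by rewrite lee_fin invr_ge0 ltW.
exact: hardy_powR.
Qed.

(** Jensen as before, then [dker <= 1] instead of an integration in [s]. It serves both for
    pointwise finiteness and, at b = 2 nu, as the bound by the norm of f. *)
Lemma weighted_hardy_le_norm s : 0 < s ->
  (hardy e (fun y => `|y| `^ b * f y)%R s <= (1 + 4 / e)%:E * N `^ p^-1)%E.
Proof.
move=> s0; have hp0 y : 0 <= h y `^ p by exact: powR_ge0.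
have e40 : 0 <= 1 + 4 / e by rewrite addr_ge0 ?divr_ge0 ?(ltW e0).
have N0 : (0 <= N)%E.
  by apply: integral_ge0 => y; rewrite in_Rpos => y0; rewrite lee_fin mulr_ge0 ?powR_ge0.
have : (hardy e h s `^ p <= ((1 + 4 / e) `^ p)%:E * N)%E.
  apply: le_trans (hardy_powR e0 s0 p1 h0 mh) _; apply: lee_wpmul2l; first by rewrite lee_fin powR_ge0.
  by rewrite -mass; apply: hardy_le_mass => //; exact: ltW.
have Hs0 : (0 <= hardy e h s)%E by exact: hardy_ge0.
have i0 (z : \bar R) : (0 <= z)%E -> z \in `[0%E, +oo%E] by rewrite in_itv/= leey andbT.
move=> /(gt0_ler_poweR _ (i0 _ (poweR_ge0 _ _)) (i0 _ _)) => /(_ p^-1).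
rewrite invr_ge0 (ltW p0) mule_ge0 ?lee_fin ?powR_ge0// => /(_ isT isT).
rewrite -poweRrM divff ?gt_eqF// poweRe1// poweRM ?lee_fin ?powR_ge0//.
by rewrite poweR_EFin -powRrM divff ?gt_eqF// powRr1.
Qed.

End fixed.

(** The weak (1,1) estimate for p = 1, and Chebyshev applied to the strong estimate for p > 1. *)
Lemma power_measure_local_maximal_gt_powR delta p : 1 <= p -> exists2 C, 0 < C &
  forall f lam, 0 < lam -> (forall y, 0 <= f y) -> measurable_fun setT f ->
  ((lam `^ p)%:E * power_measure delta [set x : R | (lam%:E < local_maximal f x)%E] <=
   C%:E * \int[leb]_(y in Rpos) (y `^ delta * f y `^ p)%:E)%E.
Proof.
rewrite le_eqVlt => /predU1P[<-|p1].
  have [C C0 hC] := power_measure_local_maximal_gt delta; exists C => // f lam lam0 f0 mf.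
  rewrite powRr1 ?(ltW lam0)//; under eq_integral do rewrite powRr1//.
  exact: hC.
have [C C0 hC] := integral_local_maximal_powR delta p1; exists C => // f lam lam0 f0 mf.
(* On the nonpositive half-line the local maximal function is [-oo], with absolute value [+oo];
   cutting it off there makes the level sets agree. *)
pose G := (local_maximal f \_ (Rpos : set (measurableTypeR R))).
have mR : measurable (Rpos : set (measurableTypeR R)) by exact: measurable_itv.
have mG : measurable_fun setT G.
  by apply/(measurable_restrictT _ mR); apply: measurable_funTS; exact: measurable_local_maximal.
have Gle x : (0 < x)%R -> (`|G x| = local_maximal f x)%E.
  move=> x0; rewrite /G patchE ifT; last by apply/mem_set; rewrite in_Rpos.
  by rewrite gee0_abs// local_maximal_ge0.
have p0 : 0 < p by exact: lt_trans p1.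
have setE : [set x | (lam%:E < `|G x|)%E] = [set x : R | (lam%:E < local_maximal f x)%E].
  apply/seteqP; split => x /= lx.
    move: (lx); rewrite /G patchE; case: ifPn => [/set_mem|_]; last by rewrite abse0 lte_fin ltNge (ltW lam0).
    by rewrite in_Rpos => x0; rewrite -(Gle x).
  have x0 : 0 < x by exact: local_maximal_gt0 lx.
  by rewrite Gle.
have := powR_measure_gt_le (power_measure delta) p0 lam0 mG.
rewrite ge0_integral_power_measureT; first last.
- by move=> x; exact: poweR_ge0.
- by meas.
rewrite setE => h; apply: le_trans h _; apply: le_trans (hC f f0 mf).
rewrite le_eqVlt; apply/orP; left; apply/eqP.
by apply: eq_integral => x /set_mem; rewrite in_Rpos => x0; rewrite Gle.
Qed.

End weighted.

Section power_measure_itv.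
Context {R : realType}.
Variable delta : R.
Notation leb := (@lebesgue_measure R).

Lemma powR_itv a b x : 0 < a -> a <= x <= b -> Num.min (a `^ delta) (b `^ delta) <= x `^ delta.
Proof.
move=> a0 /andP[ax xb]; have x0 := lt_le_trans a0 ax; have b0 := lt_le_trans x0 xb.
rewrite ge_min; have [d0|d0] := leP 0 delta.
  by rewrite ge0_ler_powR// ?nnegrE ?(ltW a0) ?(ltW x0).
apply/orP; right; rewrite /powR !gt_eqF// ler_expR.
by rewrite ler_nM2l// ler_ln ?posrE.
Qed.

Lemma power_measure_itv_ge (a b : R) : 0 < a -> a < b ->
  (((b - a) * Num.min (a `^ delta) (b `^ delta))%:E <= power_measure delta `]a, b[)%E.
Proof.
move=> a0 ab; set m := Num.min _ _.
have m0 : 0 <= m by rewrite le_min !powR_ge0.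
have -> : ((b - a) * m)%:E = (\int[leb]_(x in `]a, b[%classic) (cst m%:E) x)%E.
  rewrite integral_cst; last exact: measurable_itv.
  by rewrite /= lebesgue_measure_itv/= lte_fin ab -EFinD -EFinM mulrC.
rewrite /power_measure/= (_ : _ `&` _ = `]a, b[%classic); last first.
  apply/seteqP; split => x /=; first by case.
  by rewrite !in_itv/= andbT => /andP[ax xb]; rewrite ax xb (lt_trans a0).
apply: ge0_integral_mono => x /=; rewrite ?lee_fin// in_itv/= => /andP[ax xb].
by apply: powR_itv => //; rewrite (ltW ax) (ltW xb).
Qed.

End power_measure_itv.

(** * Sufficiency *)

Section sufficiency.
Context {R : realType}.
Variable nu : R.
Hypothesis nu1 : nu < 1.
Implicit Types (t x y a u v : R) (f : measurableTypeR R -> R).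
Notation leb := (@lebesgue_measure R).
Notation norm_powR b p f := (\int[leb]_(y in Rpos) (y `^ (b * p - 1) * `|f y|%R `^ p)%:E)%E.

(** Each conjunct offers an interior case with room [e] and an endpoint case. [L] occurs only in the
    endpoint cases, so the value 0 serves whenever b is interior. *)
Definition endpoint_bound b e f (L : \bar R) :=
  (e <= 2 - b \/ b = 2 /\ (\int[leb]_(y in Rpos) (y * `|f y|%R)%:E <= L)%E) /\
  (e <= b - 2 * nu \/
    b = 2 * nu /\ forall a, 0 < a -> (hardy (2 - 2 * nu) (fun y => `|y| `^ b * `|f y|)%R a <= L)%E).

(** The pointwise bound is finite wherever the local maximal function is. If it were infinite on all
    of ]x, x + 1[, every level set would contain this interval of positive measure, against the weak
    type estimate at a high level. *)
Lemma exotic_domain_maximal_finite b p e f (L : R) : 1 <= p -> 0 < e ->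
  measurable_fun setT f -> 0 <= L -> endpoint_bound b e f L%:E -> (norm_powR b p f < +oo)%E ->
  exotic_domain nu f.
Proof.
move=> p1 e0 mf L0 [hb1 hb2] Nf.
have p0 : 0 < p by exact: lt_le_trans p1.
have [C C0 hC] := exotic_integral_le nu1 b e0.
have f0 y : 0 <= `|f y| by [].
have mnf : measurable_fun setT (fun y => `|f y|) by meas.
set N := norm_powR b p f in Nf *.
have N0 : (0 <= N)%E.
  by apply: integral_ge0 => y; rewrite in_Rpos => y0; rewrite lee_fin mulr_ge0 ?powR_ge0.
apply: exotic_domainP => // t x t0 x0; have a0 : 0 < Num.sqrt t by rewrite sqrtr_gt0.
have [v /andP[xv vx] Mv] : exists2 v, x < v < x + 1 & (local_maximal (fun y => `|f y|)%R v < +oo)%E.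
  apply: contrapT => /forall2NP Mv.
  have Minf v : x < v < x + 1 -> local_maximal (fun y => `|f y|)%R v = +oo%E.
    by move=> xv; case: (Mv v) => // /negP; rewrite -leNgt leye_eq => /eqP.
  have [D D0 hD] := power_measure_local_maximal_gt_powR (b * p - 1) p1.
  have xx1 : x < x + 1 by rewrite ltrDl.
  have := power_measure_itv_ge (b * p - 1) x0 xx1.
  rewrite addrAC subrr add0r mul1r; set m := Num.min _ _ => hm.
  have m0 : 0 < m by rewrite lt_min !powR_gt0 ?addr_gt0.
  pose n := fine N; have nN : N = n%:E by rewrite fineK// ge0_fin_numE.
  have n0 : 0 <= n by rewrite fine_ge0.
  (* Chosen so that lam^p m = D n + 1, just above the bound D n. *)
  pose lam := ((D * n + 1) / m) `^ p^-1.
  have Dm0 : 0 < (D * n + 1) / m by rewrite divr_gt0// ltr_wpDl// mulr_ge0// ltW.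
  have lam0 : 0 < lam by exact: powR_gt0.
  have := hD (fun y => `|f y|) lam lam0 f0 mnf; rewrite -/N nN -EFinM.
  apply/negP; rewrite -ltNge.
  apply: (@lt_le_trans _ _ ((lam `^ p)%:E * m%:E)%E).
    rewrite -EFinM lte_fin /lam -powRrM mulVf ?gt_eqF// powRr1 ?(ltW Dm0)//.
    by rewrite divfK ?gt_eqF// ltrDl.
  rewrite lee_wpmul2l ?lee_fin ?powR_ge0//; apply: le_trans hm _; apply: le_measure.
  - by rewrite inE; exact: measurable_itv.
  - rewrite inE -[X in measurable X]setTI; apply: emeasurable_fun_o_infty => //.
    exact: measurable_local_maximal.
  - by move=> v; rewrite /= in_itv/= => /Minf ->; rewrite ltry.
have v0 : 0 < v by exact: lt_trans xv.
exists v; first exact: ltW.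
have L0' : (0 <= L%:E)%E by rewrite lee_fin.
apply: le_lt_trans (hC _ L%:E f0 mnf L0' hb1 hb2 _ _ a0 v0) _.
have hv : (hardy e (fun y => `|y| `^ b * `|f y|)%R v < +oo)%E.
  apply: le_lt_trans (weighted_hardy_le_norm b p1 e0 f0 mnf v0) _.
  by rewrite lte_mul_pinfty ?lee_fin ?addr_ge0 ?divr_ge0 ?(ltW e0)// poweR_lty.
rewrite lte_mul_pinfty ?lee_fin ?(ltW C0)//.
have vb := powR_ge0 v (- b).
by rewrite !lte_add_pinfty ?lte_mul_pinfty ?lee_fin ?ltry.
Qed.

Lemma exotic_maximal_endpoint_le b e : 0 < e -> exists2 C, 0 < C &
  forall f (L : R), measurable_fun setT f -> 0 <= L -> endpoint_bound b e f L%:E ->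
  forall x, 0 < x -> (exotic_maximal nu f x <=
    C%:E * ((x `^ (- b))%:E * hardy e (fun y => `|y| `^ b * `|f y|)%R x + (x `^ (- b) * L)%:E +
      local_maximal (fun y => `|f y|)%R x))%E.
Proof.
move=> e0; have [C C0 hC] := exotic_integral_le nu1 b e0.
exists C => // f L mf L0 [hb1 hb2] x x0; apply: (exotic_maximal_le nu1 mf x0) => a a0.
have L0' : (0 <= L%:E)%E by rewrite lee_fin.
have mnf : measurable_fun setT (fun y => `|f y|) by meas.
exact: (hC _ L%:E (fun y => normr_ge0 (f y)) mnf L0' hb1 hb2 _ _ a0 x0).
Qed.

(** Where the maximal function exceeds lam, one of the three terms of the pointwise bound exceeds
    lam / (3 C). Chebyshev handles the Hardy term, the tail of x^(-b) the term with L, and the weak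
    estimate the local maximal function. *)
Lemma exotic_maximal_weak b p e : 1 <= p -> 0 < e -> exists2 C, 0 < C &
  forall f (L : R), measurable_fun setT f -> 0 <= L -> b != 0 \/ L = 0 ->
    endpoint_bound b e f L%:E -> (norm_powR b p f < +oo)%E ->
  [/\ exotic_domain nu f, measurable_fun setT (exotic_maximal nu f) &
   forall lam, 0 < lam -> ((lam `^ p)%:E *
      power_measure (b * p - 1) [set x | (lam%:E < `|exotic_maximal nu f x|)%E] <=
      C%:E * (norm_powR b p f + (L `^ p)%:E))%E].
Proof.
move=> p1 e0; have p0 : 0 < p by exact: lt_le_trans p1.
have [C C0 hC] := exotic_maximal_endpoint_le b e0.
have [D D0 hD] := power_measure_local_maximal_gt_powR (b * p - 1) p1.
pose A := (1 + 4 / e) `^ p * (4 / e).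
have A0 : 0 <= A by rewrite mulr_ge0 ?powR_ge0 ?divr_ge0 ?(ltW e0).
pose B := 4 / (`|b| * p).
have B0 : 0 <= B by rewrite divr_ge0 ?mulr_ge0 ?(ltW p0).
have C3 : 0 < 3 * C by rewrite mulr_gt0.
exists ((3 * C) `^ p * (A + B + D)).
  by rewrite mulr_gt0 ?powR_gt0 ?ltr_wpDl ?addr_ge0.
move=> f L mf L0 bL hL Nf.
have Df := exotic_domain_maximal_finite p1 e0 mf L0 hL Nf.
split => //; first exact: measurable_exotic_maximal.
move=> lam lam0; pose l := lam / (3 * C).
have l0 : 0 < l by rewrite divr_gt0.
set N := norm_powR b p f in Nf *.
have N0 : (0 <= N)%E.
  by apply: integral_ge0 => y; rewrite in_Rpos => y0; rewrite lee_fin mulr_ge0 ?powR_ge0.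
have f0 y : 0 <= `|f y| by [].
have mnf : measurable_fun setT (fun y => `|f y|) by meas.
have mh : measurable_fun setT (fun y => `|y| `^ b * `|f y|) by meas.
have h0 y : 0 <= `|y| `^ b * `|f y| by rewrite mulr_ge0 ?powR_ge0.
pose H x := ((x `^ (- b))%:E * hardy e (fun y => `|y| `^ b * `|f y|)%R x)%E.
have mH : measurable_fun setT H.
  by apply: emeasurable_funM; [meas|exact: measurable_hardy].
have H0 x : (0 <= H x)%E by rewrite mule_ge0 ?lee_fin ?powR_ge0 ?hardy_ge0.
pose mu := power_measure (b * p - 1).
pose S1 := [set x | (l%:E < `|H x|)%E].
pose S2 := [set x : R | 0 < x /\ l < x `^ (- b) * L].
pose S3 := [set x : R | (l%:E < local_maximal (fun y => `|f y|)%R x)%E].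
have mS1 : measurable (S1 : set (measurableTypeR R)).
  rewrite -[S1]setTI; apply: emeasurable_fun_o_infty => //; exact: measurableT_comp.
have mS2 : measurable (S2 : set (measurableTypeR R)).
  have -> : S2 = Rpos `&` [set x : R | (l%:E < (x `^ (- b) * L)%:E)%E].
    by apply/seteqP; split => x; rewrite /S2 /= in_itv/= andbT lte_fin.
  apply: emeasurable_fun_o_infty; first exact: measurable_itv.
  by meas.
have mS3 : measurable (S3 : set (measurableTypeR R)).
  rewrite -[S3]setTI; apply: emeasurable_fun_o_infty => //; exact: measurable_local_maximal.
have sub : [set x | (lam%:E < `|exotic_maximal nu f x|)%E] `<=` S1 `|` S2 `|` S3.
  move=> x /=; rewrite gee0_abs ?exotic_maximal_ge0// => lx.
  have x0 : 0 < x.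
    move: lx; rewrite /exotic_maximal; case: ifPn => // _; rewrite lte_fin => /(lt_trans lam0).
    by rewrite ltxx.
  apply: contrapT => /not_orP[/not_orP[n1 n2] n3].
  have n1' : (H x <= l%:E)%E by move/negP: n1; rewrite /S1 /= -leNgt gee0_abs.
  have n2' : x `^ (- b) * L <= l by rewrite leNgt; apply/negP => ?; apply: n2.
  have n3' : (local_maximal (fun y => `|f y|)%R x <= l%:E)%E by rewrite leNgt; exact/negP.
  have := lt_le_trans lx (hC f L mf L0 hL x x0); apply/negP; rewrite -leNgt.
  apply: (@le_trans _ _ (C%:E * (l%:E + l%:E + l%:E))%E).
    by rewrite lee_wpmul2l ?lee_fin ?(ltW C0)// !leeD// lee_fin.
  rewrite -!EFinD -EFinM lee_fin /l.
  by rewrite (_ : C * _ = lam)//; field; rewrite gt_eqF.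
have mT : measurable ([set x | (lam%:E < `|exotic_maximal nu f x|)%E] : set (measurableTypeR R)).
  rewrite -[X in measurable X]setTI; apply: emeasurable_fun_o_infty => //.
  by apply: measurableT_comp => //; exact: measurable_exotic_maximal.
have lE : lam `^ p = (3 * C) `^ p * l `^ p.
  rewrite -powRM ?(ltW l0) ?(ltW C3)//; congr (_ `^ _); rewrite /l mulrC divfK ?gt_eqF//.
rewrite lE EFinM -muleA (EFinM _ (A + B + D)) -[leRHS]muleA.
apply: lee_wpmul2l; first by rewrite lee_fin powR_ge0.
have lp0 : (0 <= (l `^ p)%:E)%E by rewrite lee_fin powR_ge0.
apply: (@le_trans _ _ ((l `^ p)%:E * (mu S1 + mu S2 + mu S3))%E).
  apply: lee_wpmul2l => //; apply: le_trans (_ : mu (S1 `|` S2 `|` S3) <= _)%E.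
    by apply: le_measure => //; rewrite inE//; do 2 apply: measurableU => //.
  have mS12 : measurable (S1 `|` S2 : set (measurableTypeR R)) by exact: measurableU.
  apply: (le_trans (measureU2 mu mS12 mS3)).
  by apply: leeD => //; exact: (measureU2 mu mS1 mS2).
have distr (c u v w : \bar R) : (0 <= u)%E -> (0 <= v)%E -> (0 <= w)%E ->
    (c * (u + v + w) = c * u + c * v + c * w)%E.
  by move=> u0 v0 w0; rewrite !ge0_muleDr ?adde_ge0.
rewrite distr//.
have Lp0 : 0 <= L `^ p by exact: powR_ge0.
have b1 : ((l `^ p)%:E * mu S1 <= A%:E * N)%E.
  apply: le_trans (powR_measure_gt_le mu p0 l0 mH) _.
  rewrite ge0_integral_power_measureT; first last.
  - by move=> x; exact: poweR_ge0.
  - by meas.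
  apply: le_trans (integral_weighted_hardy_powR b p1 e0 f0 mnf).
  rewrite le_eqVlt; apply/orP; left; apply/eqP.
  by apply: eq_integral => x _; rewrite gee0_abs.
have b2 : ((l `^ p)%:E * mu S2 <= (B * L `^ p)%:E)%E.
  case: bL => [bn0|L00]; first exact: power_measure_tail.
  have -> : mu S2 = 0%E.
    rewrite -(measure0 mu); congr (mu _).
    by apply/seteqP; split => // x [_]; rewrite L00 mulr0 ltNge (ltW l0).
  by rewrite mule0 lee_fin mulr_ge0.
have b3 : ((l `^ p)%:E * mu S3 <= D%:E * N)%E by exact: hD.
apply: le_trans (leeD (leeD b1 b2) b3) _.
have [n [n0 ->]] : exists n, 0 <= n /\ N = n%:E.
  by exists (fine N); rewrite fine_ge0// fineK// ge0_fin_numE.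
rewrite -!EFinM -!EFinD lee_fin.
by have := mulr_ge0 A0 Lp0; have := mulr_ge0 B0 n0; have := mulr_ge0 (ltW D0) Lp0; lra.
Qed.

(** Room on both sides allows L = 0, so the term that is only in weak L^p disappears. *)
Lemma exotic_maximal_strong b p e : 1 <= p -> 0 < e -> e <= 2 - b -> e <= b - 2 * nu -> 1 < p ->
  exists2 C, 0 < C & forall f, measurable_fun setT f -> (norm_powR b p f < +oo)%E ->
  [/\ exotic_domain nu f, measurable_fun setT (exotic_maximal nu f) &
   (\int[power_measure (b * p - 1)]_x (`|exotic_maximal nu f x| `^ p) <= C%:E * norm_powR b p f)%E].
Proof.
move=> p1 e0 e1 e2 p1'; have p0 : 0 < p by exact: lt_le_trans p1.
have [C C0 hC] := exotic_maximal_endpoint_le b e0.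
have [D D0 hD] := integral_local_maximal_powR (b * p - 1) p1'.
pose A := (1 + 4 / e) `^ p * (4 / e).
have A0 : 0 <= A by rewrite mulr_ge0 ?powR_ge0 ?divr_ge0 ?(ltW e0).
pose Z := C `^ p * 2 `^ p.
have Z0 : 0 < Z by rewrite mulr_gt0 ?powR_gt0.
exists (Z * (A + D)); first by rewrite mulr_gt0// ltr_wpDl.
move=> f mf Nf; have hL : endpoint_bound b e f 0%:E by split; left.
have Df := exotic_domain_maximal_finite p1 e0 mf (lexx 0) hL Nf.
have mT := measurable_exotic_maximal nu1 Df.
split => //; set N := norm_powR b p f in Nf *.
have N0 : (0 <= N)%E.
  by apply: integral_ge0 => y; rewrite in_Rpos => y0; rewrite lee_fin mulr_ge0 ?powR_ge0.
have f0 y : 0 <= `|f y| by [].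
have mnf : measurable_fun setT (fun y => `|f y|) by meas.
have mh : measurable_fun setT (fun y => `|y| `^ b * `|f y|) by meas.
have h0 y : 0 <= `|y| `^ b * `|f y| by rewrite mulr_ge0 ?powR_ge0.
pose H x := ((x `^ (- b))%:E * hardy e (fun y => `|y| `^ b * `|f y|)%R x)%E.
have mH : measurable_fun setT H.
  by apply: emeasurable_funM; [meas|exact: measurable_hardy].
have H0 x : (0 <= H x)%E by rewrite mule_ge0 ?lee_fin ?powR_ge0 ?hardy_ge0.
pose M x := local_maximal (fun y => `|f y|) x.
have mM : measurable_fun setT M by exact: measurable_local_maximal.
have mul0 x (y : \bar R) : (0 <= y)%E -> (0 <= (x `^ (b * p - 1))%:E * y `^ p)%E.
  by move=> y0; rewrite mule_ge0 ?poweR_ge0// lee_fin powR_ge0.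
rewrite ge0_integral_power_measureT; first last.
- by move=> x; exact: poweR_ge0.
- by meas.
have mG (G : R -> \bar R) : measurable_fun setT G ->
    measurable_fun (Rpos : set R) (fun x => ((x `^ (b * p - 1))%:E * G x `^ p)%E).
  by move=> mG; meas.
apply: (@le_trans _ _ (\int[leb]_(x in Rpos) (Z%:E * ((x `^ (b * p - 1))%:E * H x `^ p +
    (x `^ (b * p - 1))%:E * M x `^ p)))%E).
  apply: ge0_integral_mono => x; rewrite in_Rpos => x0; first exact: mul0.
  have M0 : (0 <= M x)%E by exact: local_maximal_ge0.
  rewrite -ge0_muleDr ?poweR_ge0// [leRHS]muleCA; apply: lee_wpmul2l; first by rewrite lee_fin powR_ge0.
  have := hC f 0 mf (lexx 0) hL x x0; rewrite mulr0 adde0 -/(H x) -/(M x) => hT.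
  have i0 (z : \bar R) : (0 <= z)%E -> z \in `[0%E, +oo%E] by rewrite in_itv/= leey andbT.
  rewrite gee0_abs ?exotic_maximal_ge0//.
  apply: le_trans (gt0_ler_poweR (ltW p0) (i0 _ (exotic_maximal_ge0 _ _ _)) _ hT) _.
    by apply: i0; rewrite mule_ge0 ?adde_ge0// lee_fin ltW.
  rewrite poweRM ?adde_ge0 ?lee_fin ?(ltW C0)// poweR_EFin /Z EFinM -muleA.
  by apply: lee_wpmul2l; [rewrite lee_fin powR_ge0|exact: poweRD_le (ltW p0) _ _].
have mR : measurable (Rpos : set R) by exact: measurable_Rpos.
rewrite ge0_integralZl//; last 3 first.
- by apply: emeasurable_funD; exact: mG.
- by move=> x; rewrite in_Rpos => x0; rewrite adde_ge0 ?mul0// /M local_maximal_ge0.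
- by rewrite lee_fin ltW.
rewrite (EFinM Z) -[leRHS]muleA; apply: lee_wpmul2l; first by rewrite lee_fin ltW.
rewrite ge0_integralD//; last 4 first.
- by move=> x _; exact: mul0.
- exact: mG.
- by move=> x; rewrite in_Rpos => x0; rewrite mul0// /M local_maximal_ge0.
- exact: mG.
rewrite (EFinD A) ge0_muleDl ?lee_fin ?(ltW D0)//; apply: leeD; last exact: hD.
exact: integral_weighted_hardy_powR.
Qed.

(** The pointwise bound with b = 0, which is interior exactly when nu < 0. The Hardy term
    contributes [4 / e] times the bound on f, the local maximal function once the bound. *)
Lemma exotic_maximal_bounded : nu < 0 -> exists2 C, 0 < C & forall f B,
  measurable_fun setT f -> 0 <= B -> {ae leb, forall y, 0 < y -> `|f y| <= B} ->
  [/\ exotic_domain nu f, measurable_fun setT (exotic_maximal nu f) &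
   forall x, (exotic_maximal nu f x <= (C * B)%:E)%E].
Proof.
move=> nu0; pose e := Num.min 2 (- (2 * nu)).
have e0 : 0 < e by rewrite /e lt_min ltr0n/=; lra.
have e1 : e <= 2 - 0 by rewrite subr0 /e ge_min lexx.
have e2 : e <= 0 - 2 * nu by rewrite sub0r /e ge_min lexx orbT.
have [C C0 hC] := exotic_integral_le nu1 0 e0.
have e40 : 0 <= 4 / e by rewrite divr_ge0 ?(ltW e0).
exists (C * (4 / e + 1)); first by rewrite mulr_gt0 ?ltr_wpDl.
move=> f B mf B0 fB.
have f0 y : 0 <= `|f y| by [].
have mnf : measurable_fun setT (fun y => `|f y|) by meas.
have bound a x : 0 < a -> 0 < x ->
    (exotic_integral nu a (fun y => `|f y|)%R x <= (C * (4 / e + 1) * B)%:E)%E.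
  move=> a0 x0.
  apply: le_trans (hC _ 0%E f0 mnf (lexx _) (or_introl e1) (or_introl e2) _ _ a0 x0) _.
  rewrite mule0 adde0 oppr0 powRr0 mul1e -mulrA EFinM.
  apply: lee_wpmul2l; first by rewrite lee_fin ltW.
  rewrite mulrDl mul1r EFinD; apply: leeD; last exact: local_maximal_le_ae.
  apply: (@le_trans _ _ (\int[leb]_(y in Rpos) (B%:E * (dker e x y / y)%:E))%E).
    rewrite /hardy; apply: ae_ge0_le_integral => //.
    - by move=> y; rewrite in_Rpos => y0; rewrite lee_fin mulr_ge0 ?divr_ge0 ?dker_ge0 ?(ltW y0) ?mulr_ge0 ?powR_ge0.
    - by rewrite /dker; meas.
    - by move=> y; rewrite in_Rpos => y0; rewrite -EFinM lee_fin mulr_ge0 ?divr_ge0 ?dker_ge0 ?(ltW y0).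
    - by rewrite /dker; meas.
    - apply: filterS fB; first exact: (ae_filter_ringOfSetsType leb).
      move=> y fy; rewrite in_Rpos => y0.
      rewrite -EFinM lee_fin powRr0 mul1r mulrC ler_wpM2r ?divr_ge0 ?dker_ge0 ?(ltW y0)//.
      exact: fy.
  rewrite ge0_integralZl ?lee_fin//; first last.
  - by move=> y; rewrite in_Rpos => y0; rewrite lee_fin divr_ge0 ?dker_ge0 ?(ltW y0).
  - by rewrite /dker; meas.
  rewrite mulrC EFinM; apply: lee_wpmul2l; first by rewrite lee_fin.
  exact: integral_dker.
have Df : exotic_domain nu f.
  apply: exotic_domainP => // t x t0 x0; exists x => //.
  by apply: le_lt_trans (bound _ _ _ x0) (ltry _); rewrite sqrtr_gt0.
split => //; first exact: measurable_exotic_maximal.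
move=> x; have [x0|x0] := ltP 0 x.
  by apply: exotic_maximal_le => // a a0; exact: bound.
rewrite /exotic_maximal ltNge x0/= lee_fin.
by apply: mulr_ge0 => //; apply: mulr_ge0; [exact: ltW|rewrite addr_ge0].
Qed.

End sufficiency.

(** * Membership in L^p and strong type through integrals of p-th powers *)

Section Lfun_power_measure.
Context {R : realType}.
Variables (delta p : R).
Hypothesis p1 : 1 <= p.
Notation leb := (@lebesgue_measure R).
Implicit Types f : measurableTypeR R -> R.

Lemma integral_power_measure_powR f : measurable_fun setT f ->
  (\int[power_measure delta]_y (`|f y| `^ p)%:E =
   \int[leb]_(y in Rpos) (y `^ delta * `|f y| `^ p)%:E)%E.
Proof.
by move=> mf; rewrite ge0_integral_power_measureT//; meas.
Qed.

Lemma Lnorm_powRE (G : measurableTypeR R -> \bar R) :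
  ('N[power_measure delta]_p%:E[G] = (\int[power_measure delta]_x (`|G x| `^ p)) `^ p^-1)%E.
Proof. by rewrite unlock. Qed.

Lemma Lfun_power_measureP f : f \in Lfun (power_measure delta) p%:E <->
  measurable_fun setT f /\ (\int[power_measure delta]_y (`|f y| `^ p)%:E < +oo)%E.
Proof.
have p0 : 0 < p by exact: lt_le_trans p1.
have NE : ('N[power_measure delta]_p%:E[EFin \o f] =
    (\int[power_measure delta]_y (`|f y|%R `^ p)%:E) `^ p^-1)%E by rewrite Lnorm_powRE.
split=> [/andP[/set_mem mf /set_mem]|[mf fin]].
  rewrite /finite_norm/= NE => fin; split => //.
  by apply: lty_poweRy fin; rewrite invr_eq0 gt_eqF.
apply/andP; split; apply/mem_set => //=.
by rewrite /finite_norm NE; apply: poweR_lty.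
Qed.

Lemma strong_type_poweRP (D : set (measurableTypeR R -> R)) (T : (measurableTypeR R -> R) -> measurableTypeR R -> \bar R) :
  strong_type (power_measure delta) D T p%:E <->
  exists2 C, 0 < C & forall f, measurable_fun setT f ->
    (\int[power_measure delta]_y (`|f y| `^ p)%:E < +oo)%E ->
    [/\ D f, measurable_fun setT (T f) &
      (\int[power_measure delta]_x (`|T f x| `^ p) <=
       C%:E * \int[power_measure delta]_y (`|f y| `^ p)%:E)%E].
Proof.
have p0 : 0 < p by exact: lt_le_trans p1.
have i0 (z : \bar R) : (0 <= z)%E -> z \in `[0%E, +oo%E] by rewrite in_itv/= leey andbT.
have I0 (G : measurableTypeR R -> \bar R) : (0 <= \int[power_measure delta]_x (`|G x| `^ p))%E.
  by apply: integral_ge0 => x _; exact: poweR_ge0.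
have J0 f : (0 <= \int[power_measure delta]_y (`|f y| `^ p)%:E)%E.
  by apply: integral_ge0 => x _; rewrite lee_fin powR_ge0.
have NE f : ('N[power_measure delta]_p%:E[EFin \o f] =
    (\int[power_measure delta]_y (`|f y|%R `^ p)%:E) `^ p^-1)%E by rewrite Lnorm_powRE.
split=> [[C hC]|[C C0 hC]].
  (* The constant in [strong_type] is any real number; a positive one is needed before taking
     powers. *)
  pose C' := Num.max C 1; have C'0 : 0 < C' by rewrite lt_max ltr01 orbT.
  exists (C' `^ p); first exact: powR_gt0.
  move=> f mf ff; have [Df mT hT] : [/\ D f, measurable_fun setT (T f) & _] := hC f ((Lfun_power_measureP f).2 (conj mf ff)).
  split => //.
  have : ('N[power_measure delta]_p%:E[T f] <= C'%:E * 'N[power_measure delta]_p%:E[EFin \o f])%E.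
    by apply: le_trans hT _; rewrite lee_wpmul2r ?Lnorm_ge0// lee_fin le_max lexx.
  move=> /(gt0_ler_poweR (ltW p0) (i0 _ (Lnorm_ge0 _ _ _)) (i0 _ _)).
  rewrite mule_ge0 ?Lnorm_ge0 ?lee_fin ?(ltW C'0)// => /(_ isT).
  rewrite poweRM ?Lnorm_ge0 ?lee_fin ?(ltW C'0)// Lnorm_powRE NE -!poweRrM mulVf ?gt_eqF//.
  by rewrite !poweRe1.
exists (C `^ p^-1) => f /Lfun_power_measureP[mf ff]; have [Df mT hT] := hC f mf ff.
split => //; rewrite Lnorm_powRE NE -poweR_EFin -poweRM ?lee_fin ?(ltW C0)//.
apply: gt0_ler_poweR => //; first by rewrite invr_ge0 ltW.
- exact: i0.
- by apply: i0; rewrite mule_ge0 ?lee_fin ?(ltW C0).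
Qed.

End Lfun_power_measure.

(** * Sufficient conditions for finite p *)

Section sufficient_conditions.
Context {R : realType}.
Variables nu p delta : R.
Hypotheses (nu1 : nu < 1) (nu0 : nu != 0) (p1 : 1 <= p).
Notation leb := (@lebesgue_measure R).
Implicit Types f : measurableTypeR R -> R.
Notation T := (exotic_maximal nu).
Notation D := (exotic_domain nu).

Let p0 : 0 < p. Proof. exact: lt_le_trans p1. Qed.
Let b := (delta + 1) / p.
Let bE : b * p = delta + 1. Proof. by rewrite /b divfK ?gt_eqF. Qed.
Let bpE : b * p - 1 = delta. Proof. by rewrite bE addrK. Qed.
Let ltb c : (c < b) = (c * p - 1 < delta).
Proof. by rewrite /b ltr_pdivlMr// ltrBlDr. Qed.
Let leb_ c : (c <= b) = (c * p - 1 <= delta).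
Proof. by rewrite /b ler_pdivlMr// lerBlDr. Qed.
Let gtb c : (b < c) = (delta < c * p - 1).
Proof. by rewrite /b ltr_pdivrMr// ltrBrDr. Qed.
Let geb c : (b <= c) = (delta <= c * p - 1).
Proof. by rewrite /b ler_pdivrMr// lerBrDr. Qed.

Lemma exotic_maximal_strong_type : 1 < p -> 2 * nu * p - 1 < delta < 2 * p - 1 ->
  strong_type (power_measure delta) D T p%:E.
Proof.
move=> p1'; rewrite -ltb -gtb => /andP[b1 b2]; apply/strong_type_poweRP => //.
pose e := Num.min (2 - b) (b - 2 * nu).
have e0 : 0 < e by rewrite lt_min !subr_gt0 b1 b2.
have e1 : e <= 2 - b by rewrite ge_min lexx.
have e2 : e <= b - 2 * nu by rewrite ge_min lexx orbT.
have [C C0 hC] := exotic_maximal_strong nu1 p1 e0 e1 e2 p1'.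
exists C => // f mf; rewrite integral_power_measure_powR// -{1 2 3}bpE; exact: hC.
Qed.

(** Once L^p is at most K times the p-th power of the norm, the endpoint term is controlled like the
    others. What remains in each case is the choice of [L]. *)
Let weak_of_endpoint e K : 0 < e -> 0 <= K -> exists C, forall f L,
  measurable_fun setT f -> (\int[power_measure delta]_y (`|f y| `^ p)%:E < +oo)%E ->
  0 <= L -> b != 0 \/ L = 0 -> endpoint_bound nu b e f L%:E ->
  ((L `^ p)%:E <= K%:E * \int[power_measure delta]_y (`|f y| `^ p)%:E)%E ->
  [/\ D f, measurable_fun setT (T f) & weak_type_ineq (power_measure delta) T p C f].
Proof.
move=> e0 K0; have [C C0 hC] := exotic_maximal_weak nu1 b p1 e0.
exists (C * (1 + K)) => f L mf; rewrite integral_power_measure_powR// => ff L0 bL hL LK.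
have N0 : (0 <= \int[leb]_(y in Rpos) (y `^ delta * `|f y| `^ p)%:E)%E.
  by apply: integral_ge0 => y; rewrite in_Rpos => y0; rewrite lee_fin mulr_ge0 ?powR_ge0.
have := hC f L mf L0 bL hL; rewrite bpE => /(_ ff)[Df mT hT]; split => // lam lam0.
apply: le_trans (hT lam lam0) _; rewrite integral_power_measure_powR// EFinM -muleA.
apply: lee_wpmul2l; first by rewrite lee_fin ltW.
by rewrite EFinD ge0_muleDl ?lee_fin// mul1e leeD2l.
Qed.

Let interior_weak : 2 * nu < b < 2 -> exists C, forall f,
  measurable_fun setT f -> (\int[power_measure delta]_y (`|f y| `^ p)%:E < +oo)%E ->
  [/\ D f, measurable_fun setT (T f) & weak_type_ineq (power_measure delta) T p C f].
Proof.
move=> /andP[b1 b2]; pose e := Num.min (2 - b) (b - 2 * nu).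
have e0 : 0 < e by rewrite lt_min !subr_gt0 b1 b2.
have [C hC] := weak_of_endpoint e0 (lexx 0).
exists C => f mf ff; apply: (hC f 0) => //; first by right.
  by split; left; rewrite ge_min lexx ?orbT.
by rewrite powR0 ?gt_eqF// mul0e.
Qed.

(** L is a multiple of the L^p norm of f, by the pointwise bound of the Hardy operator with exponent
    2 - 2 nu. The room at the upper end is 2 - b = 2 - 2 nu, and b <> 0 holds because nu <> 0. *)
Let lower_weak : b = 2 * nu -> exists C, forall f,
  measurable_fun setT f -> (\int[power_measure delta]_y (`|f y| `^ p)%:E < +oo)%E ->
  [/\ D f, measurable_fun setT (T f) & weak_type_ineq (power_measure delta) T p C f].
Proof.
move=> bnu; pose e := 2 - 2 * nu; have e0 : 0 < e by rewrite /e; move: nu1; lra.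
pose c := 1 + 4 / e; have c0 : 0 <= c by rewrite addr_ge0 ?divr_ge0 ?(ltW e0).
have [C hC] := weak_of_endpoint e0 (powR_ge0 c p).
exists C => f mf ff; have f0 y : 0 <= `|f y| by [].
have mnf : measurable_fun setT (fun y => `|f y|) by meas.
set N := (\int[power_measure delta]_y _)%E in ff.
have N0 : (0 <= N)%E by apply: integral_ge0 => y _; rewrite lee_fin powR_ge0.
have nN : N = (fine N)%:E by rewrite fineK// ge0_fin_numE.
have n0 : 0 <= fine N by exact: fine_ge0.
apply: (hC f (c * fine N `^ p^-1)) => //.
- by rewrite mulr_ge0 ?powR_ge0.
- by left; rewrite bnu mulf_neq0.
- split; first by left; rewrite bnu.
  right; split => // a a0; apply: le_trans (weighted_hardy_le_norm b p1 e0 f0 mnf a0) _.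
  by rewrite bpE -integral_power_measure_powR// -/N nN poweR_EFin -EFinM.
- by rewrite -/N nN -EFinM lee_fin powRM ?powR_ge0// -powRrM mulVf ?gt_eqF// powRr1.
Qed.

Lemma exotic_maximal_weak_type : 2 * nu * p - 1 <= delta ->
  (if p == 1 then delta <= 2 * p - 1 else delta < 2 * p - 1) ->
  weak_type (power_measure delta) D T p.
Proof.
rewrite -leb_ -gtb -geb => b1 b2.
suff [C hC] : exists C, forall f,
    measurable_fun setT f -> (\int[power_measure delta]_y (`|f y| `^ p)%:E < +oo)%E ->
    [/\ D f, measurable_fun setT (T f) & weak_type_ineq (power_measure delta) T p C f].
  by exists C => f /Lfun_power_measureP[]//; exact: hC.
move: b1; rewrite le_eqVlt => /predU1P[/esym|b1]; first exact: lower_weak.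
have [b2'|b2'] := ltP b 2; first by apply: interior_weak; rewrite b1 b2'.
(* The only case left. Here y^delta = y, so the endpoint functional is the L^1 norm itself and
   serves as [L]. *)
have [pe be] : p = 1 /\ b = 2.
  by move: b2; case: eqP => [->|_] => h; [split => //; apply/le_anti; rewrite h|move: b2'; rewrite leNgt h].
pose e := 2 - 2 * nu; have e0 : 0 < e by rewrite /e; move: nu1; lra.
have [C hC] := weak_of_endpoint e0 ler01.
exists C => f mf ff.
set N := (\int[power_measure delta]_y _)%E in ff.
have N0 : (0 <= N)%E by apply: integral_ge0 => y _; rewrite lee_fin powR_ge0.
have nN : N = (fine N)%:E by rewrite fineK// ge0_fin_numE.
have n0 : 0 <= fine N by exact: fine_ge0.
apply: (hC f (fine N)) => //.
- by left; rewrite be.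
- split; last by left; rewrite be.
  right; split => //; rewrite -nN /N integral_power_measure_powR//.
  rewrite le_eqVlt; apply/orP; left; apply/eqP.
  apply: eq_integral => y /set_mem; rewrite in_Rpos => y0.
  rewrite -bpE be pe mulr1 powRr1// (_ : 2 - 1 = 1) ?powRr1 ?(ltW y0)//; lra.
- by rewrite -/N mul1e nN pe powRr1.
Qed.


(** On the part of E below r the integrand is at most r, which integrates to r^2. Beyond r, y =
    y^(2-2p) y^(2p-1) <= r^(2-2p) y^(2p-1), as 2 - 2p <= 0. *)
Let restricted_upper_bound (E : set (measurableTypeR R)) (r : R) : measurable E -> 0 < r ->
  (\int[leb]_(y in Rpos) (y * `|\1_E y|%R)%:E <=
   (r ^+ 2)%:E + (r `^ (2 - 2 * p))%:E * \int[leb]_(y in Rpos) (y `^ (2 * p - 1) * `|\1_E y|%R `^ p)%:E)%E.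
Proof.
move=> mE r0.
have mind : measurable_fun (setT : set (measurableTypeR R)) (\1_E : _ -> R) by exact: measurable_indic.
have -> : (r ^+ 2)%:E = (\int[leb]_(y in Rpos) (if y <= r then r else 0)%:E)%E.
  rewrite (@integral_if _ _ _ leb _ `]0, r]%classic _ (fun=> r)); last 2 first.
  - by move=> y /=; rewrite !in_itv/= andbT => /andP[].
  - by move=> y; rewrite in_Rpos => y0; rewrite /= in_itv/= y0.
  by rewrite integral_cst//= lebesgue_measure_itv/= lte_fin r0 oppr0 adde0 -EFinM.
have pos1 y : (0 <= (y `^ (2 * p - 1) * `|\1_E y|%R `^ p)%:E)%E by rewrite lee_fin mulr_ge0 ?powR_ge0.
have pos2 (y : R) : (0 <= (if (y <= r)%R then r else 0)%:E)%E by case: ifP => _; rewrite lee_fin ?(ltW r0).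
have rp : (0 <= (r `^ (2 - 2 * p))%:E)%E by rewrite lee_fin powR_ge0.
have m1 : measurable_fun (Rpos : set R) (fun y => (y `^ (2 * p - 1) * `|\1_E y|%R `^ p)%:E) by meas.
have m2 : measurable_fun (Rpos : set R) (fun y : R => (if (y <= r)%R then r else 0)%:E) by meas.
have mR := @measurable_Rpos R.
rewrite -(ge0_integralZl leb mR m1)// -(ge0_integralD leb mR _ m2)//; last 2 first.
- by move=> y _; rewrite mule_ge0.
- by meas.
apply: ge0_integral_mono => y; rewrite in_Rpos => y0.
  by rewrite lee_fin mulr_ge0 ?(ltW y0).
rewrite -EFinM -EFinD lee_fin indicE; case: (y \in E); last first.
  by rewrite normr0 mulr0 powR0 ?gt_eqF// !mulr0 addr0; case: ifP => // _; exact: ltW.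
rewrite normr1 powR1 !mulr1; case: ifPn => [yr|].
  by apply: ler_wpDr yr; rewrite mulr_ge0 ?powR_ge0.
rewrite -ltNge add0r => ry.
rewrite (_ : 2 * p - 1 = 1 - (2 - 2 * p)); last by ring.
rewrite (gt0_powRD 1 _ y0) powRr1 ?(ltW y0)// powRN mulrCA ler_peMr ?(ltW y0)//.
rewrite ler_pdivlMr ?powR_gt0// mul1r.
have d0 : 2 - 2 * p <= 0 by move: p1; lra.
by rewrite /powR !gt_eqF// ler_expR ler_wnM2l// ler_ln ?posrE// ltW.
Qed.

(** The choice r = n^(1/(2p)) makes both terms equal to n^(1/p); for n = 0, r tends to 0. For
    indicators this bounds the functional at b = 2 by the L^p norm, which fails for general f when p
    > 1. *)
Let restricted_upper_norm (E : set (measurableTypeR R)) (n : R) : measurable E -> 0 <= n ->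
  (\int[leb]_(y in Rpos) (y `^ (2 * p - 1) * `|\1_E y|%R `^ p)%:E = n%:E)%E ->
  (\int[leb]_(y in Rpos) (y * `|\1_E y|%R)%:E <= (2 * n `^ p^-1)%:E)%E.
Proof.
move=> mE n0 hn; have h r r0 := @restricted_upper_bound E r mE r0; rewrite hn in h.
have hp2 : 2 * p != 0 by rewrite mulf_neq0// gt_eqF.
move: n0; rewrite le_eqVlt => /predU1P[n0|n0].
  rewrite -n0 powR0 ?mulr0 ?invr_eq0 ?gt_eqF//; apply/lee_addgt0Pr => d d0.
  have := h (Num.sqrt d); rewrite sqrtr_gt0 => /(_ d0).
  by rewrite -n0 mule0 adde0 sqr_sqrtr ?(ltW d0)// add0e.
have := h (n `^ (2 * p)^-1) (powR_gt0 _ n0); congr (_ <= _)%E.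
rewrite -EFinM -EFinD; congr EFin.
have -> : n `^ (2 * p)^-1 ^+ 2 = n `^ p^-1.
  by rewrite -powR_mulrn ?powR_ge0// -powRrM; congr (_ `^ _); field; rewrite gt_eqF.
rewrite -powRrM -{3}(powRr1 (ltW n0)) -gt0_powRD//.
have -> : (2 * p)^-1 * (2 - 2 * p) + 1 = p^-1 by field; rewrite gt_eqF.
by ring.
Qed.

Lemma exotic_maximal_restricted_weak_type : 2 * nu * p - 1 <= delta <= 2 * p - 1 ->
  restricted_weak_type (power_measure delta) D T p.
Proof.
rewrite -leb_ -geb => /andP[b1 b2].
suff [C hC] : exists C, forall E : set (measurableTypeR R), measurable E ->
    (\int[power_measure delta]_y (`|(\1_E y : R)| `^ p)%:E < +oo)%E ->
    [/\ D \1_E, measurable_fun setT (T \1_E) & weak_type_ineq (power_measure delta) T p C \1_E].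
  exists C => E mE fE; apply: hC => //; apply: le_lt_trans fE.
  rewrite le_eqVlt; apply/orP; left; apply/eqP.
  rewrite -[in RHS](setIT E) -integral_indic//; apply: eq_integral => y _; rewrite indicE.
  by case: (y \in E); rewrite ?normr1 ?powR1// normr0 powR0// gt_eqF.
have mI (E : set (measurableTypeR R)) : measurable E ->
    measurable_fun (setT : set (measurableTypeR R)) (\1_E : _ -> R).
  by move=> mE; exact: measurable_indic.
move: b1; rewrite le_eqVlt => /predU1P[/esym/lower_weak[C hC]|b1].
  by exists C => E mE; apply: hC; exact: mI.
move: b2; rewrite le_eqVlt => /predU1P[be|b2]; last first.
  have [|C hC] := interior_weak; first by rewrite b1 b2.
  by exists C => E mE; apply: hC; exact: mI.
have dE : delta = 2 * p - 1 by rewrite -be bpE.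
pose e := 2 - 2 * nu; have e0 : 0 < e by rewrite /e; move: nu1; lra.
have [C hC] := weak_of_endpoint e0 (powR_ge0 2 p).
exists C => E mE ff; have mf := mI E mE.
set N := (\int[power_measure delta]_y _)%E in ff.
have N0 : (0 <= N)%E by apply: integral_ge0 => y _; rewrite lee_fin powR_ge0.
have nN : N = (fine N)%:E by rewrite fineK// ge0_fin_numE.
have n0 : 0 <= fine N by exact: fine_ge0.
apply: (hC _ (2 * fine N `^ p^-1)) => //.
- by rewrite mulr_ge0 ?powR_ge0.
- by left; rewrite be.
- split; last by left; rewrite be.
  right; split => //; apply: restricted_upper_norm => //.
  by rewrite -nN -dE; apply/esym; exact: integral_power_measure_powR.
- by rewrite -/N nN -EFinM lee_fin powRM ?powR_ge0// -powRrM mulVf ?gt_eqF// powRr1.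
Qed.

End sufficient_conditions.

(** * Boundedness on L^oo *)

Section infinity.
Context {R : realType}.
Variable nu : R.
Hypothesis nu1 : nu < 1.
Notation leb := (@lebesgue_measure R).

Lemma power_measure0E (A : set (measurableTypeR R)) : measurable A -> power_measure 0 A = leb (A `&` Rpos).
Proof.
move=> mA; have mAR : measurable (A `&` Rpos : set (measurableTypeR R)).
  by apply: measurableI => //; exact: measurable_itv.
rewrite /power_measure/=; under eq_integral do rewrite powRr0.
by rewrite integral_cst// mul1e.
Qed.

Lemma power_measure0_gt0 : (0 < power_measure 0 (setT : set (measurableTypeR R)))%E.
Proof.
by rewrite power_measure0E// setTI lebesgue_measure_itv/= ltry oppr0 adde0 ltry.
Qed.

(** At exponent 0 a set is null when its trace on the half-line is Lebesgue null, so an essential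
    bound on f becomes an almost everywhere bound for 0 < y. *)
Lemma exotic_maximal_strong_type_infty : nu < 0 ->
  strong_type (power_measure 0) (exotic_domain nu) (exotic_maximal nu) +oo%E.
Proof.
move=> nu0; have [C C0 hC] := exotic_maximal_bounded nu1 nu0.
exists C => f /andP[/set_mem mf /set_mem]; rewrite /finite_norm/=.
set N := Lnorm _ _ (EFin \o f) => Nf.
have N0 : (0 <= N)%E by exact: Lnorm_ge0.
have nN : N = (fine N)%:E by rewrite fineK// ge0_fin_numE.
have ae_f : {ae power_measure 0, forall y, `|f y| <= fine N}.
  have : (ess_sup (power_measure 0) (abse \o (EFin \o f)) <= (fine N)%:E)%E.
    by rewrite -nN /N unlock power_measure0_gt0.
  by move=> /ess_supP; apply: filterS => y; rewrite /= lee_fin.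
have ae_l : {ae leb, forall y, 0 < y -> `|f y| <= fine N}.
  case: ae_f => A [mA A0 hA]; exists (A `&` Rpos); split.
  - by apply: measurableI => //; exact: measurable_itv.
  - by rewrite -power_measure0E.
  - move=> y /= /not_implyP[y0 hy]; split; last by rewrite in_itv/= andbT.
    exact: hA.
have [Df mT hT] := hC f (fine N) mf (fine_ge0 N0) ae_l.
split => //; rewrite -/N nN -EFinM unlock power_measure0_gt0.
by apply/ess_supP; apply: aeW => x; rewrite /= gee0_abs ?exotic_maximal_ge0.
Qed.

End infinity.

(** * Necessity *)

Section integral_inv.
Context {R : realType}.
Implicit Types f F : R -> R.
Notation leb := (@lebesgue_measure R).

Lemma integral_inv (l a b : R) : l < a -> a < b ->
  (\int[leb]_(x in `[a, b]) ((x - l)^-1)%:E = (ln (b - l) - ln (a - l))%:E)%E.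
Proof.
move=> la ab; apply: (@integral_derive_gt _ _ (fun x => ln (x - l)) l) => // x lx.
  have xl : 0 < x - l by rewrite subr_gt0.
  have d2 : is_derive x 1 (fun z : R => z - l) 1 by apply: is_derive_eq; rewrite subr0.
  by have := @is_derive1_comp _ (@ln R) (fun z => z - l) x _ _ (is_derive1_ln xl) d2; rewrite mulr1.
apply: continuousV; first by rewrite subr_eq0 gt_eqF.
by apply: continuousB; [exact: cvg_id|exact: cvg_cst].
Qed.

End integral_inv.

(** * Growth forced by a weak type bound *)

Section lower_growth.
Context {R : realType}.
Variables delta p : R.
Implicit Types F : measurableTypeR R -> \bar R.

(** The level is taken just below the values of c x^(-g) on ]s, 2s[, so the level set contains an
    interval of weighted size s^(delta + 1). Letting s tend to 0 or to infinity then decides the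
    sign of the exponent. *)
Lemma weak_bound_lower (g : R) : exists2 A, 0 < A & forall c s F (N : R), 0 < c -> 0 < s ->
  measurable_fun setT F ->
  (forall x, s < x < 2 * s -> ((c * x `^ (- g))%:E <= F x)%E) ->
  (forall lam, 0 < lam ->
    ((lam `^ p)%:E * power_measure delta [set x | (lam%:E < `|F x|)%E] <= N%:E)%E) ->
  A * c `^ p * s `^ (delta + 1 - g * p) <= N.
Proof.
pose k d : R := Num.min 1 (2 `^ d).
have k0 d : 0 < k d by rewrite lt_min ltr01 powR_gt0.
have kE d s : 0 < s -> Num.min (s `^ d) ((2 * s) `^ d) = k d * s `^ d.
  move=> s0; rewrite powRM ?(ltW s0)// -{1}(mul1r (s `^ d)) /k.
  by rewrite minr_pMl ?powR_ge0.
exists ((k (- g) / 2) `^ p * k delta); first by rewrite mulr_gt0 ?powR_gt0 ?divr_gt0.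
move=> c s F N c0 s0 mF lowF weakF.
(* On ]s, 2s[ the power x^(-g) is at least k(-g) s^(-g), and the half makes the comparison
   strict. *)
pose lam := c * s `^ (- g) * (k (- g) / 2).
have sg : 0 < s `^ (- g) by exact: powR_gt0.
have lam0 : 0 < lam by rewrite !mulr_gt0 ?divr_gt0.
have ss : s < 2 * s by rewrite mulr_natl mulr2n ltrDl.
rewrite -lee_fin; apply: le_trans (weakF lam lam0).
apply: (@le_trans _ _ ((lam `^ p)%:E * (((2 * s - s) * (k delta * s `^ delta)))%:E)%E).
  rewrite -EFinM lee_fin le_eqVlt; apply/orP; left; apply/eqP.
  have -> : lam `^ p = c `^ p * s `^ (- (g * p)) * (k (- g) / 2) `^ p.
    by rewrite /lam !powRM ?mulr_ge0 ?divr_ge0 ?(ltW c0) ?(ltW sg) ?(ltW (k0 _))// -powRrM mulNr.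
  rewrite (gt0_powRD _ _ s0) (gt0_powRD _ _ s0) powRr1 ?(ltW s0)//; ring.
apply: lee_wpmul2l; first by rewrite lee_fin powR_ge0.
rewrite -kE//; apply: le_trans (power_measure_itv_ge delta s0 ss) _.
apply: le_measure.
- by rewrite inE; exact: measurable_itv.
- rewrite inE -[X in measurable X]setTI; apply: emeasurable_fun_o_infty => //.
  exact: measurableT_comp.
- move=> x; rewrite /= in_itv/= => /andP[sx xs].
  have x0 : 0 < x by exact: lt_trans sx.
  have lx : lam < c * x `^ (- g).
    rewrite /lam -mulrA ltr_pM2l//.
    have := powR_itv (- g) s0 (_ : s <= x <= 2 * s); rewrite (ltW sx) (ltW xs) => /(_ isT).
    rewrite kE//; have := mulr_gt0 sg (k0 (- g)); lra.
  have F0 : (lam%:E < F x)%E by apply: lt_le_trans (lowF x _); rewrite ?lte_fin// sx xs.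
  by apply: lt_le_trans F0 _; rewrite lee_abs.
Qed.

End lower_growth.

Section powR_unbounded.
Context {R : realType}.
Implicit Types A N k : R.

Lemma powR_bounded_le0 A N k s0 : 0 < A -> 0 < s0 ->
  (forall s, s0 <= s -> A * s `^ k <= N) -> k <= 0.
Proof.
move=> A0 s00 h; rewrite leNgt; apply/negP => k0.
pose M := Num.max (s0 `^ k) ((N + 1) / A).
have M0 : 0 < M by rewrite lt_max powR_gt0.
have := h (M `^ k^-1); rewrite -powRrM mulVf ?gt_eqF// powRr1 ?(ltW M0)//.
have -> : s0 <= M `^ k^-1.
  rewrite -[leLHS](powRr1 (ltW s00)) -(divff (lt0r_neq0 k0)) powRrM.
  by rewrite ge0_ler_powR ?invr_ge0 ?(ltW k0) ?nnegrE ?powR_ge0 ?(ltW M0)// le_max lexx.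
move=> /(_ isT); apply/negP; rewrite -ltNge.
apply: (@lt_le_trans _ _ (A * ((N + 1) / A))).
  by rewrite mulrC divfK ?gt_eqF// ltrDl.
by rewrite ler_wpM2l ?(ltW A0)// le_max lexx orbT.
Qed.

Lemma powR_bounded_ge0 A N k s0 : 0 < A -> 0 < s0 ->
  (forall s, 0 < s <= s0 -> A * s `^ k <= N) -> 0 <= k.
Proof.
move=> A0 s00 h; rewrite -oppr_le0; apply: (@powR_bounded_le0 A N _ s0^-1) => //.
  by rewrite invr_gt0.
move=> s ss; have sp : 0 < s by apply: lt_le_trans ss; rewrite invr_gt0.
have := h s^-1; rewrite invr_gt0 sp/= -[s0 in X in X -> _]invrK lef_pV2 ?posrE ?invr_gt0//.
move=> /(_ ss); congr (_ * _ <= _).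
by rewrite -(powR_inv1 (ltW sp)) -powRrM mulN1r.
Qed.

End powR_unbounded.

Section integrals_itv.
Context {R : realType}.
Notation leb := (@lebesgue_measure R).

Lemma integral_cst_inv (c l a b : R) : 0 <= c -> l < a -> a < b ->
  (\int[leb]_(x in `[a, b]) (c * (x - l)^-1)%:E = (c * (ln (b - l) - ln (a - l)))%:E)%E.
Proof.
move=> c0 la ab; under eq_integral do rewrite EFinM.
have m1 : measurable_fun (`[a, b]%classic : set R) (fun x : R => ((x - l)^-1)%:E) by meas.
rewrite (ge0_integralZl leb (measurable_itv `[a, b]) m1) ?lee_fin//; last first.
  move=> x; rewrite /= in_itv/= => /andP[ax _].
  by rewrite lee_fin invr_ge0 subr_ge0 ltW// (lt_le_trans la).
by rewrite integral_inv// -EFinM.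
Qed.

Lemma integral_indic_powR (mu : {measure set (measurableTypeR R) -> \bar R})
    (E : set (measurableTypeR R)) p : 0 < p -> measurable E ->
  (\int[mu]_y (`|(\1_E y : R)| `^ p)%:E = mu E)%E.
Proof.
move=> p0 mE; rewrite -[in RHS](setIT E) -integral_indic//; apply: eq_integral => y _; rewrite indicE.
by case: (y \in E); rewrite ?normr1 ?powR1// normr0 powR0// gt_eqF.
Qed.

Lemma powR_itv12 d x : 1 <= x <= 2 -> 4 `^ (- `|d|) <= x `^ d <= (4 : R) `^ `|d|.
Proof.
move=> /andP[x1 x2]; have x0 : 0 < x by lra.
apply/andP; split.
  have := @powR_le_comparable R d 1 x x0; rewrite powR1 => h.
  rewrite powRN -[_^-1]mul1r ler_pdivrMr ?powR_gt0// [leRHS]mulrC; apply: h.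
  by apply/andP; split; lra.
by have := @powR_le_comparable R d x 1 ltr01; rewrite powR1 !mulr1; apply; apply/andP; split; lra.
Qed.

Lemma power_measure_itv12_le d (u v : R) : 1 <= u -> u <= v -> v <= 2 ->
  (power_measure d `[u, v] <= (4 `^ `|d| * (v - u))%:E)%E.
Proof.
move=> u1 uv v2; rewrite -(integral_cst_itv _ uv) /power_measure/=.
rewrite (_ : _ `&` _ = `[u, v]%classic); last first.
  apply/seteqP; split => x /=; first by case.
  by rewrite !in_itv/= andbT => /andP[ux xv]; rewrite ux xv/=; split => //; lra.
apply: ge0_integral_mono => x /=; rewrite ?lee_fin ?powR_ge0// in_itv/= => /andP[ux xv].
by have /powR_itv12 : 1 <= x <= 2 := ltac:(lra); move=> /(_ d)/andP[].
Qed.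

End integrals_itv.

(** * Test functions and necessary conditions *)

Section necessary_conditions.
Context {R : realType}.
Variables nu : R.
Hypotheses (nu1 : nu < 1).
Notation leb := (@lebesgue_measure R).
Implicit Types f : measurableTypeR R -> R.
Notation T := (exotic_maximal nu).
Notation D := (exotic_domain nu).
Notation K a x y := (exotic_kernel nu (a ^+ 2) x y * y `^ (2 * nu + 1)).
Let E12 : set (measurableTypeR R) := `[1, 2]%classic.
Let mE12 : measurable E12. Proof. exact: measurable_itv. Qed.
Let mI12 : measurable_fun (setT : set (measurableTypeR R)) (\1_E12 : _ -> R).
Proof. exact: measurable_indic. Qed.

Lemma exotic_maximal_ge_itv f a x (u v : R) (g : R -> R) : measurable_fun setT f ->
  (forall y, 0 <= f y) -> D f -> 0 < a -> 0 < x -> 0 < u ->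
  (forall y, u <= y <= v -> 0 <= g y <= K a x y * f y) ->
  (\int[leb]_(y in `[u, v]) (g y)%:E <= T f x)%E.
Proof.
move=> mf f0 Df a0 x0 u0 hg.
apply: le_trans (exotic_maximal_ge nu1 mf f0 Df x0 a0).
apply: (@le_trans _ _ (\int[leb]_(y in `[u, v]) (K a x y * f y)%:E)%E).
  by apply: ge0_integral_mono => y; rewrite /= in_itv/= => /hg/andP[]; rewrite !lee_fin.
apply: ge0_integral_subset.
  move=> y; rewrite in_Rpos => y0; rewrite lee_fin mulr_ge0// mulr_ge0 ?powR_ge0//.
  by rewrite exotic_kernel_ge0// exprn_gt0.
by move=> y; rewrite /= !in_itv/= andbT => /andP[uy _]; exact: lt_le_trans uy.
Qed.

Lemma exotic_maximal_indic_ge_unit : exists2 c, 0 < c & D \1_E12 -> forall x, 0 < x <= 1 ->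
  ((c * x `^ (- (2 * nu)))%:E <= T \1_E12 x)%E.
Proof.
have [c c0 hc] := exotic_kernel_ge_unit nu1; exists c => // Df x /andP[x0 x1].
apply: le_trans (@exotic_maximal_ge_itv _ 1 x 1 2 (fun=> c * x `^ (- (2 * nu))) mI12 _ Df _ x0 _ _) => //.
  by rewrite integral_cst_itv ?ler1n// (_ : 2 - 1 = 1) ?mulr1//; lra.
move=> y y12; apply/andP; split; first by rewrite mulr_ge0 ?powR_ge0 ?(ltW c0).
rewrite indicE mem_set; last by rewrite /E12/= in_itv.
by rewrite mulr1 expr1n; apply: hc => //; rewrite x0.
Qed.

Lemma exotic_maximal_indic_ge_square : exists2 c, 0 < c & D \1_E12 -> forall x, 1 <= x ->
  ((c * x `^ (- 2))%:E <= T \1_E12 x)%E.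
Proof.
have [c c0 hc] := exotic_kernel_ge_square nu1; exists c => // Df x x1.
have x0 : 0 < x by exact: lt_le_trans x1.
apply: le_trans (@exotic_maximal_ge_itv _ x x 1 2 (fun=> c * x `^ (- 2)) mI12 _ Df _ x0 _ _) => //.
  by rewrite integral_cst_itv ?ler1n// (_ : 2 - 1 = 1) ?mulr1//; lra.
move=> y /andP[y1 y2]; apply/andP; split; first by rewrite mulr_ge0 ?powR_ge0 ?(ltW c0).
rewrite indicE mem_set; last by rewrite /E12/= in_itv/= y1.
rewrite mulr1; apply: (@le_trans _ _ (c * (x `^ (- 2) * y))).
  by rewrite ler_wpM2l ?(ltW c0)// ler_peMr ?powR_ge0.
by apply: hc => //; apply/andP; split; lra.
Qed.

Let pm12 delta : exists2 m, 0 <= m &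
  (power_measure delta : {measure set (measurableTypeR R) -> \bar R}) E12 = m%:E.
Proof.
have h : (power_measure delta E12 < +oo)%E.
  by apply: le_lt_trans (power_measure_itv12_le delta _ _ _) (ltry _); lra.
by exists (fine (power_measure delta E12)); rewrite ?fine_ge0// fineK// ge0_fin_numE.
Qed.

(** One indicator tests both ends: its maximal function is at least of order x^(-2 nu) near 0 and
    x^(-2) at infinity, and dilated intervals going to 0 and to infinity give the two
    inequalities. *)
Lemma restricted_weak_type_necessary delta p : 0 < p ->
  restricted_weak_type (power_measure delta) D T p -> 2 * nu * p - 1 <= delta <= 2 * p - 1.
Proof.
move=> p0 [C hC]; have [m m0 mE] := pm12 delta.
have [] := hC E12 mE12; first by rewrite mE ltry.
move=> Df mT; rewrite /weak_type_ineq integral_indic_powR// mE -EFinM => weakT.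
apply/andP; split.
  have [c c0 hc] := exotic_maximal_indic_ge_unit.
  have [A A0 hA] := weak_bound_lower delta p (2 * nu).
  rewrite -subr_ge0; have -> : delta - (2 * nu * p - 1) = delta + 1 - 2 * nu * p by ring.
  apply: (@powR_bounded_ge0 _ (A * c `^ p) (C * m) _ 2^-1) => //.
    by rewrite mulr_gt0 ?powR_gt0.
  move=> s /andP[s0 s1]; apply: (hA c s (T \1_E12)) => // x /andP[sx xs].
  by apply: hc => //; apply/andP; split; lra.
have [c c0 hc] := exotic_maximal_indic_ge_square.
have [A A0 hA] := weak_bound_lower delta p 2.
rewrite -subr_le0; have -> : delta - (2 * p - 1) = delta + 1 - 2 * p by ring.
apply: (@powR_bounded_le0 _ (A * c `^ p) (C * m) _ 1) => //.
  by rewrite mulr_gt0 ?powR_gt0.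
move=> s s1; have s0 : 0 < s by lra.
apply: (hA c s (T \1_E12)) => // x /andP[sx xs].
by apply: hc => //; lra.
Qed.

(** For f = y^(-2) on [exp(-l), 1] the p-th power of the norm is l, while on ]1, 2[ the maximal
    function is at least of order l, since y f(y) = 1/y. A weak bound would give l^p <= C' l for all
    l >= 1, which fails for p > 1. *)
Lemma weak_type_upper_endpoint p : 1 < p -> ~ weak_type (power_measure (2 * p - 1)) D T p.
Proof.
move=> p1 [C hC]; have p0 : 0 < p by exact: lt_trans p1.
have [c c0 hc] := exotic_kernel_ge_square nu1.
have [A A0 hA] := weak_bound_lower (2 * p - 1) p 2.
suff : p - 1 <= 0 by lra.
apply: (@powR_bounded_le0 _ (A * c `^ p) C _ 1) => //; first by rewrite mulr_gt0 ?powR_gt0.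
move=> l l1; have l0 : 0 < l by lra.
pose d := expR (- l).
have d0 : 0 < d by exact: expR_gt0.
have d1 : d < 1 by rewrite -expR0 ltr_expR oppr_lt0.
pose f (y : measurableTypeR R) : R := if (d <= y) && (y <= 1) then y `^ (- 2) else 0.
have mf : measurable_fun setT f by rewrite /f; meas.
have f0 y : 0 <= f y by rewrite /f; case: ifP => // _; exact: powR_ge0.
have intd c' : 0 <= c' -> (\int[leb]_(y in `[d, 1%R]) (c' * (y - 0)^-1)%:E = (c' * l)%:E)%E.
  by move=> c'0; rewrite integral_cst_inv// !subr0 ln1 expRK sub0r opprK.
have Nf : (\int[power_measure (2 * p - 1)]_y (`|f y| `^ p)%:E = l%:E)%E.
  rewrite integral_power_measure_powR// -[in RHS](mul1r l) -intd//.
  rewrite -(@integral_if _ _ _ leb Rpos `[d, 1]%classic (fun y => (d <= y) && (y <= 1))); last 2 first.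
  - by move=> y; rewrite /= !in_itv/= andbT => /andP[dy _]; exact: lt_le_trans dy.
  - by move=> y _; rewrite /= in_itv.
  apply: eq_integral => y /set_mem; rewrite in_Rpos => y0; rewrite /f; case: ifP => _.
    rewrite ger0_norm ?powR_ge0// -powRrM -gt0_powRD// subr0 mul1r -powR_inv1 ?(ltW y0)//.
    by congr (_ `^ _)%:E; ring.
  by rewrite normr0 powR0 ?gt_eqF// mulr0.
have [|Df mT weakT] := hC f; first by apply/Lfun_power_measureP; [exact: ltW|rewrite Nf ltry].
have weakT' lam : 0 < lam -> ((lam `^ p)%:E *
    power_measure (2 * p - 1) [set x | (lam%:E < `|T f x|)%E] <= (C * l)%:E)%E.
  by move=> lam0; have := weakT lam lam0; rewrite Nf -EFinM.
have := hA (c * l) 1 (T f) (C * l) (mulr_gt0 c0 l0) ltr01 mT _ weakT'.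
have -> : 2 * p - 1 + 1 - 2 * p = 0 by ring.
rewrite powRr0 !mulr1 powRM ?(ltW c0) ?(ltW l0)// => h.
have {}h : A * (c `^ p * l `^ p) <= C * l.
  apply: h => x /andP[x1 x2]; have x0 : 0 < x by lra.
  apply: le_trans (@exotic_maximal_ge_itv f x x d 1 (fun y => c * x `^ (- 2) * (y - 0)^-1) mf f0 Df x0 x0 d0 _).
    by rewrite intd ?mulr_ge0 ?powR_ge0 ?(ltW c0)// lee_fin mulrAC.
  move=> y /andP[dy y1]; have y0 : 0 < y by exact: lt_le_trans dy.
  apply/andP; split; first by rewrite !mulr_ge0 ?powR_ge0 ?(ltW c0)// invr_ge0 subr0 ltW.
  have yx : 0 < y <= 2 * x by apply/andP; split; lra.
  have fy : f y = y `^ (- 2) by rewrite /f dy y1.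
  rewrite fy; apply: le_trans (ler_wpM2r (powR_ge0 _ _) (hc x y x0 yx)).
  rewrite -!mulrA ler_wpM2l ?(ltW c0)// ler_wpM2l ?powR_ge0// subr0.
  rewrite -{2}(powRr1 (ltW y0)) -gt0_powRD// (_ : 1 + - 2 = -1) ?powR_inv1 ?(ltW y0)//; lra.
rewrite -(ler_pM2r l0); apply: le_trans h; rewrite -!mulrA ler_wpM2l ?(ltW A0)//.
rewrite ler_wpM2l ?powR_ge0// -{2}(powRr1 (ltW l0)) -gt0_powRD//.
by rewrite (_ : p - 1 + 1 = p)//; lra.
Qed.

(** The maximal function of the indicator is at least c x^(-2 nu) near 0, and its p-th power against
    x^(2 nu p - 1) is c^p / x. The integral over [exp(-l), 1] is c^p l, unbounded in l. *)
Lemma strong_type_lower_endpoint p : 1 <= p ->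
  ~ strong_type (power_measure (2 * nu * p - 1)) D T p%:E.
Proof.
move=> p1; have p0 : 0 < p by lra.
move=> /strong_type_poweRP => /(_ p1)[C C0 hC].
have [m m0 mE] := pm12 (2 * nu * p - 1).
have [|Df mT] := hC \1_E12 mI12; first by rewrite integral_indic_powR// mE ltry.
rewrite integral_indic_powR// mE -EFinM => strongT.
have [c c0 hc] := exotic_maximal_indic_ge_unit.
suff : (1 : R) <= 0 by rewrite ler10.
apply: (@powR_bounded_le0 _ (c `^ p) (C * m) _ 1) => //; first by rewrite powR_gt0.
move=> l l1; have l0 : 0 < l by lra.
pose d := expR (- l).
have d0 : 0 < d by exact: expR_gt0.
have d1 : d < 1 by rewrite -expR0 ltr_expR oppr_lt0.
rewrite -lee_fin; apply: le_trans strongT.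
rewrite ge0_integral_power_measureT; first last.
- by move=> x; exact: poweR_ge0.
- by meas.
have cp0 := powR_ge0 c p.
have -> : (c `^ p * l `^ 1)%:E = (\int[leb]_(y in `[d, 1%R]) (c `^ p * (y - 0)^-1)%:E)%E.
  by rewrite integral_cst_inv// !subr0 ln1 expRK sub0r opprK powRr1 ?(ltW l0).
apply: (@le_trans _ _ (\int[leb]_(x in `[d, 1%R])
    ((x `^ (2 * nu * p - 1))%:E * `|T \1_E12 x| `^ p))%E); last first.
  apply: ge0_integral_subset => x; rewrite in_Rpos => x0.
    by rewrite mule_ge0 ?poweR_ge0// lee_fin powR_ge0.
  by move: x0; rewrite /= in_itv/= => /andP[dx _]; exact: lt_le_trans dx.
apply: ge0_integral_mono => x; rewrite /= in_itv/= => /andP[dx x1].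
  by rewrite lee_fin mulr_ge0// invr_ge0 subr0 (le_trans (ltW d0)).
have x0 : 0 < x by exact: lt_le_trans dx.
have hT : ((c * x `^ (- (2 * nu)))%:E <= `|T \1_E12 x|)%E.
  by rewrite gee0_abs ?exotic_maximal_ge0//; apply: hc => //; rewrite x0.
have i0 (z : \bar R) : (0 <= z)%E -> z \in `[0%E, +oo%E] by rewrite in_itv/= leey andbT.
have := gt0_ler_poweR (ltW p0) (i0 _ _) (i0 _ (abse_ge0 _)) hT.
rewrite lee_fin mulr_ge0 ?powR_ge0 ?(ltW c0)// => /(_ isT) h.
apply: le_trans (lee_wpmul2l _ h); last by rewrite lee_fin powR_ge0.
rewrite poweR_EFin -EFinM lee_fin powRM ?powR_ge0 ?(ltW c0)// mulrCA ler_wpM2l//.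
rewrite -powRrM -gt0_powRD// subr0 -powR_inv1 ?(ltW x0)//.
by rewrite (_ : _ + _ = -1)//; ring.
Qed.

(** The functions have bounded norms and concentrate at 1, while their maximal functions are at
    least c/(x - 1) on [1 + h, 2]. With h = exp(-l) the integral of this is c l, so linear growth in
    l contradicts a uniform bound. *)
Lemma strong_type_1 delta : ~ strong_type (power_measure delta) D T 1%:E.
Proof.
move=> /strong_type_poweRP => /(_ (lexx 1))[C C0 hC].
have [c c0 hc] := exotic_kernel_ge_diagonal nu1.
pose M : R := 4 `^ `|delta|; have M0 : 0 < M by exact: powR_gt0.
suff : (1 : R) <= 0 by rewrite ler10.
apply: (@powR_bounded_le0 _ (4 `^ (- `|delta|) * c) (C * M) _ 1) => //.
  by rewrite mulr_gt0 ?powR_gt0.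
move=> l l1; have l0 : 0 < l by lra.
pose h := expR (- l).
have h0 : 0 < h by exact: expR_gt0.
have h1 : h < 1 by rewrite -expR0 ltr_expR oppr_lt0.
(* The support stops at 1 + h/2, strictly left of every x >= 1 + h, as the diagonal lower bound asks
   for y < x; the height 2/h normalizes the integral to 1. *)
pose w := 1 + h / 2; have w1 : 1 < w by rewrite /w; lra.
pose f (y : measurableTypeR R) : R := if (1 <= y) && (y <= w) then 2 / h else 0.
have mf : measurable_fun setT f by rewrite /f; meas.
have f0 y : 0 <= f y by rewrite /f; case: ifP => // _; rewrite divr_ge0 ?(ltW h0).
have Nf : (\int[power_measure delta]_y (`|f y| `^ 1)%:E <= M%:E)%E.
  rewrite integral_power_measure_powR//.
  apply: (@le_trans _ _ (\int[leb]_(y in Rpos)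
      (if (1 <= y)%R && (y <= w)%R then M * (2 / h) else 0)%:E)%E).
    apply: ge0_integral_mono => y; rewrite in_Rpos => y0.
      by rewrite lee_fin mulr_ge0 ?powR_ge0.
    rewrite lee_fin powRr1// /f; case: ifP => [/andP[y1 yw]|_]; last by rewrite normr0 mulr0.
    rewrite ger0_norm ?divr_ge0 ?(ltW h0)// ler_wpM2r ?divr_ge0 ?(ltW h0)//.
    have y12 : 1 <= y <= 2 by move: yw; rewrite y1 /w; lra.
    by have /andP[] := powR_itv12 delta y12.
  rewrite (@integral_if _ _ _ leb Rpos `[1, w]%classic); last 2 first.
  - by move=> y; rewrite /= !in_itv/= andbT => /andP[dy _]; exact: lt_le_trans dy.
  - by move=> y _; rewrite /= in_itv.
  rewrite integral_cst_itv ?(ltW w1)// lee_fin.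
  by rewrite (_ : M * (2 / h) * (w - 1) = M)// /w; field; rewrite gt_eqF.
have [|Df mT] := hC f mf; first exact: le_lt_trans Nf (ltry _).
move=> strongT; have {}strongT := le_trans strongT (lee_wpmul2l (_ : 0 <= C%:E)%E Nf).
move: strongT; rewrite lee_fin => /(_ (ltW C0)); rewrite -EFinM -lee_fin.
apply: le_trans; rewrite ge0_integral_power_measureT; first last.
- by move=> x; exact: poweR_ge0.
- by meas.
have Mc0 : 0 <= 4 `^ (- `|delta|) * c by rewrite mulr_ge0 ?powR_ge0 ?(ltW c0).
have -> : (4 `^ (- `|delta|) * c * l `^ 1)%:E =
    (\int[leb]_(y in `[(1 + h)%R, 2%R]) (4 `^ (- `|delta|) * c * (y - 1)^-1)%:E)%E.
  rewrite integral_cst_inv//; [|lra|lra].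
  have -> : 2 - 1 = 1 :> R by lra.
  have -> : 1 + h - 1 = h by lra.
  by rewrite ln1 expRK sub0r opprK powRr1 ?(ltW l0).
apply: (@le_trans _ _ (\int[leb]_(x in `[(1 + h)%R, 2%R])
    ((x `^ delta)%:E * `|T f x| `^ 1))%E); last first.
  apply: ge0_integral_subset => x; rewrite in_Rpos => x0.
    by rewrite mule_ge0 ?poweR_ge0// lee_fin powR_ge0.
  by move: x0; rewrite /= in_itv/= => /andP[dx _]; lra.
apply: ge0_integral_mono => x; rewrite /= in_itv/= => /andP[hx x2].
  by rewrite lee_fin mulr_ge0// invr_ge0; lra.
have x0 : 0 < x by lra.
have x10 : 0 < x - 1 by lra.
rewrite poweRe1// gee0_abs ?exotic_maximal_ge0// -mulrA.
have hT : ((c * (x - 1)^-1)%:E <= T f x)%E.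
  apply: le_trans (@exotic_maximal_ge_itv f (x - 1) x 1 w (fun=> c / (x - 1) * (2 / h)) mf f0 Df x10 x0 ltr01 _).
    rewrite integral_cst_itv ?(ltW w1)// lee_fin.
    by rewrite (_ : c / (x - 1) * (2 / h) * (w - 1) = c / (x - 1))// /w; field; rewrite !gt_eqF.
  move=> y /andP[y1 yw]; rewrite /f y1 yw mulr_ge0 ?divr_ge0 ?(ltW c0) ?(ltW h0) ?(ltW x10)//=.
  apply: ler_wpM2r; first by rewrite divr_ge0 ?(ltW h0).
  by apply: hc => //; move: yw; rewrite /w; lra.
have x12 : 1 <= x <= 2 by apply/andP; split; lra.
have /andP[xd _] := powR_itv12 delta x12.
rewrite EFinM; apply: lee_pmul => //; rewrite lee_fin ?powR_ge0//.
by rewrite divr_ge0 ?(ltW c0) ?(ltW x10).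
Qed.

(** The lower bound c x^(-2 nu) for the maximal function of an indicator must stay bounded as x
    tends to 0. An essential bound excludes only null sets, so exceeding it at s is extended to an
    interval of positive measure. *)
Lemma strong_type_infty_necessary : strong_type (power_measure 0) D T +oo%E -> nu <= 0.
Proof.
move=> [C hC]; have [c c0 hc] := exotic_maximal_indic_ge_unit.
have pmT := @power_measure0_gt0 R.
have N1 : ('N[power_measure 0]_+oo[EFin \o \1_E12] <= 1)%E.
  rewrite unlock pmT; apply/ess_supP; apply: aeW => x.
  by rewrite /= indicE lee_fin; case: (x \in E12); rewrite ?normr1 ?normr0.
have [|Df mT normT] := hC \1_E12.
  apply/andP; split; apply/mem_set => //=.
  by rewrite /finite_norm; apply: le_lt_trans N1 (ltry _).
(* The constant may be negative, and a nonnegative one is needed to multiply the bound on the norm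
   of the indicator. *)
pose B := Num.max C 0.
have {}normT : ('N[power_measure 0]_+oo[T \1_E12] <= B%:E)%E.
  apply: le_trans normT _; apply: (@le_trans _ _ (B%:E * 'N[power_measure 0]_+oo[EFin \o \1_E12])%E).
    by rewrite lee_wpmul2r ?Lnorm_ge0// lee_fin le_max lexx.
  by rewrite -[leRHS]mule1 lee_wpmul2l// lee_fin le_max lexx orbT.
move: normT; rewrite unlock pmT => /ess_supP[A [mA A0 hA]].
suff : 0 <= - (2 * nu) by lra.
apply: (@powR_bounded_ge0 _ c B _ 2^-1) => //.
move=> s /andP[s0 s1]; rewrite leNgt; apply/negP => Bs.
(* Near s the maximal function exceeds B, by continuity of x^(-2 nu). *)
have cs : {for s, continuous (fun x : R => c * x `^ (- (2 * nu)))}.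
  apply: continuousM; first exact: cvg_cst.
  apply/differentiable_continuous/derivable1_diffP.
  by apply: derivable_powR; rewrite in_itv/= andbT.
have [d d0 hd] : exists2 d : R, 0 < d & forall x, s < x < s + d -> B < c * x `^ (- (2 * nu)).
  have /nbhs_ballP[d d0 hd] : \forall x \near s, B < c * x `^ (- (2 * nu)) by exact: cvgr_gt cs _ Bs.
  exists d => // x /andP[sx xd].
  by apply: hd; rewrite /ball/= ltr_distlC; apply/andP; split; lra.
pose r := Num.min (s + d) 1.
have sr : s < r by rewrite lt_min ltrDl d0/=; lra.
have := power_measure_itv_ge 0 s0 sr; apply/negP; rewrite -ltNge.
apply: (@le_lt_trans _ _ 0%E); last first.
  by rewrite lte_fin mulr_gt0 ?subr_gt0// lt_min !powR_gt0// (lt_trans s0).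
rewrite -A0; apply: le_measure; [by apply/mem_set; exact: measurable_itv|by apply/mem_set|].
move=> x; rewrite /= in_itv/= => /andP[sx xr]; apply: hA => /=.
have x0 : 0 < x by exact: lt_trans sx.
move: xr; rewrite lt_min => /andP[xd x1].
rewrite gee0_abs ?exotic_maximal_ge0//; apply/negP; rewrite -ltNge.
apply: lt_le_trans (hc Df x _); last by rewrite x0 ltW.
by rewrite lte_fin; apply: hd; rewrite sx.
Qed.

End necessary_conditions.

(** * Implications between the types, and the conclusion *)

Section type_implications.
Context {R : realType}.
Variables (delta p : R).
Hypothesis p1 : 1 <= p.
Variables (D : set (measurableTypeR R -> R)) (T : (measurableTypeR R -> R) -> measurableTypeR R -> \bar R).

Let p0 : 0 < p. Proof. exact: lt_le_trans p1. Qed.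

Lemma strong_type_weak_type :
  strong_type (power_measure delta) D T p%:E -> weak_type (power_measure delta) D T p.
Proof.
move=> /(strong_type_poweRP _ p1)[C C0 hC]; exists C => f /Lfun_power_measureP[]// mf ff.
have [Df mT hT] := hC f mf ff; split => // lam lam0.
by apply: le_trans hT; exact: powR_measure_gt_le.
Qed.

Lemma weak_type_restricted_weak_type :
  weak_type (power_measure delta) D T p -> restricted_weak_type (power_measure delta) D T p.
Proof.
move=> [C hC]; exists C => E mE fE; apply: hC; apply/Lfun_power_measureP => //.
by split; [exact: measurable_indic|rewrite integral_indic_powR].
Qed.

End type_implications.

Theorem theorem3p2 (R : realType) (nu p delta : R)
    (hnu1 : nu < 1) (hnu0 : nu != 0) (hp : 1 <= p) :
  [/\ strong_type (power_measure delta)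
        (exotic_domain nu) (exotic_maximal nu) p%:E <->
      1 < p /\ 2 * nu * p - 1 < delta < 2 * p - 1,
      weak_type (power_measure delta)
        (exotic_domain nu) (exotic_maximal nu) p <->
      2 * nu * p - 1 <= delta /\
        (if p == 1 then delta <= 2 * p - 1 else delta < 2 * p - 1),
      restricted_weak_type (power_measure delta)
        (exotic_domain nu) (exotic_maximal nu) p <->
      2 * nu * p - 1 <= delta <= 2 * p - 1 &
      strong_type (power_measure 0)
        (exotic_domain nu) (exotic_maximal nu) +oo%E <->
      nu < 0].
Proof.
have p0 : 0 < p by exact: lt_le_trans hp.
have restrictedP : restricted_weak_type (power_measure delta)
    (exotic_domain nu) (exotic_maximal nu) p <-> 2 * nu * p - 1 <= delta <= 2 * p - 1.
  split; first exact: restricted_weak_type_necessary.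
  exact: exotic_maximal_restricted_weak_type.
have weakP : weak_type (power_measure delta) (exotic_domain nu) (exotic_maximal nu) p <->
    2 * nu * p - 1 <= delta /\
      (if p == 1 then delta <= 2 * p - 1 else delta < 2 * p - 1).
  split=> [w|[]]; last exact: exotic_maximal_weak_type.
  have /restrictedP/andP[dl du] := weak_type_restricted_weak_type hp w.
  (* The restricted condition allows delta = 2p - 1 for every p; for p > 1 the power y^(-2) cut off
     near 0 rules it out. *)
  split => //; case: eqVneq => // p_neq1; rewrite lt_neqAle du andbT.
  apply/eqP => dE; rewrite dE in w.
  by apply: weak_type_upper_endpoint w => //; rewrite lt_neqAle eq_sym p_neq1.
split => //.
- split=> [s|[p1 dlu]]; last exact: exotic_maximal_strong_type.
  (* For p = 1 the concentrating indicators exclude strong type whatever delta is. For p > 1 the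
     weak condition is already strict at the upper end, and only the lower endpoint remains to be
     excluded. *)
  have p1 : 1 < p.
    rewrite lt_neqAle hp andbT; apply/eqP => pE; rewrite -pE in s.
    exact: strong_type_1 s.
  split => //; have /weakP[dl] := strong_type_weak_type hp s.
  rewrite gt_eqF// => ->; rewrite andbT lt_neqAle dl andbT.
  apply/eqP => dE; rewrite -dE in s.
  exact: strong_type_lower_endpoint s.
- split=> [s|]; last exact: exotic_maximal_strong_type_infty.
  by rewrite lt_neqAle hnu0/=; exact: strong_type_infty_necessary s.
Qed.
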